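(* Consider the linear equation $$\frac{\partial A(t,p)}{\partial t}=\gamma_N A(t,p)+\int_0^\infty\mathcal V\left(\frac p{p'}\right)A(t,p')\frac{dp'}{p'},\qquad t>0,\ p>0,\qquad(\ast)$$ with $\mathcal V$, $\gamma_N$ and the spaces $L^q_\theta(0,\infty)$, $\mathscr Y_{A,B}$ given in the context. It has the following properties. (Well-posedness) (i) Let $q\ge1$ and $\theta\in(-1,5/2)$. For all non-negative $A_0\in L^q_\theta(0,\infty)$ there exists a unique $A\in C([0,\infty);L^q_\theta(0,\infty))\cap C^1((0,\infty);L^q_\theta(0,\infty))$ with $A(0)=A_0$, satisfying $(\ast)$ in $L^q_\theta(0,\infty)$ and such that $A(t)\ge0$ for all $t>0$. Moreover, for all $T>0$ there exists a constant $C_T>0$ such that $\|A(t)\|_{L^q_\theta}\le C_T\|A_0\|_{L^q_\theta}$ for all $t\in[0,T]$. When $\theta=0$, $$\|A(t)\|_{L^q_0}\le e^{\gamma_N t}\left(1+\|\mathcal V\|_{L^1_0}\left(e^{\|\mathcal V\|_{L^1_0}t}-1\right)\right)\|A_0\|_{L^q_0}\qquad\text{for all }t\ge0.$$ (ii) Let $A,B$ be real exponents with $-\frac52<B<-\frac34<\frac12<A<1$. For all non-negative $A_0\in\mathscr Y_{A,B}$ there exists a unique $A\in C([0,\infty);\mathscr Y_{A,B})\cap C^1((0,\infty);\mathscr Y_{A,B})$ with $A(0)=A_0$, satisfying $(\ast)$ in $\mathscr Y_{A,B}$ and such that $A(t)\ge0$ for all $t>0$. For all $T>0$ there exists a constant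 $C_T>0$ such that $\|A(t)\|_{A,B}\le C_T\|A_0\|_{A,B}$ for all $t\in[0,T]$. (Conservation of wave action) The solutions conserve the wave action: if $A_0\in L^1(0,\infty)$, then $$\int_0^\infty A(t,p)\,dp=\int_0^\infty A_0(p)\,dp\qquad\text{for all }t>0.$$ (Non-conservation of energy) There exists $\kappa>0$ such that, if $A_0\in L^1((0,\infty);p^2dp)$, then for all $t>0$ $$\int_0^\infty A(t,p)p^2\,dp=e^{\kappa t}\int_0^\infty A_0(p)p^2\,dp.$$ (Long time behaviour) If $A_0\in\mathscr Y_{A,B}$, $A_0\ge0$, and the exponents satisfy $-\frac52<B<-\frac34<\frac12<A<1$, then for all $\varphi\in C([0,\infty))\cap L^\infty((0,\infty))$, $$\lim_{t\to\infty}\int_0^\infty A(t,p)\varphi(p)\,dp=\varphi(0)\int_0^\infty A_0(p)\,dp.$$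
   Context: The letter $A$ is used (as in the source) both for the unknown function $A(t,p)$ and for a real exponent in $\mathscr Y_{A,B}$; the meaning is clear from the position. The function $\mathcal V$ on $(0,1)\cup(1,\infty)$: for $0<p<1$, $$\mathcal V(p)=\frac{2\log p}{1+p^2}-\frac{2}{p\sqrt{1+p^2}}\operatorname{arctanh}\frac{p}{\sqrt{1+p^2}}-\frac{2\log p}{1-p^2}+\frac{2}{p\sqrt{1-p^2}}\arctan\frac{p}{\sqrt{1-p^2}},$$ and for $p>1$, $$\mathcal V(p)=-\frac{2\log p}{p(1+p^2)}-\frac{2}{p\sqrt{1+p^2}}\operatorname{arctanh}\frac{1}{\sqrt{1+p^2}}+\frac{2\log p}{p(p^2-1)}+\frac{2}{p\sqrt{p^2-1}}\arctan\frac{1}{\sqrt{p^2-1}}.$$ The constant $\gamma_N<0$ is the one for which $W(s):=\gamma_N+\int_0^\infty\mathcal V(p)p^{s}\frac{dp}p$ satisfies $W(1)=W(2)=0$, i.e. $\gamma_N=-\int_0^\infty\mathcal V(p)\,dp=-\int_0^\infty\mathcal V(p)\,p\,dp$. Spaces: $L^q_\theta(0,\infty)$ is the space of measurable $A$ on $(0,\infty)$ with $\|A\|_{L^q_\theta}^q=\int_0^\infty|A(p)|^qp^{2\theta-1}dp<\infty$. For real $A,B$, $\mathscr Y_{A,B}$ is the space of $g\in L^\infty_{\rm loc}(0,\infty)$ with $$\|g\|_{A,B}=\sup_{0<p<1}\left(p^{-2A}|g(p)|\right)+\sup_{p>1}\left(p^{-2B}|g(p)|\right)<\infty.$$ In the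 last three items $A(t)$ denotes the solution of $(\ast)$ with initial data $A_0$ provided by the well-posedness part (note $L^1(0,\infty)=L^1_{1/2}$ and $L^1((0,\infty);p^2dp)=L^1_{3/2}$). *)

(* Defs.v *)
From HB Require Import structures.
From mathcomp Require Import all_boot all_order all_algebra.
From mathcomp Require Import all_classical all_reals all_analysis.
From mathcomp Require Import ess_sup_inf.

Set Implicit Arguments.
Unset Strict Implicit.
Unset Printing Implicit Defensive.

Import Order.TTheory GRing.Theory Num.Theory.
Import numFieldNormedType.Exports.

Local Open Scope classical_set_scope.
Local Open Scope ring_scope.

Notation Leb := (@lebesgue_measure _).

Definition arctanh (R : realType) (x : R) : R := ln ((1 + x) / (1 - x)) / 2.

(* The value at p = 1, where the kernel is singular, and the values at p <= 0
   are irrelevant: the kernel is only used on (0, +oo), up to a null set. *)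
Definition kerV (R : realType) (p : R) : R :=
  if p < 1 then
      2 * ln p / (1 + p ^+ 2)
    - 2 / (p * Num.sqrt (1 + p ^+ 2)) * arctanh (p / Num.sqrt (1 + p ^+ 2))
    - 2 * ln p / (1 - p ^+ 2)
    + 2 / (p * Num.sqrt (1 - p ^+ 2)) * atan (p / Num.sqrt (1 - p ^+ 2))
  else if 1 < p then
    - (2 * ln p / (p * (1 + p ^+ 2)))
    - 2 / (p * Num.sqrt (1 + p ^+ 2)) * arctanh (1 / Num.sqrt (1 + p ^+ 2))
    + 2 * ln p / (p * (p ^+ 2 - 1))
    + 2 / (p * Num.sqrt (p ^+ 2 - 1)) * atan (1 / Num.sqrt (p ^+ 2 - 1))
  else 0.

Definition gammaN (R : realType) : R :=
  - (\int[Leb]_(p in `]0, +oo[) kerV p)%R.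

(* A space of (classes of) real functions on (0, +oo): elements are represented
   by functions R -> R whose values outside (0, +oo) are ignored, and equality
   in the space is [ae_eq0oo]. *)
Record fspace (R : realType) := FSpace {
  fmem : set (R -> R);
  fnorm : (R -> R) -> \bar R }.

Definition ae_eq0oo (R : realType) (f g : R -> R) : Prop :=
  {ae Leb, forall p : R, 0 < p -> f p = g p}.

Definition ae_ge0 (R : realType) (f : R -> R) : Prop :=
  {ae Leb, forall p : R, 0 < p -> 0 <= f p}.

Definition Lqnorm (R : realType) (q theta : R) (f : R -> R) : \bar R :=
  ((\int[Leb]_(p in `]0%R, +oo[)
      (`|f p| `^ q * p `^ (2 * theta - 1))%:E) `^ q^-1)%E.

Definition Lq (R : realType) (q theta : R) : fspace R :=
  FSpace [set f : R -> R | measurable_fun (`]0, +oo[ : set R) f /\ (Lqnorm q theta f < +oo)%E]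
         (Lqnorm q theta).

(* Suprema are essential suprema, since elements of L^oo_loc are classes of
   functions; extending the nonnegative quantities by 0 outside the given
   interval does not change their essential suprema. *)
Definition weighted_sup (R : realType) (I : set R) (c : R) (g : R -> R)
    : \bar R :=
  ess_sup Leb (EFin \o ((fun p : R => p `^ (- (2 * c)) * `|g p|) \_ I)).

Definition Ynorm (R : realType) (a b : R) (g : R -> R) : \bar R :=
  (weighted_sup `]0%R, 1%R[ a g + weighted_sup `]1%R, +oo[ b g)%E.

Definition Linfty_loc (R : realType) (g : R -> R) : Prop :=
  measurable_fun (`]0, +oo[ : set R) g /\
  forall K : set R, compact K -> K `<=` `]0, +oo[ ->
    exists M : R, {ae Leb, forall p : R, K p -> `|g p| <= M}.

Definition Yspace (R : realType) (a b : R) : fspace R :=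
  FSpace [set g | Linfty_loc g /\ (Ynorm a b g < +oo)%E] (Ynorm a b).

Definition continuous_into (R : realType) (X : fspace R) (I : set R)
    (A : R -> R -> R) : Prop :=
  (forall t, I t -> fmem X (A t)) /\
  (forall t, I t ->
     (fun s => fnorm X (A s \- A t)) @ within I (nbhs t) --> 0%E).

Definition derivative_into (R : realType) (X : fspace R)
    (A D : R -> R -> R) : Prop :=
  forall t : R, 0 < t ->
    (fun h : R => fnorm X (fun p => (A (t + h) p - A t p) / h - D t p))
      @ (0 : R)^' --> 0%E.

(* The equation is stated in \bar R: the left-hand side being finite, it
   entails that the integral converges for almost every p. *)
Definition satisfies_eqn (R : realType) (A D : R -> R -> R) : Prop :=
  forall t : R, 0 < t ->
    {ae Leb, forall p : R, 0 < p ->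
      (D t p)%:E = ((gammaN R * A t p)%:E
        + \int[Leb]_(p' in `]0%R, +oo[) (kerV (p / p') * A t p' / p')%:E)%E}.

Definition nonneg_solution (R : realType) (X : fspace R) (A0 : R -> R)
    (A : R -> R -> R) : Prop :=
  [/\ continuous_into X `[0, +oo[ A,
      ae_eq0oo (A 0) A0,
      exists D : R -> R -> R,
        [/\ continuous_into X `]0, +oo[ D,
            derivative_into X A D &
            satisfies_eqn A D] &
      forall t : R, 0 < t -> ae_ge0 (A t)].

Definition well_posed_in (R : realType) (X : fspace R) : Prop :=
  forall A0 : R -> R, fmem X A0 -> ae_ge0 A0 ->
    exists A : R -> R -> R, nonneg_solution X A0 A /\
      forall A' : R -> R -> R, nonneg_solution X A0 A' ->
        forall t : R, 0 <= t -> ae_eq0oo (A' t) (A t).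

Definition bounded_on_finite_times (R : realType) (X : fspace R) : Prop :=
  forall T : R, 0 < T -> exists C : R, 0 < C /\
    forall (A0 : R -> R) (A : R -> R -> R),
      fmem X A0 -> ae_ge0 A0 -> nonneg_solution X A0 A ->
      forall t : R, 0 <= t <= T ->
        (fnorm X (A t) <= C%:E * fnorm X A0)%E.

(* Main.v *)
Require Import Defs.
From HB Require Import structures.
From mathcomp Require Import all_boot all_order all_algebra.
From mathcomp Require Import all_classical all_reals all_analysis.
From mathcomp Require Import measurable_realfun ess_sup_inf ring lra.
Import Order.TTheory GRing.Theory Num.Theory.
Import numFieldNormedType.Exports.
Local Open Scope classical_set_scope.
Local Open Scope ring_scope.

(** With the measure dp/p on (0, +oo), the integral term of the equation is the
    multiplicative convolution T A with the kernel V, so that the solution must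
    be A(t) = exp(gamma t) * sum_n t^n/n! T^n A0.  The proof makes this formula
    do all the work.

    Everything rests on the Mellin transform K(s) = int_0^oo V(u) u^s du/u of
    the kernel ([mellinV]).  V is nonnegative ([kerV_ge0]), it is
    O(u^(2 - eta)) at 0, it has an inverse square root singularity at 1, and
    V(1/u) = u^3 V(u) ([kerV_inv]); hence K(s) is finite for
    -2 < s < 5 ([mellinV_lty]), a range that contains all the exponents below.
    By definition gamma = - K(1).

    Spaces.  T maps L^q_theta to itself with norm at most K(2 theta / q) by
    Jensen's inequality ([mconv_jensen]), and it maps functions bounded by a
    power p^c to functions bounded by K(-c) p^c ([mconv_le_powR]).  The record
    [good_space] collects what these two facts are used for: a lattice norm
    satisfying a form of monotone convergence, on which T is bounded.
    Both families of spaces are instances ([good_Lq], [good_Y]).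

    Existence.  As all terms are nonnegative, the series above and all its
    formal time derivatives converge at almost every p ([regular_ae]).  At such
    a p the solution is an honest analytic function of t, with a second-order
    Taylor bound whose constant, as a function of p, has a finite norm
    ([flow_taylor_norm]); this is the differentiability in the space.

    Uniqueness.  The norm f(t) of the difference of two solutions satisfies
    f(t + h) <= (1 + h (|gamma| + |T|)) f(t) + o(h), which forces f = 0
    ([gronwall_le0], [nonneg_solution_unique]).  So every solution is the
    explicit one, and the bounds on finite times are read off the series.  For
    theta = 0 the series gives exp(gamma t) exp(n t) with n = K(0) the L^1_0
    norm of V; the bound to be proved is the weaker one, because n >= 1
    ([mellinV_0_ge1]).

    Moments.  T multiplies int A p^s dp/p by K(s), so that this moment of the
    solution is exp((gamma + K(s)) t) times the initial one ([flow_moment]).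
    For s = 1 the rate vanishes: wave action is conserved.  For s = 3 it is
    K(3) - K(1) > 0: energy grows.  For s = 3/2 it is K(3/2) - K(1) < 0: the
    integral of A(t) p^(1/2) tends to 0 while that of A(t) does not change, so
    that A(t) dp concentrates at p = 0.  Both signs come from folding the
    integral onto (0, 1) by the symmetry of V, which turns K(s) into
    int_0^1 V(u) (u^s + u^(3 - s)) du/u, and from the convexity in s of
    u^s + u^(3 - s) ([mellinV_lt]). *)

Set Implicit Arguments.
Unset Strict Implicit.
Unset Printing Implicit Defensive.

(** * Integration against dp/p on the half-line, and multiplicative convolution *)

Section haar.
Context {R : realType}.
Local Notation D := (`]0, +oo[%classic : set R).

Lemma measurable_fun_invr : measurable_fun [set: R] (fun x : R => x^-1).
Proof.
rewrite (_ : (fun x : R => x^-1) = (fun x => x * (x ^+ 2) `^ (-1))).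
  apply: measurable_funM => //.
  have m2 : measurable_fun [set: R] (fun x : R => x ^+ 2) by exact: measurable_funX.
  exact: (measurableT_comp (measurable_powR (-1)) m2).
apply/funext => x; rewrite powR_inv1 ?sqr_ge0//.
have [->|x0] := eqVneq x 0; first by rewrite invr0 mul0r.
by rewrite expr2 invfM mulrA divff// mul1r.
Qed.

(** The integral for the Haar measure dp/p of the multiplicative group
    (0, +oo). *)
Definition haar (f : R -> \bar R) : \bar R :=
  (\int[Leb]_(p in `]0%R, +oo[) (f p * (p^-1)%:E))%E.

Lemma measurable_haar_integrand (f : R -> \bar R) : measurable_fun D f ->
  measurable_fun D (fun p => f p * (p^-1)%:E)%E.
Proof.
move=> mf; apply: emeasurable_funM => //.
apply/measurable_EFinP; apply: measurable_funTS; exact: measurable_fun_invr.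
Qed.

Lemma lebesgue_measureZ (c : R) (c0 : 0 < c) (A : set R) : measurable A ->
  (Leb A = c%:E * pushforward Leb ( *%R c : R -> measurableTypeR R) A)%E.
Proof.
move=> mA.
have mphi : measurable_fun [set: measurableTypeR R] ( *%R c : R -> measurableTypeR R).
  exact: measurable_funM.
have := @lebesgue_measure_unique R (mscale (NngNum (ltW c0)) (pushforward Leb ( *%R c : R -> measurableTypeR R))).
move=> /(_ mphi); apply => //.
move=> _ [[a b]] _ <- /=; rewrite /mscale/= /pushforward.
rewrite (_ : ( *%R c) @^-1` _ = `]a / c, b / c]%classic); last first.
  by apply/seteqP; split => x /=; rewrite !in_itv/= ltr_pdivrMr// ler_pdivlMr// (mulrC x).
rewrite !lebesgue_measure_itv/= !lte_fin ltr_pM2r ?invr_gt0//.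
case: ifPn => _; last by rewrite mule0.
by rewrite -EFinB -EFinM -mulrBl mulrCA divff ?mulr1// gt_eqF.
Qed.

Lemma preimage_mul_pos (c : R) : 0 < c -> ( *%R c) @^-1` D = D.
Proof.
move=> c0; apply/seteqP; split => x /=; rewrite !in_itv/= !andbT.
  by rewrite pmulr_rgt0.
by move=> x0; rewrite mulr_gt0.
Qed.

(** Translation invariance of the Haar measure: the Jacobian of p |-> c p is
    absorbed by the weight 1/p. *)
Lemma haar_dilation (c : R) (f : R -> \bar R) : 0 < c ->
  measurable_fun D f -> (forall p, 0 < p -> (0 <= f p)%E) ->
  haar (fun p => f (c * p)) = haar f.
Proof.
move=> c0 mf f0.
have mphi : measurable_fun [set: measurableTypeR R] ( *%R c : R -> measurableTypeR R).
  exact: measurable_funM.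
have mg := measurable_haar_integrand mf.
have g0 : forall x, D x -> (0 <= f x * (x^-1)%:E)%E.
  move=> x; rewrite /= in_itv/= andbT => x0.
  by rewrite mule_ge0 ?f0// lee_fin invr_ge0 ltW.
rewrite /haar [RHS](@eq_measure_integral _ _ _ _ (mscale (NngNum (ltW c0)) (pushforward Leb ( *%R c : R -> measurableTypeR R)))) => //; last first.
  by move=> A mA _; exact: lebesgue_measureZ.
rewrite ge0_integral_mscale// ge0_integral_pushforward//; last first.
  by move=> x /[!inE] /g0.
rewrite preimage_mul_pos// -ge0_integralZl//=.
- apply: eq_integral => x /[!inE]; rewrite /= in_itv/= andbT => x0.
  rewrite muleCA -EFinM; congr (_ * _%:E)%E.
  by rewrite invfM mulrA divff ?mul1r// gt_eqF.
- rewrite -[X in measurable_fun X _](preimage_mul_pos c0).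
  apply: measurable_comp mg _ => //.
  + by move=> _ [x + <-].
- move=> x; rewrite in_itv/= andbT => x0; apply: g0.
  by rewrite /= in_itv/= andbT mulr_gt0.
- by rewrite lee_fin ltW.
Qed.

Lemma measurable_fun_ratio :
  measurable_fun [set: R * R] (fun z : R * R => z.1 / z.2).
Proof.
apply: measurable_funM; first exact: measurable_fst.
exact: (measurableT_comp measurable_fun_invr measurable_snd).
Qed.

(** Tonelli's theorem for dp/p * dq/q, obtained from that for Lebesgue measure
    by moving the weights and the restriction to p, q > 0 into the integrand. *)
Lemma haar_fubini (F : R * R -> \bar R) : measurable_fun [set: R * R] F ->
  (forall z, 0 <= F z)%E ->
  haar (fun p => haar (fun q => F (p, q))) = haar (fun q => haar (fun p => F (p, q))).
Proof.
move=> mF F0.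
have mD : measurable D by [].
pose G (z : R * R) : \bar R := (F z * (z.1^-1 * z.2^-1 * \1_D z.1 * \1_D z.2)%:E)%E.
have mG : measurable_fun [set: R * R] G.
  apply: emeasurable_funM => //; apply/measurable_EFinP.
  apply: measurable_funM; first apply: measurable_funM; first apply: measurable_funM.
  - exact: (measurableT_comp measurable_fun_invr measurable_fst).
  - exact: (measurableT_comp measurable_fun_invr measurable_snd).
  - exact: (measurableT_comp (measurable_indic mD) measurable_fst).
  - exact: (measurableT_comp (measurable_indic mD) measurable_snd).
have G0 z : (0 <= G z)%E.
  rewrite /G !indicE; have [z1|z1] := boolP (z.1 \in D); last by rewrite mulr0 mul0r mule0.
  have [z2|z2] := boolP (z.2 \in D); last by rewrite mulr0 mule0.
  move: z1 z2; rewrite !inE/= !in_itv/= !andbT => z1 z2.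
  by rewrite mule_ge0// lee_fin !mulr1 mulr_ge0// invr_ge0 ltW.

have Lint p : D p -> (\int[Leb]_q G (p, q) = haar (fun q => F (p, q)) * (p^-1)%:E)%E.
  move=> Dp; rewrite /haar -ge0_integralZr//.
  - rewrite [RHS]integral_mkcond; apply: eq_integral => q _.
    rewrite patchE /G /= !indicE mem_set// mulr1.
    by case: ifPn => _; [rewrite mulr1 -muleA -EFinM mulrC | rewrite mulr0 mule0].
  - apply: measurable_haar_integrand; apply: measurable_funTS.
    exact: measurableT_comp mF (pair1_measurable p).
  - move=> x; rewrite /= in_itv/= andbT => x0.
    by rewrite mule_ge0// lee_fin invr_ge0 ltW.
  - by move: Dp; rewrite /= in_itv/= andbT => x0; rewrite lee_fin invr_ge0 ltW.
have Rint q : D q -> (\int[Leb]_p G (p, q) = haar (fun p => F (p, q)) * (q^-1)%:E)%E.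
  move=> Dq; rewrite /haar -ge0_integralZr//.
  - rewrite [RHS]integral_mkcond; apply: eq_integral => p _.
    rewrite patchE /G /= !indicE (mem_set Dq) mulr1.
    by case: ifPn => _; [rewrite mulr1 -muleA -EFinM | rewrite mulr0 mule0].
  - apply: measurable_haar_integrand; apply: measurable_funTS.
    exact: measurableT_comp mF (pair2_measurable q).
  - move=> x; rewrite /= in_itv/= andbT => x0.
    by rewrite mule_ge0// lee_fin invr_ge0 ltW.
  - by move: Dq; rewrite /= in_itv/= andbT => x0; rewrite lee_fin invr_ge0 ltW.
transitivity (\int[Leb]_p \int[Leb]_q G (p, q))%E.
  rewrite [LHS]integral_mkcond; apply: eq_integral => p _; rewrite patchE.
  case: ifPn => [/[!inE] Dp|Dp]; first by rewrite Lint.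
  by apply/esym/integral0_eq => q _; rewrite /G/= !indicE (negbTE Dp) mulr0 mul0r mule0.
rewrite (fubini_tonelli (m1 := Leb) (m2 := Leb) G)//.
rewrite [RHS]integral_mkcond; apply: eq_integral => q _; rewrite patchE.
case: ifPn => [/[!inE] Dq|Dq]; first by rewrite Rint.
by apply: integral0_eq => p _; rewrite /G/= !indicE (negbTE Dq) mulr0 mule0.
Qed.

Lemma measurable_haar2 (F : R * R -> \bar R) : measurable_fun [set: R * R] F ->
  (forall z, 0 <= F z)%E ->
  measurable_fun [set: R] (fun p => haar (fun q => F (p, q))).
Proof.
move=> mF F0.
have mD : measurable D by [].
pose G (z : R * R) : \bar R := (F z * (z.2^-1 * \1_D z.2)%:E)%E.
have mG : measurable_fun [set: R * R] G.
  apply: emeasurable_funM => //; apply/measurable_EFinP.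
  apply: measurable_funM.
  - exact: (measurableT_comp measurable_fun_invr measurable_snd).
  - exact: (measurableT_comp (measurable_indic mD) measurable_snd).
have G0 z : (0 <= G z)%E.
  rewrite /G !indicE.
  have [z2|z2] := boolP (z.2 \in D); last by rewrite mulr0 mule0.
  move: z2; rewrite !inE/= !in_itv/= !andbT => z2.
  by rewrite mule_ge0// lee_fin !mulr1 invr_ge0 ltW.
rewrite (_ : (fun _ => _) = fubini_F Leb G).
  exact: measurable_fun_fubini_tonelli_F.
apply/funext => p; rewrite /fubini_F /haar [LHS]integral_mkcond.
congr (integral _ _ _); apply/funext => q.
by rewrite patchE /G/= indicE; case: ifPn => _; rewrite ?mulr1// mulr0 mule0.
Qed.

(** The integral operator of the equation when k is the kernel. *)
Definition mconv (k f : R -> R) (p : R) : \bar R :=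
  haar (fun q => (k (p / q) * f q)%:E).

Section mconv.
Variables (k f : R -> R).
Hypotheses (mk : measurable_fun [set: R] k) (mf : measurable_fun [set: R] f).
Hypotheses (k0 : forall x, 0 <= k x) (f0 : forall x, 0 <= f x).

Lemma haar_ge0 (g : R -> \bar R) : (forall p, 0 < p -> (0 <= g p)%E) -> (0 <= haar g)%E.
Proof.
move=> g0; apply: integral_ge0 => p; rewrite /= in_itv/= andbT => p0.
by rewrite mule_ge0 ?g0// lee_fin invr_ge0 ltW.
Qed.

Lemma eq_haar (g h : R -> \bar R) : (forall p, 0 < p -> g p = h p) -> haar g = haar h.
Proof.
move=> gh; apply: eq_integral => p; rewrite inE /= in_itv/= andbT => p0.
by rewrite gh.
Qed.

Lemma haarZ (c : R) (g : R -> \bar R) : 0 <= c -> measurable_fun D g ->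
  (forall p, 0 < p -> (0 <= g p)%E) -> haar (fun p => c%:E * g p)%E = (c%:E * haar g)%E.
Proof.
move=> c0 mg g0; rewrite /haar -ge0_integralZl//.
- by apply: eq_integral => p _; rewrite muleA.
- exact: measurable_haar_integrand.
- by move=> p; rewrite /= in_itv/= andbT => p0; rewrite mule_ge0 ?g0// lee_fin invr_ge0 ltW.
Qed.

Lemma measurable_mconv_integrand :
  measurable_fun [set: R * R] (fun z => (k (z.1 / z.2) * f z.2)%:E).
Proof.
apply/measurable_EFinP; apply: measurable_funM.
  exact: (measurableT_comp mk measurable_fun_ratio).
exact: (measurableT_comp mf measurable_snd).
Qed.

Lemma measurable_mconv : measurable_fun [set: R] (mconv k f).
Proof.
apply: (measurable_haar2 measurable_mconv_integrand) => z.
by rewrite lee_fin mulr_ge0.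
Qed.

Lemma mconv_ge0 p : (0 <= mconv k f p)%E.
Proof. by apply: haar_ge0 => q _; rewrite lee_fin mulr_ge0. Qed.

(** Tonelli and dilation invariance: the total mass of a convolution is the
    product of the total masses. *)
Lemma haar_mconv :
  haar (mconv k f) = (haar (EFin \o k) * haar (EFin \o f))%E.
Proof.
rewrite [LHS](haar_fubini measurable_mconv_integrand); last first.
  by move=> z; rewrite lee_fin mulr_ge0.
have K0 := @haar_ge0 (EFin \o k) (fun p _ => k0 p).
have mfD : measurable_fun D (EFin \o f).
  by apply/measurable_EFinP; exact: measurable_funTS.
rewrite {2}/haar -ge0_integralZl//; last 2 first.
  - exact: measurable_haar_integrand.
  - move=> p; rewrite /= in_itv/= andbT => p0.
    by rewrite mule_ge0// lee_fin ?f0// invr_ge0 ltW.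
apply: eq_integral => q; rewrite inE/= in_itv/= andbT => q0.
rewrite muleA; congr (_ * _)%E.
have mkD : measurable_fun D (EFin \o k).
  by apply/measurable_EFinP; exact: measurable_funTS.
rewrite -(@haar_dilation q^-1 (EFin \o k)) ?invr_gt0//=.
rewrite muleC -haarZ//.
- by apply: eq_haar => p p0; rewrite -EFinM mulrC (mulrC p).
- apply/measurable_EFinP; apply: measurable_funTS; apply: (measurableT_comp mk).
  exact: measurable_funM.
- by move=> p p0; rewrite lee_fin.
- by move=> p p0; rewrite lee_fin.
Qed.

End mconv.

Lemma le_haar (g h : R -> \bar R) : measurable_fun D g -> measurable_fun D h ->
  (forall p, 0 < p -> (0 <= g p)%E) -> (forall p, 0 < p -> (g p <= h p)%E) ->
  (haar g <= haar h)%E.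
Proof.
move=> mg mh g0 gh; apply: ge0_le_integral => //.
- by move=> p; rewrite /= in_itv/= andbT => p0; rewrite mule_ge0 ?g0// lee_fin invr_ge0 ltW.
- exact: measurable_haar_integrand.
- exact: measurable_haar_integrand.
- move=> p; rewrite /= in_itv/= andbT => p0.
  by rewrite lee_wpmul2r ?gh// lee_fin invr_ge0 ltW.
Qed.

Lemma haarD (g h : R -> \bar R) : measurable_fun D g -> measurable_fun D h ->
  (forall p, 0 < p -> (0 <= g p)%E) -> (forall p, 0 < p -> (0 <= h p)%E) ->
  haar (fun p => g p + h p)%E = (haar g + haar h)%E.
Proof.
move=> mg mh g0 h0; rewrite /haar -ge0_integralD//.
- apply: eq_integral => p; rewrite inE /= in_itv/= andbT => p0.
  by rewrite ge0_muleDl ?g0 ?h0.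
- by move=> p; rewrite /= in_itv/= andbT => p0; rewrite mule_ge0 ?g0// lee_fin invr_ge0 ltW.
- exact: measurable_haar_integrand.
- by move=> p; rewrite /= in_itv/= andbT => p0; rewrite mule_ge0 ?h0// lee_fin invr_ge0 ltW.
- exact: measurable_haar_integrand.
Qed.

Section inv.
Variable f : R -> R.
Hypotheses (mf : measurable_fun [set: R] f) (f0 : forall x, 0 <= f x).

(** Inversion invariance follows from dilation invariance by uniqueness of the
    Haar measure: integrating f(p) h(pq) in both orders, for a test function h
    of finite nonzero mass, compares the integral of f with that of f(1/p). *)
Lemma haar_inv : haar (fun p => (f p^-1)%:E) = haar (EFin \o f).
Proof.
(* any measurable set of finite nonzero Haar measure would do *)
pose h : R -> R := \1_(`[1, 2]%classic : set R).
have mh : measurable_fun [set: R] h by exact: measurable_indic.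
have h0 x : 0 <= h x by rewrite /h indicE.
have m2 : measurable_fun [set: R * R] (fun z => z.1 * z.2).
  by apply: measurable_funM; [exact: measurable_fst|exact: measurable_snd].
have mfi : measurable_fun [set: R] (fun p => f p^-1).
  exact: (measurableT_comp mf measurable_fun_invr).
have mfD : measurable_fun D (EFin \o f).
  by apply/measurable_EFinP; exact: measurable_funTS.
have mhD : measurable_fun D (EFin \o h).
  by apply/measurable_EFinP; exact: measurable_funTS.
have H1 : (haar (EFin \o h) <= 1)%E.
  apply: (@le_trans _ _ (\int[Leb]_(p in D) (h p)%:E)%E).
    apply: ge0_le_integral => //.
    - by move=> p; rewrite /= in_itv/= andbT => p0; rewrite mule_ge0 ?lee_fin// invr_ge0 ltW.
    - exact: measurable_haar_integrand.
    - move=> p; rewrite /= in_itv/= andbT => p0; rewrite /= -EFinM lee_fin.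
      have [p1|p1] := leP 1 p; first by rewrite ler_piMr// invf_le1.
      by rewrite /h indicE memNset ?mul0r//= in_itv/= leNgt p1.
  rewrite integral_indic//= -[X in (_ <= X)%E]mule1.
  have -> : (1 * 1 = Leb (`[1%R, 2%R]%classic : set R))%E.
    by rewrite lebesgue_measure_itv/= lte_fin ltrDl ltr01 -EFinB mule1; congr (_%:E); ring.
  by apply: le_measure; rewrite ?inE//; exact: measurableI.
have H0 : (0 < haar (EFin \o h))%E.
  apply: (@lt_le_trans _ _ (\int[Leb]_(p in `[1%R, 2%R]) (2^-1)%:E)%E).
    rewrite integral_cst//= lebesgue_measure_itv/= lte_fin ltrDl ltr01 -EFinB -EFinM lte_fin.
    by lra.
  have h12 : (\int[Leb]_(p in `[1%R, 2%R]) (2^-1)%:E <= \int[Leb]_(p in `[1%R, 2%R]) ((h p)%:E * (p^-1)%:E))%E.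
    apply: ge0_le_integral => //.
    - apply: emeasurable_funM; first by apply/measurable_EFinP; exact: measurable_funTS.
      by apply/measurable_EFinP; apply: measurable_funTS; exact: measurable_fun_invr.
    - move=> p; rewrite /= in_itv/= => /andP[p1 p2]; rewrite -EFinM lee_fin.
      rewrite /h indicE mem_set/= ?in_itv/= ?p1 ?p2// mul1r lef_pV2// posrE//.
      exact: lt_le_trans p1.
  apply: (le_trans h12); apply: ge0_subset_integral => //.
  - exact: measurable_haar_integrand.
  - by move=> p; rewrite /= in_itv/= andbT => p0; rewrite mule_ge0 ?lee_fin// invr_ge0 ltW.
  - by move=> p; rewrite /= !in_itv/= => /andP[p1 _]; rewrite andbT (lt_le_trans _ p1).
have E1 : haar (fun p => haar (fun q => (f p * h (p * q))%:E)) = (haar (EFin \o h) * haar (EFin \o f))%E.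
  rewrite -[haar (EFin \o h)]fineK; last by rewrite ge0_fin_numE ?ltW//; apply: le_lt_trans H1 _; rewrite ltry.
  rewrite -haarZ ?fine_ge0 ?ltW//; last by move=> p p0; rewrite lee_fin.
  apply: eq_haar => p p0.
  rewrite fineK; last by rewrite ge0_fin_numE ?ltW//; apply: le_lt_trans H1 _; rewrite ltry.
  under eq_haar do rewrite EFinM.
  rewrite haarZ//; last 2 first.
  - apply/measurable_EFinP; apply: measurable_funTS; apply: (measurableT_comp mh).
    exact: measurable_funM.
  - by move=> q q0; rewrite lee_fin.
  rewrite (@haar_dilation p (EFin \o h))//=; last by move=> q _; rewrite lee_fin.
  by rewrite muleC.
have E2 : haar (fun p => haar (fun q => (f p * h (p * q))%:E)) = (haar (EFin \o h) * haar (fun p => (f p^-1)%:E))%E.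
  rewrite (@haar_fubini (fun z => (f z.1 * h (z.1 * z.2))%:E)); last 2 first.
  - apply/measurable_EFinP; apply: measurable_funM.
      exact: (measurableT_comp mf measurable_fst).
    exact: (measurableT_comp mh m2).
  - by move=> z; rewrite lee_fin mulr_ge0.
  transitivity (haar (fun q => haar (fun p => (f (q^-1 * p) * h p)%:E))).
    apply: eq_haar => q q0 /=.
    rewrite -(@haar_dilation q^-1 (fun p => (f p * h (p * q))%:E)) ?invr_gt0//.
    + by apply: eq_haar => p p0; rewrite mulrAC mulVf ?mul1r// gt_eqF.
    + apply/measurable_EFinP; apply: measurable_funTS; apply: measurable_funM => //.
      by apply: (measurableT_comp mh); exact: measurable_funM.
    + by move=> p p0; rewrite lee_fin mulr_ge0.
  rewrite (@haar_fubini (fun z => (f (z.1^-1 * z.2) * h z.2)%:E)); last 2 first.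
  - apply/measurable_EFinP; apply: measurable_funM.
      apply: (measurableT_comp mf); apply: measurable_funM.
        exact: (measurableT_comp measurable_fun_invr measurable_fst).
      exact: measurable_snd.
    exact: (measurableT_comp mh measurable_snd).
  - by move=> z; rewrite lee_fin mulr_ge0.
  rewrite /=.
  transitivity (haar (fun p => (h p)%:E * haar (fun q => (f q^-1)%:E))%E).
    apply: eq_haar => p p0; rewrite -(@haar_dilation p^-1 (fun q => (f q^-1)%:E)) ?invr_gt0//.
    + rewrite -haarZ//; last 2 first.
      * apply/measurable_EFinP; apply: measurable_funTS; apply: (measurableT_comp mfi).
        exact: measurable_funM.
      * by move=> q q0; rewrite lee_fin.
      by apply: eq_haar => q q0; rewrite -EFinM mulrC invfM invrK (mulrC q^-1).
    + by apply/measurable_EFinP; apply: measurable_funTS.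
    + by move=> q q0; rewrite lee_fin.
  rewrite /haar -ge0_integralZr//.
  - by apply: eq_integral => p _; rewrite muleAC.
  - exact: measurable_haar_integrand.
  - by move=> p; rewrite /= in_itv/= andbT => p0; rewrite mule_ge0 ?lee_fin// invr_ge0 ltW.
  - by apply: haar_ge0 => p p0; rewrite lee_fin.
have Hf : haar (EFin \o h) \is a fin_num.
  by rewrite ge0_fin_numE ?ltW//; apply: le_lt_trans H1 _; rewrite ltry.
by apply/eqP; rewrite eq_le; apply/andP; split; rewrite -(lee_pmul2l Hf H0) -E2 E1.
Qed.

End inv.

(** Since p^c = (p/q)^c q^c, multiplication by a power is compatible with
    convolution; weights can be moved from the function to the kernel. *)
Lemma mconv_powR (k f : R -> R) (c p : R) : measurable_fun [set: R] k -> measurable_fun [set: R] f ->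
  (forall x, 0 <= k x) -> (forall x, 0 <= f x) -> 0 < p ->
  ((p `^ c)%:E * mconv k f p)%E = mconv (fun u => k u * u `^ c) (fun q => f q * q `^ c) p.
Proof.
move=> mk mf k0 f0 p0; rewrite /mconv -haarZ ?powR_ge0//.
- apply: eq_haar => q q0; rewrite -EFinM; congr (_%:E).
  have -> : p `^ c = (p / q) `^ c * q `^ c.
    by rewrite -powRM ?divfK ?gt_eqF// ltW// divr_gt0.
  by ring.
- apply/measurable_EFinP; apply: measurable_funTS; apply: measurable_funM => //.
  apply: (measurableT_comp mk); apply: measurable_funM => //.
  exact: measurable_fun_invr.
- by move=> q q0; rewrite lee_fin mulr_ge0.
Qed.

Lemma haar_refl (k : R -> R) (p : R) : measurable_fun [set: R] k ->
  (forall x, 0 <= k x) -> 0 < p ->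
  haar (fun q => (k (p / q))%:E) = haar (EFin \o k).
Proof.
move=> mk k0 p0; rewrite -(haar_inv mk k0).
rewrite -(@haar_dilation p^-1 (fun q => (k q^-1)%:E)) ?invr_gt0//.
- by apply: eq_haar => q q0; rewrite invfM invrK.
- apply/measurable_EFinP; apply: measurable_funTS.
  exact: (measurableT_comp mk measurable_fun_invr).
- by move=> q q0; rewrite lee_fin.
Qed.

(** The graph of x^q lies above its tangent at l; a rearranged form of Young's
    inequality. *)
Lemma powR_tangent (q l x : R) : 1 <= q -> 0 < l -> 0 <= x ->
  q * l `^ (q - 1) * x <= x `^ q + (q - 1) * l `^ q.
Proof.
move=> q1 l0 x0; have q0 : 0 < q by exact: lt_le_trans q1.
move: q1; rewrite le_eqVlt => /predU1P[<-|q1].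
  by rewrite subrr powRr0 powRr1// mul0r addr0 !mul1r.
have qc : 0 < q / (q - 1) by rewrite divr_gt0// subr_gt0.
have := @conjugate_powR R x (l `^ (q - 1)) q (q / (q - 1)) x0 (powR_ge0 _ _) q0 qc.
have q10 : q - 1 != 0 by rewrite gt_eqF// subr_gt0.
have qn0 : q != 0 by rewrite gt_eqF.
have -> : q^-1 + (q / (q - 1))^-1 = 1 by field; rewrite qn0 q10.
rewrite -powRrM (_ : (q - 1) * (q / (q - 1)) = q); last by field.
move=> /(_ erefl) h.
have {}h := ler_wpM2l (ltW q0) h.
apply: le_trans (le_trans h _); first by rewrite mulrAC mulrA.
rewrite le_eqVlt; apply/orP; left; apply/eqP; field.
by rewrite qn0 q10.
Qed.

(** Jensen's inequality for the measure k(p/q) dq/q, of mass N.  It is proved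
    by integrating the tangent-line inequality at l and then choosing the best
    l, which avoids any discussion of conjugate exponents. *)
Lemma mconv_jensen (k f : R -> R) (q p N : R) :
  measurable_fun [set: R] k -> measurable_fun [set: R] f ->
  (forall x, 0 <= k x) -> (forall x, 0 <= f x) -> 1 <= q -> 0 < p -> 0 < N ->
  haar (EFin \o k) = N%:E ->
  (mconv k f p `^ q <= (N `^ (q - 1))%:E * mconv k (fun x => (f x `^ q)%R) p)%E.
Proof.
move=> mk mf k0 f0 q1 p0 N0 kN; have q0 : 0 < q by exact: lt_le_trans q1.
have mfq : measurable_fun [set: R] (fun x => f x `^ q).
  exact: (measurableT_comp (measurable_powR q) mf).
have mkp : measurable_fun [set: R] (fun x => k (p / x)).
  by apply: (measurableT_comp mk); apply: measurable_funM => //; exact: measurable_fun_invr.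
set X := mconv k f p; set Q := mconv k _ p.
have X0 : (0 <= X)%E by exact: mconv_ge0.
have Q0 : (0 <= Q)%E by apply: mconv_ge0 => // x; exact: powR_ge0.
have key (l : R) : 0 < l -> ((q * l `^ (q - 1))%:E * X <= Q + ((q - 1) * l `^ q * N)%:E)%E.
  move=> l0; rewrite /X /mconv -haarZ ?mulr_ge0 ?powR_ge0 ?(ltW q0)//; last 2 first.
  - by apply/measurable_EFinP; apply: measurable_funTS; exact: measurable_funM.
  - by move=> x x0; rewrite lee_fin mulr_ge0.
  rewrite (EFinM _ N) -kN -(haar_refl mk k0 p0) -haarZ; last 3 first.
  - by rewrite mulr_ge0 ?powR_ge0// subr_ge0.
  - by apply/measurable_EFinP; apply: measurable_funTS.
  - by move=> x x0; rewrite lee_fin.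
  rewrite /Q /mconv -haarD; last 4 first.
  - by apply/measurable_EFinP; apply: measurable_funTS; exact: measurable_funM.
  - by apply: measurable_funeM; apply/measurable_EFinP; apply: measurable_funTS.
  - by move=> x x0; rewrite lee_fin mulr_ge0// powR_ge0.
  - by move=> x x0; rewrite mule_ge0// lee_fin// mulr_ge0 ?powR_ge0// subr_ge0.
  apply: le_haar.
  - apply: measurable_funeM; apply/measurable_EFinP; apply: measurable_funTS.
    exact: measurable_funM.
  - apply: emeasurable_funD; last first.
      by apply: measurable_funeM; apply/measurable_EFinP; apply: measurable_funTS.
    by apply/measurable_EFinP; apply: measurable_funTS; exact: measurable_funM.
  - by move=> x x0; rewrite -EFinM lee_fin !mulr_ge0 ?powR_ge0 ?(ltW q0).
  - move=> x x0; rewrite -!EFinM -EFinD lee_fin.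
    have := ler_wpM2l (k0 (p / x)) (powR_tangent q1 l0 (f0 x)).
    by rewrite mulrDr [in X in _ -> X]mulrCA [in X in _ -> X](mulrC _ (k (p / x))).
have Nq0 : 0 < N `^ (q - 1) by exact: powR_gt0.
have fin_bound (Q' : R) : 0 < Q' -> (Q <= Q'%:E)%E -> (X `^ q <= (N `^ (q - 1) * Q')%:E)%E.
  (* the value of l at which the right-hand side of [key] is optimal *)
  move=> Q'0 QQ'; pose l := (Q' / N) `^ q^-1.
  have l0 : 0 < l by rewrite powR_gt0// divr_gt0.
  have lq : l `^ q = Q' / N.
    by rewrite -powRrM mulVf ?gt_eqF// powRr1// divr_ge0// ltW.
  have := key _ l0; clear key; rewrite lq.
  have -> : (q - 1) * (Q' / N) * N = (q - 1) * Q' by rewrite -mulrA divfK// gt_eqF.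
  move=> h; have {h}h : ((q * l `^ (q - 1))%:E * X <= (q * Q')%:E)%E.
    apply: (le_trans h); rewrite -[leRHS]/((q * Q')%:E).
    rewrite (_ : q * Q' = Q' + (q - 1) * Q'); last by ring.
    by rewrite EFinD leeD2r.
  move: X0 h; case: X => [x| |]//; last first.
    by rewrite mulry gtr0_sg ?mul1e ?leye_eq// mulr_gt0// powR_gt0.
  rewrite lee_fin => x0; rewrite -EFinM lee_fin => h.
  have {}h : l `^ (q - 1) * x <= Q' by rewrite -(ler_pM2l q0) mulrA.
  rewrite poweR_EFin lee_fin.
  have xl : x <= Q' / l `^ (q - 1) by rewrite (ler_pdivlMr _ _ (powR_gt0 _ l0)) (mulrC x).
  have Ql0 : 0 <= Q' / l `^ (q - 1) by rewrite divr_ge0 ?powR_ge0 ?ltW.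
  have := ge0_ler_powR (ltW q0) x0 Ql0 xl => /le_trans; apply.
  have -> : (Q' / l `^ (q - 1)) `^ q = Q' `^ q / (Q' / N) `^ (q - 1).
    rewrite powRM ?invr_ge0 ?powR_ge0 ?(ltW Q'0)// -powR_inv1 ?powR_ge0//.
    by rewrite -(powRrM _ (-1)) mulN1r powRN powRAC lq.
  rewrite -(mulr_powRB1 (ltW Q'0) q0) (powRM _ (ltW Q'0)) ?invr_ge0 ?(ltW N0)//.
  rewrite -(powR_inv1 (ltW N0)) -powRrM mulN1r powRN.
  have Qq : Q' `^ (q - 1) != 0 by rewrite gt_eqF// powR_gt0.
  rewrite le_eqVlt; apply/orP; left; apply/eqP; field.
  by rewrite Qq gt_eqF.
have [->|Qy] := eqVneq Q +oo%E.
  by rewrite mulry gtr0_sg// mul1e leey.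
have Qfin : Q \is a fin_num by rewrite ge0_fin_numE// ltey.
apply/lee_addgt0Pr => e e0.
have e'0 : 0 < e / N `^ (q - 1) by rewrite divr_gt0.
have := @fin_bound (fine Q + e / N `^ (q - 1)).
rewrite ltr_wpDl ?fine_ge0// => /(_ isT); rewrite EFinD fineK// leeDl ?lee_fin ?(ltW e'0)//.
move=> /(_ isT) /le_trans; apply.
by rewrite mulrDr (mulrC _ (e / _)) divfK ?gt_eqF// EFinD EFinM fineK.
Qed.

End haar.

(** * The kernel: positivity, size, and comparison of its moments *)

Section kernel.
Context {R : realType}.
Local Notation D := (`]0, +oo[%classic : set R).

(** The mean value form of atan and arctanh is all that is needed of these
    functions: it gives two-sided bounds by rational functions. *)
Lemma atan_mvt (x : R) : 0 <= x -> exists2 c, 0 <= c <= x & atan x = x / (1 + c ^+ 2).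
Proof.
move=> x0; have [|c] := @MVT_segment R atan (fun c => (1 + c ^+ 2)^-1) 0 x x0.
- by apply: continuous_subspaceT => y; exact: continuous_atan.
- by rewrite in_itv/= atan0 !subr0 => cx ->; exists c => //; rewrite mulrC.
Qed.

Lemma atan_le (x : R) : 0 <= x -> atan x <= x.
Proof.
move=> x0; have [c _ ->] := atan_mvt x0.
by rewrite ler_pdivrMr ?ler_peMr// ?lerDl ?sqr_ge0// ltr_pwDl ?sqr_ge0.
Qed.

Lemma atan_ge (x : R) : 0 <= x -> x / (1 + x ^+ 2) <= atan x.
Proof.
move=> x0; have [c /andP[c0 cx] ->] := atan_mvt x0.
rewrite ler_wpM2l// lef_pV2 ?posrE ?ltr_pwDl ?sqr_ge0// lerD2l.
by rewrite lerXn2r// nnegrE.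
Qed.

Lemma arctanh_mvt (x : R) : 0 <= x < 1 ->
  exists2 c, 0 <= c <= x & arctanh x = x / (1 - c ^+ 2).
Proof.
move=> /andP[x0 x1].
have xb c : 0 <= c <= x -> 0 < 1 + c /\ 0 < 1 - c by move=> /andP[? ?]; split; lra.
pose f := fun y : R => (ln (1 + y) - ln (1 - y)) / 2.
have df y : 0 <= y <= x -> is_derive y (1 : R) f ((1 - y ^+ 2)^-1).
  move=> /xb[y1 y2].
  have d1 : is_derive (1 + y) (1 : R) (@ln R) (1 + y)^-1 by exact: is_derive1_ln.
  have d2 : is_derive (1 - y) (1 : R) (@ln R) (1 - y)^-1 by exact: is_derive1_ln.
  rewrite /f; apply: is_derive_eq.
  rewrite /GRing.scale/= !mulr0 add0r add0r; field.
  by rewrite (gt_eqF y1) (gt_eqF y2) gt_eqF// (_ : 1 - y ^+ 2 = (1 + y) * (1 - y)) ?mulr_gt0//; ring.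
have [||c] := @MVT_segment R f (fun c => (1 - c ^+ 2)^-1) 0 x x0.
- by move=> y; rewrite in_itv/= => /andP[y0 y1]; apply: df; rewrite !ltW.
- apply: derivable_within_continuous => y; rewrite in_itv/= => /df h.
  exact: ex_derive.
- rewrite in_itv/= {2}/f addr0 !subr0 ln1 subrr mul0r subr0 => cx fx; exists c => //.
  rewrite mulrC -fx /f /arctanh ln_div// posrE; lra.
Qed.

Ltac meas := repeat match goal with
  | |- measurable_fun _ (fun x => _ + _) => apply: measurable_funD
  | |- measurable_fun _ (fun x => - _) => apply: measurable_funN
  | |- measurable_fun _ (fun x => _ * _) => apply: measurable_funM
  | |- measurable_fun _ (fun x => _ ^-1) => apply: (measurableT_comp measurable_fun_invr)
  | |- measurable_fun _ (fun x => _ ^+ _) => apply: measurable_funX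
  | |- measurable_fun _ (fun x => ln _) => apply: (measurableT_comp (@measurable_ln R))
  | |- measurable_fun _ (fun x => atan _) => apply: (measurableT_comp (continuous_measurable_fun (@continuous_atan R)))
  | |- measurable_fun _ (fun x => Num.sqrt _) => apply: (measurableT_comp (continuous_measurable_fun (@sqrt_continuous R)))
  end; try by [].

Lemma measurable_kerV : measurable_fun [set: R] (@kerV R).
Proof.
rewrite /kerV /arctanh; apply: measurable_fun_ifT; first exact: measurable_fun_ltr.
  by meas.
apply: measurable_fun_ifT; [exact: measurable_fun_ltr| |exact: measurable_cst].
by meas.
Qed.

Lemma arctanh_ge (x : R) : 0 <= x < 1 -> x <= arctanh x.
Proof.
move=> x01; have [c /andP[c0 cx] ->] := arctanh_mvt x01; move: x01 => /andP[x0 x1].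
have c1 : 0 < 1 - c ^+ 2 by nra.
by rewrite ler_pdivlMr// ler_piMr//; nra.
Qed.

Lemma arctanh_le (x : R) : 0 <= x < 1 -> arctanh x <= x / (1 - x ^+ 2).
Proof.
move=> x01; have [c /andP[c0 cx] ->] := arctanh_mvt x01; move: x01 => /andP[x0 x1].
rewrite ler_wpM2l// lef_pV2 ?posrE; nra.
Qed.

(** For 0 < u < 1 this is asin u / sqrt (1 - u^2) - asinh u / sqrt (1 + u^2). *)
Definition kerB (u : R) : R :=
  atan (u / Num.sqrt (1 - u ^+ 2)) / Num.sqrt (1 - u ^+ 2)
  - arctanh (u / Num.sqrt (1 + u ^+ 2)) / Num.sqrt (1 + u ^+ 2).

Lemma sqrt_unit (u : R) : 0 < u < 1 ->
  let s := Num.sqrt (1 - u ^+ 2) in let r := Num.sqrt (1 + u ^+ 2) in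
  [/\ (s ^+ 2 = 1 - u ^+ 2) * (r ^+ 2 = 1 + u ^+ 2), 0 < s, 0 < r & 0 <= u / r < 1].
Proof.
move=> /andP[u0 u1] s r.
have s2 : s ^+ 2 = 1 - u ^+ 2 by rewrite sqr_sqrtr//; nra.
have r2 : r ^+ 2 = 1 + u ^+ 2 by rewrite sqr_sqrtr//; nra.
have s0 : 0 < s by rewrite sqrtr_gt0; nra.
have r0 : 0 < r by rewrite sqrtr_gt0; nra.
split => //; rewrite divr_ge0 ?ltW//= ltr_pdivrMr// mul1r.
by rewrite -(@ltr_pXn2r _ 2) ?nnegrE ?ltW// r2; lra.
Qed.

(** On (0, 1) the four terms of the kernel group into two nonnegative ones: the
    logarithms combine over 1 - u^4, the rest is [kerB]. *)
Lemma kerV_lt1 (u : R) : 0 < u < 1 -> kerV u = 4 * u ^+ 2 * (- ln u) / (1 - u ^+ 4) + 2 / u * kerB u.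
Proof.
move=> /[dup] u01 /andP[u0 u1]; have := sqrt_unit u01.
set s := Num.sqrt (1 - u ^+ 2); set r := Num.sqrt (1 + u ^+ 2).
move=> [[s2 r2] s0 r0 ur].
rewrite /kerV u1 /kerB -/s -/r.
have h1 : 1 + u ^+ 2 != 0 by rewrite gt_eqF//; nra.
have h2 : 1 - u ^+ 2 != 0 by rewrite gt_eqF//; nra.
have h3 : 1 - u ^+ 4 != 0 by rewrite (_ : 1 - u ^+ 4 = (1 + u ^+ 2) * (1 - u ^+ 2)) ?mulf_neq0//; ring.
field.
by rewrite (gt_eqF u0) (gt_eqF s0) (gt_eqF r0) h1 h2 h3.
Qed.

(** The two terms are separated by u: asinh u <= u sqrt (1 + u^2) bounds the
    subtracted one, asin u >= u sqrt (1 - u^2) the other. *)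
Lemma kerB_ge0 (u : R) : 0 < u < 1 -> 0 <= kerB u.
Proof.
move=> /[dup] u01 /andP[u0 u1]; have := sqrt_unit u01.
set s := Num.sqrt (1 - u ^+ 2); set r := Num.sqrt (1 + u ^+ 2).
move=> [[s2 r2] s0 r0 ur].
rewrite /kerB -/s -/r subr_ge0.
have h1 : arctanh (u / r) <= u * r.
  apply: (le_trans (arctanh_le ur)).
  rewrite le_eqVlt; apply/orP; left; apply/eqP.
  have e1 : 1 - (u / r) ^+ 2 = (r ^+ 2)^-1.
    rewrite expr_div_n {1}(_ : u ^+ 2 = r ^+ 2 - 1); last by rewrite r2; ring.
    by field; rewrite gt_eqF.
  by rewrite e1; field; rewrite gt_eqF.
have h2 : u * s <= atan (u / s).
  apply: (le_trans _ (@atan_ge (u / s) _)); last by rewrite divr_ge0 ?ltW.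
  rewrite le_eqVlt; apply/orP; left; apply/eqP.
  have e1 : 1 + (u / s) ^+ 2 = (s ^+ 2)^-1.
    rewrite expr_div_n {1}(_ : u ^+ 2 = 1 - s ^+ 2); last by rewrite s2; ring.
    by field; rewrite gt_eqF.
  by rewrite e1; field; rewrite gt_eqF.
apply: (@le_trans _ _ u); first by rewrite ler_pdivrMr.
by rewrite ler_pdivlMr.
Qed.

(** The two terms agree to first order at 0, so only a cubic remainder is
    left; a linear bound would not make the kernel vanish at 0. *)
Lemma kerB_le_cube (u : R) : 0 < u < 1 -> u <= 2^-1 -> kerB u <= 3 * u ^+ 3.
Proof.
move=> /[dup] u01 /andP[u0 u1]; have := sqrt_unit u01.
set s := Num.sqrt (1 - u ^+ 2); set r := Num.sqrt (1 + u ^+ 2).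
move=> [[s2 r2] s0 r0 ur].
move=> uh; rewrite /kerB -/s -/r.
have h1 : u / s ^+ 2 >= atan (u / s) / s.
  rewrite expr2 invfM mulrA ler_wpM2r ?invr_ge0 ?(ltW s0)//.
  by apply: atan_le; rewrite divr_ge0 ?ltW.
have h2 : u / r ^+ 2 <= arctanh (u / r) / r.
  by rewrite expr2 invfM mulrA ler_wpM2r ?invr_ge0 ?(ltW r0)//; exact: arctanh_ge.
apply: le_trans (lerB h1 h2) _; rewrite s2 r2.
have p1 : 0 < 1 - u ^+ 2 by nra.
have p2 : 0 < 1 + u ^+ 2 by nra.
have -> : u / (1 - u ^+ 2) - u / (1 + u ^+ 2) = 2 * u ^+ 3 / ((1 - u ^+ 2) * (1 + u ^+ 2)).
  by field; rewrite !gt_eqF.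
have u3 : 0 < u ^+ 3 by rewrite exprn_gt0.
rewrite ler_pdivrMr ?mulr_gt0//.
have : u ^+ 2 <= 4^-1 by nra.
have : 0 < u ^+ 2 by nra.
have -> : u ^+ 3 = u * u ^+ 2 by ring.
set w := u ^+ 2 => w0 w4.
have uw : 0 < u * w by exact: mulr_gt0.
have h : 2 <= 3 * ((1 - w) * (1 + w)) by nra.
by have := ler_wpM2l (ltW uw) h; lra.
Qed.

Lemma kerB_le_sqrt (u : R) : 0 < u < 1 -> kerB u <= 2 / Num.sqrt (1 - u).
Proof.
move=> /[dup] u01 /andP[u0 u1]; have := sqrt_unit u01.
set s := Num.sqrt (1 - u ^+ 2); set r := Num.sqrt (1 + u ^+ 2).
move=> [[s2 r2] s0 r0 ur].
have h2 : 0 <= arctanh (u / r) / r.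
  rewrite divr_ge0 ?(ltW r0)//; apply: le_trans (arctanh_ge ur).
  by case/andP: ur.
have h1 : atan (u / s) <= 2.
  apply: (le_trans (ltW (atan_ltpi2 _))).
  by have [] := @pihalf_02 R; lra.
rewrite /kerB -/s -/r; apply: (@le_trans _ _ (2 / s)).
  apply: (@le_trans _ _ (atan (u / s) / s)); first by rewrite gerDl oppr_le0.
  by rewrite ler_wpM2r// invr_ge0 ltW.
rewrite ler_wpM2l// lef_pV2 ?posrE ?sqrtr_gt0 ?subr_gt0//.
by rewrite ler_wsqrtr//; nra.
by rewrite expr_lt1// ltW.
Qed.

(** Dropping [kerB] and using - ln u >= 1 - u. *)
Lemma kerV_ge (u : R) : 0 < u < 1 -> 4 * u ^+ 2 / ((1 + u) * (1 + u ^+ 2)) <= kerV u.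
Proof.
move=> /[dup] u01 /andP[u0 u1]; rewrite kerV_lt1//.
have B0 : 0 <= 2 / u * kerB u by rewrite mulr_ge0 ?kerB_ge0// divr_ge0// ltW.
have u4 : 0 < 1 - u ^+ 4 by rewrite subr_gt0 exprn_ilt1// ltW.
have u2 : 0 < 1 + u ^+ 2 by nra.
have lnu : 1 - u <= - ln u.
  have := @le_ln1Dx R (u - 1); rewrite subrKC => /(_ _); lra.
apply: (@le_trans _ _ (4 * u ^+ 2 * (1 - u) / (1 - u ^+ 4))).
  rewrite le_eqVlt; apply/orP; left; apply/eqP; field.
  by rewrite !gt_eqF//; lra.
apply: (@le_trans _ _ (4 * u ^+ 2 * - ln u / (1 - u ^+ 4))); last by rewrite lerDl.
rewrite ler_wpM2r ?invr_ge0 ?(ltW u4)// ler_wpM2l//; nra.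
Qed.

Lemma kerV_ge_sqr (u : R) : 0 < u < 1 -> u ^+ 2 <= kerV u.
Proof.
move=> /[dup] u01 /andP[u0 u1]; apply: le_trans (kerV_ge u01).
rewrite ler_pdivlMr; last by rewrite mulr_gt0//; nra.
rewrite mulrC ler_wpM2r//; first nra.
nra.
Qed.

(** The branch of the kernel on (1, +oo) is the reflection of the branch on
    (0, 1).  All statements about the kernel are thereby reduced to (0, 1). *)
Lemma kerV_inv (u : R) : 0 < u < 1 -> kerV u^-1 = u ^+ 3 * kerV u.
Proof.
move=> /[dup] u01 /andP[u0 u1]; have := sqrt_unit u01.
have iu : 1 < u^-1 by rewrite invf_gt1.
rewrite /kerV u1 iu (ltNge u^-1) (ltW iu)/=.
have -> : Num.sqrt (1 + u^-1 ^+ 2) = Num.sqrt (1 + u ^+ 2) / u.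
  rewrite (_ : 1 + u^-1 ^+ 2 = (1 + u ^+ 2) * u^-1 ^+ 2); last by field; rewrite gt_eqF.
  by rewrite sqrtrM ?sqrtr_sqr ?gtr0_norm ?invr_gt0//; nra.
have -> : Num.sqrt (u^-1 ^+ 2 - 1) = Num.sqrt (1 - u ^+ 2) / u.
  rewrite (_ : u^-1 ^+ 2 - 1 = (1 - u ^+ 2) * u^-1 ^+ 2); last by field; rewrite gt_eqF.
  by rewrite sqrtrM ?sqrtr_sqr ?gtr0_norm ?invr_gt0//; nra.
set s := Num.sqrt (1 - u ^+ 2); set r := Num.sqrt (1 + u ^+ 2).
move=> [[s2 r2] s0 r0 ur].
rewrite !div1r !invf_div lnV ?posrE//.
have h1 : 1 + u ^+ 2 != 0 by rewrite gt_eqF//; nra.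
have h2 : 1 - u ^+ 2 != 0 by rewrite gt_eqF//; nra.
field.
by rewrite (gt_eqF u0) (gt_eqF s0) (gt_eqF r0) h1 h2.
Qed.

Lemma kerV_ge0 (u : R) : 0 < u -> 0 <= kerV u.
Proof.
have le1 (v : R) : 0 < v < 1 -> 0 <= kerV v.
  by move=> v01; apply: le_trans (kerV_ge_sqr v01); exact: sqr_ge0.
move=> u0; have [u1|u1|->] := ltgtP u 1; first by apply: le1; rewrite u0.
  have v01 : 0 < u^-1 < 1 by rewrite invr_gt0 u0 invf_lt1.
  by rewrite -[u]invrK kerV_inv// mulr_ge0 ?le1// exprn_ge0 ?invr_ge0 ?ltW.
by rewrite /kerV ltxx.
Qed.

(** The logarithm in u^2 ln u is absorbed in an arbitrarily small power.  The
    exponent 2 is what gives the lower end -2 of the strip of convergence. *)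
Lemma kerV_le_small (u eta : R) : 0 < eta <= 1 -> 0 < u <= 2^-1 ->
  kerV u <= (8 / eta + 6) * u `^ (2 - eta).
Proof.
move=> /andP[e0 e1] /andP[u0 uh]; have u01 : 0 < u < 1 by rewrite u0/=; lra.
rewrite kerV_lt1// [leRHS]mulrDl.
have u4 : 2^-1 <= 1 - u ^+ 4.
  have : u ^+ 2 <= 4^-1 by nra.
  have -> : u ^+ 4 = u ^+ 2 * u ^+ 2 by ring.
  have : 0 <= u ^+ 2 by exact: sqr_ge0.
  set w := u ^+ 2 => *; nra.
have lnu : - ln u <= u `^ (- eta) / eta.
  rewrite ler_pdivlMr// mulNr mulrC -mulNr -ln_powR.
  by apply: ltW; apply: ln_sublinear; rewrite powR_gt0.
have ue : u `^ (2 - eta) = u ^+ 2 * u `^ (- eta).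
  by rewrite powRD ?(gt_eqF u0) ?implybT// powR_mulrn// ltW.
apply: lerD.
  rewrite ue.
  have -> : 8 / eta * (u ^+ 2 * u `^ (- eta)) = 4 * u ^+ 2 * (u `^ (- eta) / eta) * 2.
    by field; rewrite gt_eqF.
  have u40 : 0 < 1 - u ^+ 4 by lra.
  apply: (@le_trans _ _ (4 * u ^+ 2 * (u `^ (- eta) / eta) / (1 - u ^+ 4))).
    by rewrite ler_wpM2r ?invr_ge0 ?(ltW u40)// ler_wpM2l// mulr_ge0 ?sqr_ge0.
  apply: ler_wpM2l; last by rewrite invf_ple ?posrE//; lra.
  by rewrite mulr_ge0 ?divr_ge0 ?powR_ge0 ?(ltW e0)// mulr_ge0 ?sqr_ge0.
apply: (@le_trans _ _ (2 / u * (3 * u ^+ 3))).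
  by rewrite ler_wpM2l ?kerB_le_cube// divr_ge0// ltW.
rewrite (_ : 2 / u * _ = 6 * u ^+ 2); last by field; rewrite gt_eqF.
rewrite ler_wpM2l// -(powR_mulrn 2 (ltW u0)).
apply: ger_powR; first by rewrite u0/=; lra.
lra.
Qed.

(** The logarithmic term is bounded at u = 1, where ln u and 1 - u^4 vanish
    together; only [kerB] blows up, integrably. *)
Lemma kerV_le_large (u : R) : 2^-1 <= u < 1 -> kerV u <= 12 / Num.sqrt (1 - u).
Proof.
move=> /andP[uh u1]; have u0 : 0 < u by lra.
have u01 : 0 < u < 1 by rewrite u0.
have s0 : 0 < Num.sqrt (1 - u) by rewrite sqrtr_gt0 subr_gt0.
have s1 : Num.sqrt (1 - u) <= 1 by rewrite -[leRHS](@sqrtr1 R) ler_sqrt//; lra.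
rewrite kerV_lt1// (_ : 12 / _ = 4 / Num.sqrt (1 - u) + 4 * (2 / Num.sqrt (1 - u))); last first.
  by field; rewrite gt_eqF.
have u4 : 0 < 1 - u ^+ 4 by rewrite subr_gt0 exprn_ilt1// ltW.
have lnu : - ln u <= (1 - u) / u.
  have := @le_ln1Dx R (u^-1 - 1); rewrite subrKC lnV ?posrE// => h.
  rewrite (_ : (1 - u) / u = u^-1 - 1); last by field; rewrite gt_eqF.
  by apply: h; rewrite ltrBrDl subrr invr_gt0.
apply: lerD; last first.
  apply: ler_pM; rewrite ?divr_ge0 ?kerB_ge0 ?(ltW u0)//; last exact: kerB_le_sqrt.
  by rewrite ler_pdivrMr//; lra.
apply: (@le_trans _ _ 4).
  apply: (@le_trans _ _ (4 * u ^+ 2 * ((1 - u) / u) / (1 - u ^+ 4))).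
    by rewrite ler_wpM2r ?invr_ge0 ?(ltW u4)// ler_wpM2l// mulr_ge0 ?sqr_ge0.
  have -> : 4 * u ^+ 2 * ((1 - u) / u) / (1 - u ^+ 4) = 4 * u / ((1 + u) * (1 + u ^+ 2)).
    field; rewrite !gt_eqF//; nra.
  rewrite ler_pdivrMr; last by rewrite mulr_gt0//; nra.
  nra.
by rewrite ler_pdivlMr// ler_piMr.
Qed.

Lemma cvg_powR_y (c : R) : 0 < c -> x `^ (- c) @[x --> +oo%R] --> (0 : R).
Proof.
move=> c0; apply/cvgrPdist_lt => e e0; near=> x.
have x0 : 0 < x by near: x; exact: nbhs_pinfty_gt.
rewrite sub0r normrN ger0_norm ?powR_ge0// powRN invf_plt ?posrE ?powR_gt0//.
rewrite -[ltLHS](@powRr1 _ e^-1) ?invr_ge0 ?(ltW e0)// -(@mulVf _ c) ?gt_eqF//.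
rewrite powRrM gt0_ltr_powR ?nnegrE ?powR_ge0 ?(ltW x0)//.
Unshelve. all: by end_near. Qed.

Lemma integral_powR_1y (c : R) : 0 < c ->
  (\int[Leb]_(x in `[1%R, +oo[) (x `^ (- c - 1))%:E < +oo)%E.
Proof.
move=> c0.
pose F (x : R) := - c^-1 * (x `^ (- c)).
have dF (x : R) : 0 < x -> is_derive x (1 : R) F (x `^ (- c - 1)).
  move=> x0; have := is_derive1_powR (- c) x0 => h.
  rewrite /F; apply: is_derive_eq; rewrite /GRing.scale/=; field.
  by rewrite gt_eqF.
rewrite (@ge0_continuous_FTC2y _ (fun x => x `^ (- c - 1)) F 1 0).
- by rewrite -EFinB ltry.
- by move=> x _; exact: powR_ge0.
- apply: derivable_within_continuous => x; rewrite in_itv/= andbT => x1.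
  by apply: ex_derive; apply: is_derive1_powR; exact: lt_le_trans x1.
- rewrite -[X in _ --> X](mulr0 (- c^-1)); apply: cvgMr.
  exact: cvg_powR_y.
- by move=> x x1; apply: ex_derive; apply: dF; exact: lt_trans x1.
- apply: cvg_at_right_filter; apply: differentiable_continuous.
  by apply/derivable1_diffP; apply: ex_derive; exact: dF.
- move=> x; rewrite in_itv/= andbT => x1; rewrite derive1E.
  by apply: derive_val; apply: dF; exact: lt_trans x1.
Qed.

Lemma measurable_powRl (c : R) (A : set R) : measurable_fun A (fun x : R => x `^ c).
Proof. by apply: measurable_funTS; exact: measurable_powR. Qed.

Lemma integral_powR_01 (e : R) : -1 < e ->
  (\int[Leb]_(x in `]0%R, 1%R[) (x `^ e)%:E < +oo)%E.
Proof.
move=> e1.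
pose f (x : R) := if 0 < x < 1 then x `^ (e + 1) else 0.
have mf : measurable_fun [set: R] f.
  apply: measurable_fun_ifT; last exact: measurable_cst.
    by apply: measurable_and; exact: measurable_fun_ltr.
  exact: measurable_powR.
have f0 x : 0 <= f x by rewrite /f; case: ifP => // _; exact: powR_ge0.
have -> : (\int[Leb]_(x in `]0%R, 1%R[) (x `^ e)%:E = haar (EFin \o f))%E.
  rewrite /haar [LHS]integral_mkcond [RHS]integral_mkcond; apply: eq_integral => x _.
  rewrite !patchE !mem_setE !in_itv/= andbT /f.
  have [x0|x0]//= := ltP 0 x; case: ifPn => x1; last by rewrite mul0e.
  by rewrite -EFinM powRD ?(gt_eqF x0) ?implybT// powRr1 ?ltW// mulfK// gt_eqF.
rewrite -(haar_inv mf f0).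
have c0 : 0 < e + 1 by lra.
apply: le_lt_trans (integral_powR_1y c0).
rewrite /haar [leLHS]integral_mkcond [leRHS]integral_mkcond.
apply: ge0_le_integral => //.
- move=> x _; rewrite patchE mem_setE in_itv/= andbT; case: ifPn => // x0.
  by rewrite mule_ge0// lee_fin ?f0// invr_ge0 ltW.
- apply/(measurable_restrictT _ _).1 => //; apply: measurable_haar_integrand.
  apply/measurable_EFinP; apply: measurable_funTS.
  exact: (measurableT_comp mf measurable_fun_invr).
- by apply/(measurable_restrictT _ _).1 => //; apply/measurable_EFinP; exact: measurable_powRl.
- move=> x _; rewrite !patchE !mem_setE !in_itv/= !andbT.
  have [x0|x0]/= := ltP 0 x; last by case: ifP => // x1; rewrite lee_fin powR_ge0.
  have [x1|x1] := leP 1 x.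
    rewrite -EFinM lee_fin /f; case: ifP => _; last by rewrite mul0r powR_ge0.
    by rewrite -powR_inv1 ?(ltW x0)// -powRrM mulN1r powRD ?(gt_eqF x0) ?implybT.
  by rewrite /f invr_gt0 x0/= invf_lt1// ltNge (ltW x1)/= mul0e.
Qed.

(** Used to move the singularity of 1 / sqrt (1 - x) from 1 to 0. *)
Lemma lebesgue_measure_reflect (A : set R) : measurable A ->
  (Leb A = pushforward Leb (fun x : R => (1 - x : measurableTypeR R)) A).
Proof.
have mphi : measurable_fun [set: measurableTypeR R] (fun x : R => (1 - x : measurableTypeR R)).
  exact: measurable_funB.
apply: (@lebesgue_measure_unique R (pushforward Leb (fun x : R => (1 - x : measurableTypeR R)))) => //.
move=> _ [[a b]] _ <- /=; rewrite /pushforward.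
rewrite (_ : _ @^-1` _ = `[1 - b, 1 - a[%classic); last first.
  apply/seteqP; split => x /=; rewrite !in_itv/= => /andP[xa xb]; apply/andP; split; lra.
rewrite !lebesgue_measure_itv/= !lte_fin ltrD2l ltrN2.
by case: ifPn => _//; rewrite -!EFinB; congr (_%:E); ring.
Qed.

Lemma integral_sqrt_01 :
  (\int[Leb]_(x in `]0%R, 1%R[) ((Num.sqrt (1 - x : R))^-1)%:E < +oo)%E.
Proof.
have mphi : measurable_fun [set: measurableTypeR R] (fun x : R => (1 - x : measurableTypeR R)).
  exact: measurable_funB.
apply: le_lt_trans (@integral_powR_01 (- 2^-1) _); last by lra.
rewrite [leRHS](@eq_measure_integral _ _ _ _ (pushforward Leb (fun x : R => (1 - x : measurableTypeR R)))) => //; last first.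
  by move=> A mA _; exact: lebesgue_measure_reflect.
rewrite ge0_integral_pushforward//; last 2 first.
- by apply/measurable_EFinP; exact: measurable_powRl.
- by move=> x _; rewrite lee_fin powR_ge0.
rewrite (_ : _ @^-1` _ = `]0, 1[%classic); last first.
  apply/seteqP; split => x /=; rewrite !in_itv/= => /andP[xa xb]; apply/andP; split; lra.
rewrite le_eqVlt; apply/orP; left; apply/eqP; apply: eq_integral => x.
rewrite inE/= in_itv/= => /andP[x0 x1].
by rewrite powRN powR12_sqrt// subr_ge0 ltW.
Qed.

(** The kernel made nonnegative on the whole line, so that it can serve as the
    kernel of [mconv]; it agrees with [kerV] where the equation uses it. *)
Definition kerV0 (u : R) : R := if 0 < u then kerV u else 0.
Definition kerV01 (u : R) : R := if 0 < u < 1 then kerV u else 0.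

Lemma kerV0_ge0 u : 0 <= kerV0 u.
Proof. by rewrite /kerV0; case: ifP => // u0; exact: kerV_ge0. Qed.

Lemma kerV01_ge0 u : 0 <= kerV01 u.
Proof. by rewrite /kerV01; case: ifP => // /andP[u0 _]; exact: kerV_ge0. Qed.

Lemma measurable_kerV0 : measurable_fun [set: R] kerV0.
Proof.
apply: measurable_fun_ifT; [exact: measurable_fun_ltr| |exact: measurable_cst].
exact: measurable_kerV.
Qed.

Lemma measurable_kerV01 : measurable_fun [set: R] kerV01.
Proof.
apply: measurable_fun_ifT; [| |exact: measurable_cst].
  by apply: measurable_and; exact: measurable_fun_ltr.
exact: measurable_kerV.
Qed.

(** The Mellin transform of the kernel; gammaN + mellinV s is the symbol of the
    evolution operator at p^(-s). *)
Definition mellinV (s : R) : \bar R := haar (fun u => (kerV0 u * u `^ s)%:E).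
Definition mellinV01 (s : R) : \bar R := haar (fun u => (kerV01 u * u `^ s)%:E).

Lemma measurable_kerV0X s : measurable_fun [set: R] (fun u => kerV0 u * u `^ s).
Proof. apply: measurable_funM; [exact: measurable_kerV0|exact: measurable_powR]. Qed.

Lemma measurable_kerV01X s : measurable_fun [set: R] (fun u => kerV01 u * u `^ s).
Proof. apply: measurable_funM; [exact: measurable_kerV01|exact: measurable_powR]. Qed.

Lemma kerV0X_ge0 s u : 0 <= kerV0 u * u `^ s.
Proof. by rewrite mulr_ge0 ?kerV0_ge0 ?powR_ge0. Qed.

Lemma kerV01X_ge0 s u : 0 <= kerV01 u * u `^ s.
Proof. by rewrite mulr_ge0 ?kerV01_ge0 ?powR_ge0. Qed.

Lemma mellinV01_ge0 s : (0 <= mellinV01 s)%E.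
Proof. by apply: haar_ge0 => u u0; rewrite lee_fin kerV01X_ge0. Qed.

Lemma kerV0_splitX s u : 0 < u ->
  kerV0 u * u `^ s = kerV01 u * u `^ s + kerV01 u^-1 * u^-1 `^ (3 - s).
Proof.
move=> u0; rewrite /kerV0 /kerV01 u0 invr_gt0 u0 invf_lt1//=.
have [u1|u1|->] := ltgtP u 1; [by rewrite mul0r addr0| |].
  rewrite mul0r add0r; have v01 : 0 < u^-1 < 1 by rewrite invr_gt0 u0 invf_lt1.
  have -> : kerV u = u^-1 ^+ 3 * kerV u^-1 by rewrite -(kerV_inv v01) invrK.
  rewrite [LHS]mulrC mulrA [RHS]mulrC; congr (_ * _); clear v01.
  have -> : u^-1 = u `^ (-1) by rewrite powR_inv1 // ltW.
  rewrite -powR_mulrn ?powR_ge0// -!powRrM.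
  have u0' : u != 0 by rewrite gt_eqF.
  have e1 : s + -1 * 3 = - (3 - s) by ring.
  by rewrite -powRD ?u0' ?implybT// e1 mulN1r.
by rewrite /kerV ltxx !mul0r addr0.
Qed.

(** Folding the integral onto (0, 1) by u |-> 1/u and the symmetry of the
    kernel. *)
Lemma mellinV_split s : mellinV s = (mellinV01 s + mellinV01 (3 - s))%E.
Proof.
rewrite {2}/mellinV01 -(haar_inv (@measurable_kerV01X (3 - s)) (kerV01X_ge0 (3 - s))).
rewrite -haarD; last 4 first.
- by apply/measurable_EFinP; apply: measurable_funTS; exact: measurable_kerV01X.
- apply/measurable_EFinP; apply: measurable_funTS.
  exact: (measurableT_comp (@measurable_kerV01X (3 - s)) measurable_fun_invr).
- by move=> u _; rewrite lee_fin kerV01X_ge0.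
- by move=> u _; rewrite lee_fin kerV01X_ge0.
by apply: eq_haar => u u0; rewrite -EFinD (kerV0_splitX s u0).
Qed.

Lemma mellinV01_lty s : -2 < s -> (mellinV01 s < +oo)%E.
Proof.
(* eta is small enough for u^(2 - eta + s - 1) to be integrable at 0; the bounds
   [kerV_le_small] and [kerV_le_large] are used on either side of 1/2 *)
move=> s2; pose eta := Num.min 1 ((s + 2) / 2).
have eta0 : 0 < eta by rewrite lt_min ltr01/=; lra.
have eta1 : eta <= 1 by rewrite ge_min lexx.
have etas : eta < s + 2.
  by rewrite (@le_lt_trans _ _ ((s + 2) / 2))//; [rewrite ge_min lexx orbT|lra].
pose e := 1 + s - eta; have e1 : -1 < e by rewrite /e; lra.
pose C1 := 8 / eta + 6; pose C2 := 12 * expR (`|s - 1| * ln 2).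
have C10 : 0 <= C1 by rewrite /C1 addr_ge0// divr_ge0// ltW.
have C20 : 0 <= C2 by rewrite /C2 mulr_ge0// expR_ge0.
have C1E : C1 = 8 / eta + 6 by [].
have C2E : C2 = 12 * expR (`|s - 1| * ln 2) by [].
clearbody C1 C2.
have mi : measurable_fun [set: R] (fun u : R => (Num.sqrt (1 - u))^-1).
  apply: (measurableT_comp measurable_fun_invr).
  apply: (measurableT_comp (continuous_measurable_fun (@sqrt_continuous R))).
  exact: measurable_funB.
have fin : ((\int[Leb]_(u in `]0%R, 1%R[) (C1 * u `^ e + C2 * (Num.sqrt (1 - u))^-1)%:E) < +oo)%E.
  under eq_integral do rewrite EFinD !EFinM.
  rewrite ge0_integralD//; last 4 first.
  - by move=> x _; rewrite -EFinM lee_fin mulr_ge0// powR_ge0.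
  - by apply: measurable_funeM; apply/measurable_EFinP; exact: measurable_powRl.
  - by move=> x _; rewrite -EFinM lee_fin mulr_ge0// invr_ge0 sqrtr_ge0.
  - by apply: measurable_funeM; apply/measurable_EFinP; exact: measurable_funTS.
  rewrite !ge0_integralZl_EFin//; last 3 first.
  - by apply/measurable_EFinP; exact: measurable_funTS.
  - by move=> x _; rewrite lee_fin powR_ge0.
  - by apply/measurable_EFinP; exact: measurable_powRl.
  apply: lte_add_pinfty; apply: lte_mul_pinfty => //; [exact: integral_powR_01|exact: integral_sqrt_01].
apply: le_lt_trans fin.
rewrite /mellinV01 /haar [leLHS]integral_mkcond [leRHS]integral_mkcond.
apply: ge0_le_integral => //.
- move=> x _; rewrite patchE mem_setE in_itv/= andbT; case: ifPn => // x0.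
  by rewrite mule_ge0// lee_fin ?kerV01X_ge0// invr_ge0 ltW.
- apply/(measurable_restrictT _ _).1 => //; apply: measurable_haar_integrand.
  by apply/measurable_EFinP; apply: measurable_funTS; exact: measurable_kerV01X.
- apply/(measurable_restrictT _ _).1 => //; apply/measurable_EFinP.
  apply: measurable_funTS; apply: measurable_funD; apply: measurable_funM => //.
move=> u _; rewrite !patchE !mem_setE !in_itv/= !andbT.
have [u0|u0]//= := ltP 0 u; rewrite /kerV01 u0/=; case: ifPn => u1; last by rewrite mul0r mul0e.
rewrite -EFinM lee_fin -mulrA -[X in kerV u * X](_ : u `^ (s - 1) = _); last first.
  by rewrite powRD ?(gt_eqF u0) ?implybT// powR_inv1 ?ltW.
have [uh|uh] := leP u 2^-1.
  apply: (@le_trans _ _ (C1 * u `^ e)); last first.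
    by rewrite lerDl mulr_ge0// invr_ge0 sqrtr_ge0.
  have -> : u `^ e = u `^ (2 - eta) * u `^ (s - 1).
    by rewrite -powRD ?(gt_eqF u0) ?implybT// /e; congr (_ `^ _); ring.
  rewrite mulrA ler_wpM2r ?powR_ge0//.
  by rewrite C1E; apply: kerV_le_small; rewrite ?eta0 ?u0.
apply: (@le_trans _ _ (C2 * (Num.sqrt (1 - u))^-1)); last first.
  by rewrite lerDr mulr_ge0// powR_ge0.
rewrite C2E mulrAC; apply: ler_pM; rewrite ?powR_ge0 ?kerV_ge0//.
  by apply: kerV_le_large; rewrite u1 ltW.
rewrite /powR gt_eqF// ler_expR.
apply: le_trans (ler_norm _) _; rewrite normrM ler_wpM2l//.
rewrite ler0_norm; last by apply: ln_le0; exact: ltW.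
by rewrite -lnV ?posrE// ler_ln ?posrE ?invr_gt0// invf_ple ?posrE// ltW.
Qed.

Lemma mellinV_lty s : -2 < s < 5 -> (mellinV s < +oo)%E.
Proof.
move=> /andP[s2 s5]; rewrite mellinV_split.
by apply: lte_add_pinfty; apply: mellinV01_lty => //; lra.
Qed.

Lemma gammaN_mellinV : gammaN R = - fine (mellinV 1).
Proof.
rewrite /gammaN /Rintegral; congr (- fine _).
apply: eq_integral => u; rewrite inE/= in_itv/= andbT => u0.
by rewrite -EFinM /kerV0 u0 powRr1 ?ltW// mulfK// gt_eqF.
Qed.

Lemma Lqnorm_mellinV : Lqnorm 1 0 (@kerV R) = mellinV 0.
Proof.
rewrite /Lqnorm invr1 poweRe1; last first.
  by apply: integral_ge0 => u _; rewrite lee_fin mulr_ge0 ?powR_ge0.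
apply: eq_integral => u; rewrite inE/= in_itv/= andbT => u0.
rewrite -EFinM /kerV0 u0 mulr0 sub0r powR_inv1 ?ltW// powRr0 mulr1 powRr1//.
by rewrite ger0_norm// kerV_ge0.
Qed.

Lemma mellinV01_fin s : -2 < s -> mellinV01 s \is a fin_num.
Proof. by move=> s2; rewrite ge0_fin_numE ?mellinV01_ge0// mellinV01_lty. Qed.

Lemma mellinV_fin s : -2 < s < 5 -> mellinV s \is a fin_num.
Proof.
move=> s2; rewrite ge0_fin_numE ?mellinV_lty//.
by apply: haar_ge0 => u u0; rewrite lee_fin kerV0X_ge0.
Qed.

(** The strict part of the comparisons of moments: the gap below has a nonzero
    integral against the kernel. *)
Lemma haar_kerV01_gt0 : (0 < haar (fun u => (kerV01 u * (u * (1 - u) ^+ 2 / 4))%:E))%E.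
Proof.
apply: (@lt_le_trans _ _ (\int[Leb]_(u in `[4^-1%R, 2^-1%R]) (4^-1 ^+ 5)%:E)%E).
  (* on [1/4, 1/2] both u^2 and (1 - u)^2 / 4 are at least 1/16 *)
  rewrite integral_cst//= lebesgue_measure_itv/= lte_fin.
  have -> : (4^-1 : R) < 2^-1 by lra.
  by rewrite -EFinB -EFinM lte_fin mulr_gt0//; lra.
have mf : measurable_fun D (fun u => ((kerV01 u * (u * (1 - u) ^+ 2 / 4))%:E * (u^-1)%:E)%E).
  apply: measurable_haar_integrand; apply/measurable_EFinP; apply: measurable_funTS.
  apply: measurable_funM; first exact: measurable_kerV01.
  apply: measurable_funM => //; apply: measurable_funM => //.
  by apply: measurable_funX; exact: measurable_funB.
have sub : (`[4^-1%R, 2^-1%R]%classic : set R) `<=` D.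
  by move=> u; rewrite /= !in_itv/= andbT => /andP[u4 _]; lra.
apply: (@le_trans _ _ (\int[Leb]_(u in `[4^-1%R, 2^-1%R]) ((kerV01 u * (u * (1 - u) ^+ 2 / 4))%:E * (u^-1)%:E))%E).
  apply: ge0_le_integral => //.
  - by apply: measurable_funS mf.
  - move=> u; rewrite /= in_itv/= => /andP[u4 u2]; rewrite -EFinM lee_fin.
    have u0 : 0 < u by lra.
    have u01 : 0 < u < 1 by rewrite u0/=; lra.
    rewrite /kerV01 u01.
    have h := kerV_ge_sqr u01.
    have -> : kerV u * (u * (1 - u) ^+ 2 / 4) / u = kerV u * ((1 - u) ^+ 2 / 4) by field; rewrite gt_eqF.
    apply: (@le_trans _ _ (u ^+ 2 * ((1 - u) ^+ 2 / 4))); last first.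
      by rewrite ler_wpM2r// divr_ge0// sqr_ge0.
    have h1 : 16^-1 <= u ^+ 2 by nra.
    have h2 : 16^-1 <= (1 - u) ^+ 2 / 4 by nra.
    have -> : (4^-1 : R) ^+ 5 = 16^-1 * 64^-1 by lra.
    by apply: ler_pM => //; lra.
apply: ge0_subset_integral => //.
move=> u; rewrite /= in_itv/= andbT => u0.
rewrite mule_ge0// lee_fin ?invr_ge0 ?(ltW u0)// mulr_ge0 ?kerV01_ge0//.
by rewrite divr_ge0// mulr_ge0 ?sqr_ge0// ltW.
Qed.

Lemma mellinV01_le_gap (f g : R -> R) :
  measurable_fun [set: R] f -> measurable_fun [set: R] g ->
  (forall u, 0 <= f u) -> (forall u, 0 <= g u) ->
  (forall u, 0 < u < 1 -> f u + u * (1 - u) ^+ 2 / 4 <= g u) ->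
  haar (fun u => (kerV01 u * f u)%:E) \is a fin_num ->
  (haar (fun u => (kerV01 u * f u)%:E) < haar (fun u => (kerV01 u * g u)%:E))%E.
Proof.
move=> mf mg f0 g0 fg ffin.
have mk (h : R -> R) : measurable_fun [set: R] h -> measurable_fun D (fun u => (kerV01 u * h u)%:E).
  move=> mh; apply/measurable_EFinP; apply: measurable_funTS; apply: measurable_funM => //.
  exact: measurable_kerV01.
have md : measurable_fun [set: R] (fun u : R => u * (1 - u) ^+ 2 / 4).
  apply: measurable_funM => //; apply: measurable_funM => //.
  by apply: measurable_funX; exact: measurable_funB.
have d0 (u : R) : 0 < u -> 0 <= u * (1 - u) ^+ 2 / 4.
  by move=> u0; rewrite divr_ge0// mulr_ge0 ?sqr_ge0// ltW.
apply: (@lt_le_trans _ _ (haar (fun u => (kerV01 u * f u)%:E) + haar (fun u => (kerV01 u * (u * (1 - u) ^+ 2 / 4))%:E))%E).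
  by rewrite lteDl// haar_kerV01_gt0.
rewrite -haarD; last 4 first.
- exact: mk.
- exact: mk.
- by move=> u _; rewrite lee_fin mulr_ge0 ?kerV01_ge0.
- by move=> u u0; rewrite lee_fin mulr_ge0 ?kerV01_ge0 ?d0.
apply: le_haar.
- by apply: emeasurable_funD; exact: mk.
- exact: mk.
- by move=> u u0; rewrite -EFinD lee_fin addr_ge0// mulr_ge0 ?kerV01_ge0 ?d0.
- move=> u u0; rewrite -EFinD lee_fin -mulrDr /kerV01; case: ifP => u01; last by rewrite !mul0r.
  by rewrite ler_wpM2l ?kerV_ge0// fg.
Qed.

Lemma mellinV01D s t : (mellinV01 s + mellinV01 t = haar (fun u => (kerV01 u * (u `^ s + u `^ t))%:E))%E.
Proof.
rewrite /mellinV01 -haarD; last 4 first.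
- by apply/measurable_EFinP; apply: measurable_funTS; exact: measurable_kerV01X.
- by apply/measurable_EFinP; apply: measurable_funTS; exact: measurable_kerV01X.
- by move=> u _; rewrite lee_fin kerV01X_ge0.
- by move=> u _; rewrite lee_fin kerV01X_ge0.
by apply: eq_haar => u u0; rewrite -EFinD mulrDr.
Qed.

(** u^s + u^(3 - s) is a convex function of s, symmetric about 3/2, so moving s
    away from 3/2 increases the moment.  The quantitative gap in the hypothesis
    makes the inequality strict after integration. *)
Lemma mellinV_lt (s t : R) : -2 < s < 5 ->
  (forall u, 0 < u < 1 -> u `^ s + u `^ (3 - s) + u * (1 - u) ^+ 2 / 4 <= u `^ t + u `^ (3 - t)) ->
  (mellinV s < mellinV t)%E.
Proof.
move=> /andP[s2 s5] h; rewrite (mellinV_split s) (mellinV_split t) !mellinV01D.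
have m a : measurable_fun [set: R] (fun u : R => u `^ a + u `^ (3 - a)).
  by apply: measurable_funD; exact: measurable_powR.
apply: mellinV01_le_gap => //.
- by move=> u; rewrite addr_ge0// powR_ge0.
- by move=> u; rewrite addr_ge0// powR_ge0.
- rewrite -mellinV01D; have /fin_numP[] := @mellinV01_fin s s2 => ? ?.
  by rewrite fin_numD !mellinV01_fin//; lra.
Qed.

(** 1 + u^3 - u - u^2 = (1 - u)^2 (1 + u).  This strict inequality is the growth
    of the energy. *)
Lemma mellinV_1_lt_3 : (mellinV 1 < mellinV 3)%E.
Proof.
apply: mellinV_lt; first lra.
move=> u /andP[u0 u1]; rewrite subrr powRr0 powRr1 ?(ltW u0)//.
have -> : 3 - 1 = 2%:R :> R by lra.
rewrite !powR_mulrn ?(ltW u0)//.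
have -> : u ^+ 3 = u * u ^+ 2 by ring.
have : 0 <= (1 - u) ^+ 2 by exact: sqr_ge0.
nra.
Qed.

(** u + u^2 - 2 u^(3/2) = u (1 - sqrt u)^2.  This strict inequality is the decay
    of the moment that drives the concentration at 0. *)
Lemma mellinV_32_lt_1 : (mellinV (3 / 2) < mellinV 1)%E.
Proof.
apply: mellinV_lt; first lra.
move=> u /andP[u0 u1].
have -> : 3 - 3 / 2 = 3 / 2 :> R by lra.
have -> : 3 - 1 = 2%:R :> R by lra.
rewrite powR_mulrn ?(ltW u0)// powRr1 ?(ltW u0)//.
have e : u `^ (3 / 2) = u * Num.sqrt u.
  rewrite -powR12_sqrt ?(ltW u0)// -{2}(powRr1 (ltW u0)) -powRD ?(gt_eqF u0) ?implybT//.
  by congr (_ `^ _); lra.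
rewrite e.
have s0 : 0 <= Num.sqrt u by exact: sqrtr_ge0.
have s1 : Num.sqrt u ^+ 2 = u by rewrite sqr_sqrtr// ltW.
have s2 : Num.sqrt u <= 1 by rewrite -[leRHS](@sqrtr1 R) ler_sqrt// ltW.
set s := Num.sqrt u in s0 s1 s2 *.
have : (1 - u) ^+ 2 / 4 <= (1 - s) ^+ 2.
  rewrite -s1; have -> : (1 - s ^+ 2) ^+ 2 = (1 - s) ^+ 2 * (1 + s) ^+ 2 by ring.
  have : 0 <= (1 - s) ^+ 2 by exact: sqr_ge0.
  have : (1 + s) ^+ 2 <= 4 by nra.
  nra.
move=> h; have {}h := ler_wpM2l (ltW u0) h.
have : u * (1 - s) ^+ 2 = u + u ^+ 2 - 2 * (u * s).
  by transitivity (u - 2 * (u * s) + u * s ^+ 2); [ring|rewrite s1; ring].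
lra.
Qed.

(** By [kerV_ge], V(u) (1 + u^3) / u >= 2 u on (0, 1), and the right-hand side
    integrates to 1. *)
Lemma mellinV_0_ge1 : (1 <= mellinV 0)%E.
Proof.
rewrite mellinV_split subr0 mellinV01D.
have E : (\int[Leb]_(u in `[0%R, 1%R]) (2 * u : R)%:E = 1)%E.
  have dF (x : R) : is_derive x (1 : R) (fun u => u ^+ 2) (2 * x).
    by apply: is_derive_eq; rewrite /GRing.scale/= mulr1 mulr_natl.
  rewrite (@continuous_FTC2 R (fun u => 2 * u) (fun u => u ^+ 2) 0 1)//.
  - by rewrite expr1n expr0n/= sube0.
  - by apply: continuous_subspaceT => x; apply: cvgMr; exact: cvg_id.
  - split => [x _||]; first exact: ex_derive.
      by apply: cvg_at_right_filter; apply: exprn_continuous.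
    by apply: cvg_at_left_filter; apply: exprn_continuous.
  - by move=> x _; rewrite derive1E; apply: derive_val.
rewrite -E.
apply: (@le_trans _ _ (\int[Leb]_(u in `]0%R, 1%R[) (2 * u : R)%:E)%E).
  rewrite le_eqVlt; apply/orP; left; apply/eqP.
  rewrite integral_itv_obnd_cbnd; last by apply/measurable_EFinP; apply: measurable_funTS; exact: measurable_funM.
  by rewrite integral_itv_bndo_bndc//; apply/measurable_EFinP; apply: measurable_funTS; exact: measurable_funM.
rewrite /haar [leLHS]integral_mkcond [leRHS]integral_mkcond.
apply: ge0_le_integral => //.
- by move=> x _; rewrite patchE mem_setE in_itv/=; case: ifPn => // /andP[x0 _]; rewrite lee_fin mulr_ge0// ltW.
- apply/(measurable_restrictT _ _).1 => //; apply/measurable_EFinP.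
  by apply: measurable_funTS; exact: measurable_funM.
- apply/(measurable_restrictT _ _).1 => //; apply: measurable_haar_integrand.
  apply/measurable_EFinP; apply: measurable_funTS; apply: measurable_funM; first exact: measurable_kerV01.
  by apply: measurable_funD; exact: measurable_powR.
move=> u _; rewrite !patchE !mem_setE !in_itv/= !andbT.
have [u0|u0]//= := ltP 0 u; rewrite /kerV01 u0/=; case: ifPn => u1; last by rewrite mul0r mul0e.
have u01 : 0 < u < 1 by rewrite u0.
rewrite -EFinM lee_fin powRr0 powR_mulrn ?(ltW u0)//.
rewrite ler_pdivlMr//; apply: (@le_trans _ _ (4 * u ^+ 2 / ((1 + u) * (1 + u ^+ 2)) * (1 + u ^+ 3))); last first.
  by rewrite ler_wpM2r ?kerV_ge// addr_ge0// exprn_ge0// ltW.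
have p2 : 0 < 1 + u ^+ 2 by nra.
have -> : 4 * u ^+ 2 / ((1 + u) * (1 + u ^+ 2)) * (1 + u ^+ 3) = u ^+ 2 * (4 * (1 - u + u ^+ 2) / (1 + u ^+ 2)).
  by field; rewrite !gt_eqF//; lra.
have -> : 2 * u * u = u ^+ 2 * 2 by ring.
rewrite ler_wpM2l ?sqr_ge0// ler_pdivlMr//.
nra.
Qed.

End kernel.

(** * The function spaces: lattice norms, and boundedness of the convolution *)

(** The filter of properties true almost everywhere, for the two forms in which
    Lebesgue measure is inferred. *)
#[local] Instance ae_leb_filter (R : realType) :
  Filter (nbhs (almost_everywhere (@lebesgue_measure R))).
Proof. exact: ae_filter_ringOfSetsType. Qed.

#[local] Instance ae_leb_filter' (R : realType) : Filter (nbhs (almost_everywhere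
  (@lebesgue_measure_lebesgue_measure__canonical__measure_function_Measure R))).
Proof. exact: ae_filter_ringOfSetsType. Qed.

Section spaces.
Context {R : realType}.
Local Notation D := (`]0, +oo[%classic : set R).
Implicit Types (f g : R -> R).

(** A nonnegative representative, defined on the whole line, of a function that
    is nonnegative almost everywhere on the half-line. *)
Definition posD (f : R -> R) (p : R) : R := if 0 < p then `|f p| else 0.

Lemma posD_ge0 f p : 0 <= posD f p.
Proof. by rewrite /posD; case: ifP. Qed.

Lemma measurable_posD f : measurable_fun D f -> measurable_fun [set: R] (posD f).
Proof.
move=> mf; have m1 : measurable_fun D (fun p => `|f p|) by exact: measurableT_comp.
have := (measurable_restrictT (fun p => `|f p|) (measurable_itv `]0, +oo[%R)).1 m1.
congr measurable_fun; apply/funext => p.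
by rewrite patchE mem_setE in_itv/= andbT.
Qed.

(** What the well-posedness proof uses of a space X: a lattice norm with a
    Fatou property for increasing sequences (with a loss B, which is 1 for
    L^q_theta and 2 for the sum of two suprema), on which convolution with the
    kernel has norm at most K.  Completeness is only used in this monotone
    form. *)
Record good_space (X : fspace R) (K B : R) : Prop := GoodSpace {
  gs_K : 0 <= K;
  gs_B : 0 <= B;
  gs_ge0 : forall f, (0 <= fnorm X f)%E;
  gs_mem : forall f, fmem X f <-> measurable_fun D f /\ (fnorm X f < +oo)%E;
  gs_le : forall f g, measurable_fun D f -> measurable_fun D g ->
    {ae Leb, forall p : R, 0 < p -> `|f p| <= `|g p|} -> (fnorm X f <= fnorm X g)%E;
  gs_add : forall f g, measurable_fun D f -> measurable_fun D g ->
    (fnorm X (fun p => f p + g p)%R <= fnorm X f + fnorm X g)%E;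
  gs_scale : forall c f, measurable_fun D f -> 0 <= c ->
    (fnorm X (fun p => c * f p)%R = c%:E * fnorm X f)%E;
  gs_eq0 : forall f, measurable_fun D f -> fnorm X f = 0%E ->
    {ae Leb, forall p : R, 0 < p -> f p = 0};
  gs_sup : forall (f : nat -> R -> R) (C : R), (forall n, measurable_fun D (f n)) ->
    (forall n p, 0 <= f n p) -> (forall p, nondecreasing_seq (f^~ p)) ->
    (forall n, fnorm X (f n) <= C%:E)%E ->
    {ae Leb, forall p : R, 0 < p -> cvgn (f^~ p)} /\
    (forall g, measurable_fun D g -> (forall p, 0 <= g p) ->
      {ae Leb, forall p : R, 0 < p -> (f^~ p) @ \oo --> g p} -> (fnorm X g <= (B * C)%:E)%E);
  gs_op : forall f, measurable_fun [set: R] f -> (forall p, 0 <= f p) ->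
    (fnorm X f < +oo)%E ->
    {ae Leb, forall p : R, 0 < p -> (mconv kerV0 f p < +oo)%E} /\
    (fnorm X (fun p => fine (mconv kerV0 f p)) <= K%:E * fnorm X f)%E }.

(** If the integral vanished the kernel would be zero almost everywhere and
    [mellinV_0_ge1] would fail. *)
Lemma mellinV_gt0 (s : R) : (0 < mellinV s)%E.
Proof.
have m0 : (0 <= mellinV s)%E by apply: haar_ge0 => u u0; rewrite lee_fin kerV0X_ge0.
rewrite lt_neqAle m0 andbT; apply/eqP => /esym s0.
have mk t : measurable_fun D (fun u => (kerV0 u * u `^ t)%:E * (u^-1)%:E)%E.
  by apply: measurable_haar_integrand; apply/measurable_EFinP; apply: measurable_funTS; exact: measurable_kerV0X.
have h0 : (\int[Leb]_(u in D) `|(kerV0 u * u `^ s)%:E * (u^-1)%:E| = 0)%E.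
  rewrite -[RHS]s0; apply: eq_integral => u; rewrite inE/= in_itv/= andbT => u0.
  by rewrite /= ger0_norm ?EFinM// mulr_ge0 ?kerV0X_ge0// invr_ge0 ltW.
have h := (ae_eq_integral_abs Leb (measurable_itv _) (mk s)).1 h0.
have : @mellinV R 0 = 0%E.
  transitivity (\int[Leb]_(u in D) cst 0%E u)%E; last by rewrite integral0.
  apply: ae_eq_integral => //; first exact: mk.
  apply: filterS h => u hu; rewrite /= in_itv/= andbT => u0.
  have := hu; rewrite /= in_itv/= andbT => /(_ u0)/eqP.
  rewrite -EFinM eqe mulf_eq0 invr_eq0 (gt_eqF u0) orbF mulf_eq0.
  by rewrite (gt_eqF (powR_gt0 _ u0)) orbF => /eqP ->; rewrite !mul0r mul0e.
by have := @mellinV_0_ge1 R; move=> /[swap] ->; rewrite lee_fin ler10.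
Qed.

Lemma Lq_exponent_range (q theta : R) : 1 <= q -> -1 < theta < 5 / 2 ->
  -2 < 2 * theta / q < 5.
Proof.
move=> q1 /andP[t1 t2]; have q0 : 0 < q by lra.
by apply/andP; split; [rewrite ltr_pdivlMr//|rewrite ltr_pdivrMr//]; lra.
Qed.

Section Lq.
Variables (q theta : R).
Hypotheses (q1 : 1 <= q) (th : -1 < theta < 5 / 2).

Let q0 : 0 < q. Proof. exact: lt_le_trans q1. Qed.

Definition Lqint (f : R -> R) : \bar R :=
  (\int[Leb]_(p in `]0%R, +oo[) (`|f p| `^ q * p `^ (2 * theta - 1))%:E)%E.

Lemma LqnormE f : Lqnorm q theta f = (Lqint f `^ q^-1)%E.
Proof. by []. Qed.

Lemma Lqint_ge0 f : (0 <= Lqint f)%E.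
Proof. by apply: integral_ge0 => p _; rewrite lee_fin mulr_ge0 ?powR_ge0. Qed.

Lemma measurable_Lqintegrand f : measurable_fun D f ->
  measurable_fun D (fun p => (`|f p| `^ q * p `^ (2 * theta - 1))%:E).
Proof.
move=> mf; apply/measurable_EFinP; apply: measurable_funM; last exact: measurable_powRl.
have m1 : measurable_fun D (fun p => `|f p|) by exact: measurableT_comp.
exact: (measurableT_comp (measurable_powR q) m1).
Qed.

Lemma Lqint_le f g : measurable_fun D f -> measurable_fun D g ->
  {ae Leb, forall p : R, 0 < p -> `|f p| <= `|g p|} -> (Lqint f <= Lqint g)%E.
Proof.
move=> mf mg fg; apply: ae_ge0_le_integral => //.
- by move=> p _; rewrite lee_fin mulr_ge0 ?powR_ge0.
- exact: measurable_Lqintegrand.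
- by move=> p _; rewrite lee_fin mulr_ge0 ?powR_ge0.
- exact: measurable_Lqintegrand.
- apply: filterS fg => p h; rewrite /= in_itv/= andbT => /h {}h.
  rewrite lee_fin ler_wpM2r ?powR_ge0// ge0_ler_powR ?nnegrE// ltW//.
Qed.

Lemma poweR_inv_le x y : (0 <= x)%E -> (x <= y)%E -> (x `^ q^-1 <= y `^ q^-1)%E.
Proof.
move=> x0 xy; apply: gt0_ler_poweR => //; first by rewrite invr_ge0 ltW.
- by rewrite in_itv/= x0 leey.
- by rewrite in_itv/= (le_trans x0 xy) leey.
Qed.

Lemma Lqnorm_le_fin f (C : R) : 0 <= C -> (Lqnorm q theta f <= C%:E)%E <-> (Lqint f <= (C `^ q)%:E)%E.
Proof.
move=> C0; rewrite LqnormE; split => h.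
- rewrite -[leLHS]poweRe1 ?Lqint_ge0// -(@mulVf _ q) ?gt_eqF// poweRrM.
  rewrite -poweR_EFin; apply: gt0_ler_poweR => //; first exact: ltW.
  + by rewrite in_itv/= poweR_ge0 leey.
  + by rewrite in_itv/= lee_fin C0 leey.
- rewrite [leRHS](_ : _ = ((C `^ q)%:E `^ q^-1)%E).
    by apply: poweR_inv_le => //; exact: Lqint_ge0.
  by rewrite poweR_EFin -powRrM divff ?gt_eqF// powRr1.
Qed.

Lemma Lqnorm_lty f : (Lqnorm q theta f < +oo)%E <-> (Lqint f < +oo)%E.
Proof.
rewrite LqnormE; split => h; last exact: poweR_lty.
by apply: lty_poweRy h; rewrite invr_eq0 gt_eqF.
Qed.

Let w f := fun p : R => (fun p => f p * p `^ ((2 * theta - 1) / q)) \_ D p.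

Lemma Lqnorm_LnormE f : Lqnorm q theta f = ('N[Leb]_(q%:E)[EFin \o (w f)])%E.
Proof.
rewrite LqnormE /Lqint unlock; congr poweR; rewrite [LHS]integral_mkcond.
apply: eq_integral => p _; rewrite /w /= !patchE mem_setE in_itv/= andbT.
case: ifPn => p0; last by rewrite normr0 powR0 ?gt_eqF.
rewrite normrM powRM// (ger0_norm (powR_ge0 _ _)) -powRrM divfK ?(gt_eqF q0)//.
Qed.

Lemma measurable_w f : measurable_fun D f -> measurable_fun [set: R] (w f).
Proof.
move=> mf; apply/(measurable_restrictT _ _).1 => //.
by apply: measurable_funM => //; exact: measurable_powRl.
Qed.

Lemma Lqnorm_add f g : measurable_fun D f -> measurable_fun D g ->
  (Lqnorm q theta (fun p => f p + g p)%R <= Lqnorm q theta f + Lqnorm q theta g)%E.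
Proof.
move=> mf mg; rewrite !Lqnorm_LnormE.
rewrite (_ : w (fun p => f p + g p) = (w f \+ w g)%R).
  by apply: minkowski_EFin => //; exact: measurable_w.
apply/funext => p; rewrite /w /= !patchE; case: ifP => _; rewrite ?mulrDl//.
by rewrite addr0.
Qed.

Lemma Lqnorm_scale (c : R) f : measurable_fun D f -> 0 <= c ->
  (Lqnorm q theta (fun p => c * f p)%R = c%:E * Lqnorm q theta f)%E.
Proof.
move=> mf c0; rewrite !LqnormE.
have -> : Lqint (fun p => c * f p) = ((c `^ q)%:E * Lqint f)%E.
  rewrite /Lqint -ge0_integralZl_EFin ?powR_ge0//.
  - by apply: eq_integral => p _; rewrite normrM powRM// (ger0_norm c0) -EFinM mulrA.
  - by move=> p _; rewrite lee_fin mulr_ge0 ?powR_ge0.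
  - exact: measurable_Lqintegrand.
rewrite poweRM ?lee_fin ?powR_ge0 ?Lqint_ge0//.
by rewrite poweR_EFin -powRrM divff ?gt_eqF// powRr1.
Qed.

Lemma Lqnorm_eq0 f : measurable_fun D f -> Lqnorm q theta f = 0%E ->
    {ae Leb, forall p : R, 0 < p -> f p = 0}.
Proof.
move=> mf; rewrite LqnormE => /(poweR_eq0_eq0 (Lqint_ge0 f)) => h.
have /ae_eq_integral_abs : (\int[Leb]_(p in D) `|(`|f p| `^ q * p `^ (2 * theta - 1))%:E| = 0)%E.
  rewrite -[RHS]h; apply: eq_integral => p _.
  by rewrite gee0_abs// lee_fin mulr_ge0 ?powR_ge0.
move=> /(_ (measurable_itv _) (measurable_Lqintegrand mf)); apply: filterS => p hp p0.
have := hp; rewrite /= in_itv/= andbT => /(_ p0)/eqP.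
rewrite eqe mulf_eq0 => /orP[|]; last by rewrite gt_eqF// powR_gt0.
by rewrite powR_eq0 normr_eq0 => /andP[/eqP].
Qed.

Lemma powR_mul_le (x v L : R) : 0 <= x -> 0 < v -> 0 <= L ->
  (x `^ q * v <= L) = (x <= (L / v) `^ q^-1).
Proof.
move=> x0 v0 L0; rewrite -ler_pdivlMr//.
have Lv : 0 <= L / v by rewrite divr_ge0// ltW.
apply/idP/idP => h.
- rewrite -[leLHS]powRr1// -(@divff _ q) ?gt_eqF// powRrM.
  by rewrite ge0_ler_powR ?nnegrE ?powR_ge0// invr_ge0 ltW.
- rewrite -[leRHS]powRr1// -(@mulVf _ q) ?gt_eqF// powRrM.
  by rewrite ge0_ler_powR ?nnegrE ?powR_ge0// ltW.
Qed.

(** Monotone convergence for the q-th powers; their limit is finite almost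
    everywhere, and so is that of the functions. *)
Lemma Lq_sup (f : nat -> R -> R) (C : R) : (forall n, measurable_fun D (f n)) ->
    (forall n p, 0 <= f n p) -> (forall p, nondecreasing_seq (f^~ p)) ->
    (forall n, Lqnorm q theta (f n) <= C%:E)%E ->
    {ae Leb, forall p : R, 0 < p -> cvgn (f^~ p)} /\
    (forall g, measurable_fun D g -> (forall p, 0 <= g p) ->
      {ae Leb, forall p : R, 0 < p -> (f^~ p) @ \oo --> g p} -> (Lqnorm q theta g <= (1 * C)%:E)%E).
Proof.
move=> mf f0 fnd fC.
have C0 : 0 <= C by rewrite -lee_fin; apply: le_trans (fC 0%N); rewrite LqnormE poweR_ge0.
pose phi n p := (`|f n p| `^ q * p `^ (2 * theta - 1))%:E.
have phi0 n p : (0 <= phi n p)%E by rewrite lee_fin mulr_ge0 ?powR_ge0.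
have mphi n : measurable_fun D (phi n) by exact: measurable_Lqintegrand.
have phind p : {homo phi^~ p : n m / (n <= m)%N >-> (n <= m)%E}.
  move=> n m nm; rewrite lee_fin ler_wpM2r ?powR_ge0// ge0_ler_powR ?nnegrE ?(ltW q0)//.
  by rewrite !ger0_norm//; exact: fnd.
have cphi p : cvgn (phi^~ p) by apply: ereal_nondecreasing_is_cvgn; exact: phind.
pose L p := limn (phi^~ p).
have mL : measurable_fun D L.
  by apply: (@emeasurable_fun_cvg _ _ _ _ phi) => // p _; exact: cphi.
have L0 p : (0 <= L p)%E by apply: lime_ge => //; exact: nearW.
have phiL n p : (phi n p <= L p)%E by apply: lime_ge => //; exists n => // m /= nm; exact: phind.
have intL : (\int[Leb]_(p in D) L p <= (C `^ q)%:E)%E.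
  rewrite (@monotone_convergence _ _ _ Leb _ _ phi)//.
  apply: lime_le.
    apply: ereal_nondecreasing_is_cvgn => n m nm; apply: ge0_le_integral => //;
      [exact: mphi|exact: mphi|by move=> p _; exact: phind].
  by apply: nearW => n; exact/(Lqnorm_le_fin _ C0).1.
have aeL : {ae Leb, forall p : R, 0 < p -> (L p < +oo)%E}.
  have : Leb.-integrable D L.
    apply/integrableP; split => //; under eq_integral do rewrite gee0_abs//.
    by apply: le_lt_trans intL _; rewrite ltry.
  move=> /integrable_ae => /(_ (measurable_itv _)); apply: filterS => p h p0.
  by rewrite ltey_eq h//= in_itv/= p0.
have fle n p : 0 < p -> (L p < +oo)%E -> f n p <= (fine (L p) / p `^ (2 * theta - 1)) `^ q^-1.
  move=> p0 Lp; rewrite -powR_mul_le ?powR_gt0 ?fine_ge0//.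
  rewrite -lee_fin fineK ?ge0_fin_numE//.
  by apply: le_trans (phiL n p); rewrite lee_fin ger0_norm.
split.
  apply: filterS aeL => p hp p0; apply: nondecreasing_is_cvgn; first exact: fnd.
  by exists ((fine (L p) / p `^ (2 * theta - 1)) `^ q^-1) => _ [n _ <-]; apply: fle => //; exact: hp.
move=> g mg g0 fg; rewrite mul1r; apply/(Lqnorm_le_fin _ C0).2.
apply: le_trans intL; apply: ae_ge0_le_integral => //.
- by move=> p _; rewrite lee_fin mulr_ge0 ?powR_ge0.
- exact: measurable_Lqintegrand.
apply: filterS2 aeL fg => p Lp fp; rewrite /= in_itv/= andbT => p0.
have {}Lp := Lp p0; have {}fp := fp p0.
rewrite -(@fineK _ (L p)) ?ge0_fin_numE// lee_fin (ger0_norm (g0 p)).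
rewrite powR_mul_le ?powR_gt0 ?fine_ge0//.
rewrite -(cvg_lim (@Rhausdorff R) fp); apply: limr_le; first by apply/cvg_ex; exists (g p).
by apply: nearW => n; exact: fle.
Qed.

Let c := 2 * theta / q.
Let c_range : -2 < c < 5. Proof. exact: Lq_exponent_range. Qed.

(** With c = 2 theta / q, the norm of L^q_theta is the L^q(dp/p) norm of
    p^c f.  By [mconv_powR] the weight p^c turns the kernel into V(u) u^c, of
    mass K(c); Jensen's inequality and [haar_mconv] conclude. *)
Lemma Lq_op_integral f : measurable_fun [set: R] f -> (forall p, 0 <= f p) ->
  (\int[Leb]_(p in D) (mconv kerV0 f p `^ q * (p `^ (2 * theta - 1))%:E) <=
   (fine (mellinV c) `^ q)%:E * Lqint f)%E.
Proof.
move=> mf f0; set N := fine (mellinV c).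
have Nfin := mellinV_fin c_range; have NE : mellinV c = N%:E by rewrite fineK.
have N0 : 0 < N by rewrite -lte_fin -NE mellinV_gt0.
pose k u := kerV0 u * u `^ c; pose G p := f p * p `^ c.
have mk : measurable_fun [set: R] k by exact: measurable_kerV0X.
have k0 u : 0 <= k u by exact: kerV0X_ge0.
have mG : measurable_fun [set: R] G by apply: measurable_funM => //; exact: measurable_powR.
have G0 p : 0 <= G p by rewrite mulr_ge0// powR_ge0.
have mGq : measurable_fun [set: R] (fun p => G p `^ q).
  exact: (measurableT_comp (measurable_powR q) mG).
have Gq0 p : 0 <= G p `^ q by exact: powR_ge0.
have mH : measurable_fun [set: R] (mconv kerV0 f) by apply: measurable_mconv => //; [exact: measurable_kerV0|exact: kerV0_ge0].
have H0 p : (0 <= mconv kerV0 f p)%E by apply: mconv_ge0 => //; exact: kerV0_ge0.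
have pc (p : R) : 0 < p -> p `^ (2 * theta - 1) = (p `^ c) `^ q * p^-1.
  move=> p0; rewrite -powRrM /c divfK ?gt_eqF// powRD ?(gt_eqF p0) ?implybT//.
  by rewrite powR_inv1// ltW.
have mM : measurable_fun [set: R] (mconv k (fun p => G p `^ q)) by exact: measurable_mconv.
have M0 p : (0 <= mconv k (fun p => (G p `^ q)%R) p)%E by exact: mconv_ge0.
apply: (@le_trans _ _ (haar (fun p => (N `^ (q - 1))%:E * mconv k (fun p => (G p `^ q)%R) p))%E).
  apply: ge0_le_integral => //.
  - by move=> p _; rewrite mule_ge0 ?poweR_ge0// lee_fin powR_ge0.
  - apply: emeasurable_funM; last by apply/measurable_EFinP; exact: measurable_powRl.
    by apply: measurable_funTS; exact: (measurableT_comp (measurable_poweR q) mH).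
  - by apply: measurable_haar_integrand; apply: measurable_funeM; exact: measurable_funTS.
  - move=> p; rewrite /= in_itv/= andbT => p0.
    rewrite (pc p p0) EFinM muleA lee_wpmul2r ?lee_fin ?invr_ge0 ?(ltW p0)//.
    apply: le_trans (mconv_jensen mk mG k0 G0 q1 p0 N0 NE).
    rewrite -(mconv_powR c measurable_kerV0 mf kerV0_ge0 f0 p0).
    by rewrite poweRM ?lee_fin ?powR_ge0// poweR_EFin muleC.
rewrite haarZ ?powR_ge0//; last exact: measurable_funTS.
rewrite haar_mconv// [haar (EFin \o k)]NE muleA -EFinM mulrC mulr_powRB1 ?(ltW N0)//.
rewrite lee_wpmul2l ?lee_fin ?powR_ge0//.
rewrite le_eqVlt; apply/orP; left; apply/eqP; apply: eq_integral => p.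
rewrite inE/= in_itv/= andbT => p0.
by rewrite -EFinM /G powRM ?powR_ge0// (pc p p0) mulrA (ger0_norm (f0 p)).
Qed.

Lemma Lq_op f : measurable_fun [set: R] f -> (forall p, 0 <= f p) ->
    (Lqnorm q theta f < +oo)%E ->
    {ae Leb, forall p : R, 0 < p -> (mconv kerV0 f p < +oo)%E} /\
    (Lqnorm q theta (fun p => fine (mconv kerV0 f p)) <= (fine (mellinV c))%:E * Lqnorm q theta f)%E.
Proof.
move=> mf f0 /Lqnorm_lty ffin.
have h := Lq_op_integral mf f0.
have mH : measurable_fun [set: R] (mconv kerV0 f) by apply: measurable_mconv => //; [exact: measurable_kerV0|exact: kerV0_ge0].
have H0 p : (0 <= mconv kerV0 f p)%E by apply: mconv_ge0 => //; exact: kerV0_ge0.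
have N0 : 0 <= fine (mellinV c) by rewrite fine_ge0// ltW// mellinV_gt0.
have mHq : measurable_fun D (fun p => mconv kerV0 f p `^ q * (p `^ (2 * theta - 1))%:E)%E.
  apply: emeasurable_funM; last by apply/measurable_EFinP; exact: measurable_powRl.
  by apply: measurable_funTS; exact: (measurableT_comp (measurable_poweR q) mH).
have Hq0 p : (0 <= mconv kerV0 f p `^ q * (p `^ (2 * theta - 1))%:E)%E.
  by rewrite mule_ge0 ?poweR_ge0// lee_fin powR_ge0.
split.
  have : Leb.-integrable D (fun p => mconv kerV0 f p `^ q * (p `^ (2 * theta - 1))%:E)%E.
    apply/integrableP; split => //; under eq_integral do rewrite gee0_abs//.
    by apply: le_lt_trans h _; apply: lte_mul_pinfty => //; rewrite lee_fin powR_ge0.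
  move=> /integrable_ae => /(_ (measurable_itv _)); apply: filterS => p hp p0.
  have := hp; rewrite /= in_itv/= andbT => /(_ p0).
  case: (mconv kerV0 f p) => [r| |]//; first by rewrite ltry.
  by rewrite poweRyr ?gt_eqF// gt0_mulye ?lte_fin ?powR_gt0.
rewrite !LqnormE.
have -> : ((fine (mellinV c))%:E * Lqint f `^ q^-1 = ((fine (mellinV c) `^ q)%:E * Lqint f) `^ q^-1)%E.
  rewrite poweRM ?Lqint_ge0 ?lee_fin ?powR_ge0//.
  by rewrite poweR_EFin -powRrM divff ?gt_eqF// powRr1.
apply: poweR_inv_le; first exact: Lqint_ge0.
apply: le_trans h; apply: ge0_le_integral => //.
- by move=> p _; rewrite lee_fin mulr_ge0 ?powR_ge0.
- apply: measurable_Lqintegrand; apply: measurable_funTS.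
  exact: (measurableT_comp _ mH).
- move=> p _; rewrite EFinM lee_wpmul2r ?lee_fin ?powR_ge0//.
  move: (H0 p); case: (mconv kerV0 f p) => [r| |]//= r0.
    by rewrite ger0_norm.
  by rewrite gt_eqF// leey.
Qed.

Lemma good_Lq : good_space (Lq q theta) (fine (mellinV c)) 1.
Proof.
split.
- by rewrite fine_ge0// ltW// mellinV_gt0.
- exact: ler01.
- by move=> f; exact: poweR_ge0.
- by [].
- move=> f g mf mg fg; apply: poweR_inv_le; [exact: Lqint_ge0|exact: Lqint_le].
- exact: Lqnorm_add.
- exact: Lqnorm_scale.
- exact: Lqnorm_eq0.
- exact: Lq_sup.
- exact: Lq_op.
Qed.

End Lq.

Lemma Y_exponents (a b : R) :
  - (5 / 2) < b -> b < - (3 / 4) -> 1 / 2 < a -> a < 1 ->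
  [/\ 2 * b <= 2 * a, 0 <= 2 * a, 2 * b <= 0, -2 < - (2 * a) < 5 & -2 < - (2 * b) < 5].
Proof. by move=> ? ? ? ?; split; [| | |apply/andP; split|apply/andP; split]; lra. Qed.

Section Y.
Variables (a b : R).
Hypotheses (b1 : - (5 / 2) < b) (b2 : b < - (3 / 4)) (a1 : 1 / 2 < a) (a2 : a < 1).

Let lebT : (0 < @lebesgue_measure R [set: R])%E.
Proof. by rewrite -set_itvNyy lebesgue_measure_itv/= lt0y. Qed.

Let expo := Y_exponents b1 b2 a1 a2.

Lemma weighted_sup_le (I : set R) (c : R) (g : R -> R) (M : R) : 0 <= M ->
  (weighted_sup I c g <= M%:E)%E <->
  {ae Leb, forall p : R, I p -> p `^ (- (2 * c)) * `|g p| <= M}.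
Proof.
move=> M0; split.
  move=> /ess_supP; apply: filterS => p /= + Ip; rewrite patchE mem_set //.
move=> h; apply/ess_supP; apply: filterS h => p h /=; rewrite patchE.
by case: ifPn => [/[!inE] /h|_]; rewrite ?lee_fin.
Qed.

Lemma weighted_sup_ge0 (I : set R) (c : R) (g : R -> R) : (0 <= weighted_sup I c g)%E.
Proof.
apply: ess_sup_gee; first exact: lebT.
apply: aeW => p /=; rewrite patchE ?lee_fin.
by case: ifP => // _; rewrite mulr_ge0// powR_ge0.
Qed.

Lemma weighted_sup_mono (I : set R) (c : R) (f g : R -> R) : I `<=` D ->
  {ae Leb, forall p : R, 0 < p -> `|f p| <= `|g p|} ->
  (weighted_sup I c f <= weighted_sup I c g)%E.
Proof.
move=> ID fg; apply: le_ess_sup; apply: filterS fg => p h /=; rewrite !patchE lee_fin.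
case: ifPn => //; rewrite inE => /ID; rewrite /= in_itv/= andbT => p0.
by rewrite ler_wpM2l ?powR_ge0// h.
Qed.

Lemma weighted_supD (I : set R) (c : R) (f g : R -> R) :
  (weighted_sup I c (fun p => f p + g p)%R <= weighted_sup I c f + weighted_sup I c g)%E.
Proof.
rewrite /weighted_sup; apply: le_trans (ess_supD _ _ _); apply: le_ess_sup.
apply: aeW => p /=; rewrite !patchE -EFinD lee_fin.
case: ifPn => // _; last by rewrite addr0.
by rewrite -mulrDr ler_wpM2l ?powR_ge0// ler_normD.
Qed.

Lemma weighted_supZ (I : set R) (c k : R) (f : R -> R) : 0 <= k ->
  (weighted_sup I c (fun p => k * f p)%R = k%:E * weighted_sup I c f)%E.
Proof.
move=> k0; rewrite /weighted_sup -ess_supZl; [|exact: lebT|exact: k0]. apply: eq_ess_sup; apply: aeW => p /=; rewrite !patchE -EFinM; congr (_%:E).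
case: ifPn => // _; last by rewrite mulr0.
by rewrite normrM (ger0_norm k0) mulrCA.
Qed.

Lemma Ynorm_ge0 f : (0 <= Ynorm a b f)%E.
Proof. by rewrite adde_ge0 ?weighted_sup_ge0. Qed.

Lemma ae_neq1 : {ae (@lebesgue_measure R), forall p : R, p != 1}.
Proof.
exists [set 1]; split => //; first exact: lebesgue_measure_set1.
by move=> p /= /negP; rewrite negbK => /eqP.
Qed.

Let I0 : `]0, 1[%classic `<=` D.
Proof. by move=> p; rewrite /= !in_itv/= andbT => /andP[]. Qed.
Let I1 : `]1, +oo[%classic `<=` D.
Proof. by move=> p; rewrite /= !in_itv/= !andbT; exact: lt_trans. Qed.

(** Because b < 0 < a, each of the two power bounds holds on the whole
    half-line and not only on its own side of 1. *)
Lemma Ynorm_bounds f (M : R) : (Ynorm a b f <= M%:E)%E ->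
  {ae Leb, forall p : R, 0 < p -> `|f p| <= M * p `^ (2 * a) /\ `|f p| <= M * p `^ (2 * b)}.
Proof.
move=> h; have M0 : 0 <= M by rewrite -lee_fin; apply: le_trans h; exact: Ynorm_ge0.
have h0 : (weighted_sup `]0%R, 1%R[ a f <= M%:E)%E.
  by apply: le_trans h; rewrite leeDl// weighted_sup_ge0.
have h1 : (weighted_sup `]1%R, +oo[ b f <= M%:E)%E.
  by apply: le_trans h; rewrite leeDr// weighted_sup_ge0.
have [ab _ _ _ _] := expo.
have inv (p c : R) : 0 < p -> p `^ (- (2 * c)) * `|f p| <= M -> `|f p| <= M * p `^ (2 * c).
  move=> p0; rewrite powRN mulrC ler_pdivrMr// powR_gt0//.
apply: filterS3 ae_neq1 ((weighted_sup_le _ _ _ M0).1 h0) ((weighted_sup_le _ _ _ M0).1 h1).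
move=> p p1 /= h0p h1p p0.
have [pl|pg|/eqP] := ltgtP p 1; last by rewrite (negbTE p1).
  have := h0p; rewrite /= in_itv/= p0 pl => /(_ isT)/(inv _ _ p0) H; split => //.
  by apply: (le_trans H); rewrite ler_wpM2l// ger_powR// p0 ltW.
have := h1p; rewrite /= in_itv/= pg => /(_ isT)/(inv _ _ p0) H; split => //.
by apply: (le_trans H); rewrite ler_wpM2l// ler_powR// ltW.
Qed.

Lemma Ynorm_le f (M1 M2 : R) : 0 <= M1 -> 0 <= M2 ->
  {ae Leb, forall p : R, 0 < p -> `|f p| <= M1 * p `^ (2 * a) /\ `|f p| <= M2 * p `^ (2 * b)} ->
  (Ynorm a b f <= (M1 + M2)%:E)%E.
Proof.
move=> M10 M20 h; rewrite EFinD; apply: leeD; apply/weighted_sup_le => //.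
- apply: filterS h => p hp /I0; rewrite /= in_itv/= andbT => p0.
  by rewrite powRN mulrC ler_pdivrMr ?powR_gt0//; have [] := hp p0.
- apply: filterS h => p hp /I1; rewrite /= in_itv/= andbT => p0.
  by rewrite powRN mulrC ler_pdivrMr ?powR_gt0//; have [] := hp p0.
Qed.

Lemma fine_Ynorm f : (Ynorm a b f < +oo)%E -> Ynorm a b f = (fine (Ynorm a b f))%:E.
Proof. by move=> h; rewrite fineK// ge0_fin_numE// Ynorm_ge0. Qed.

Lemma Y_mem f : fmem (Yspace a b) f <-> measurable_fun D f /\ (Ynorm a b f < +oo)%E.
Proof.
split => [[[mf _] h]//|[mf h]]; split => //; split => // K _ KD.
exists (fine (Ynorm a b f)); have := h => /fine_Ynorm E.
have M0 : 0 <= fine (Ynorm a b f) by rewrite fine_ge0// Ynorm_ge0.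
have : (Ynorm a b f <= (fine (Ynorm a b f))%:E)%E by rewrite -E.
move=> /Ynorm_bounds; apply: filterS => p hp /KD; rewrite /= in_itv/= andbT => p0.
have [ha hb] := hp p0; have [p1|p1] := leP p 1.
  apply: (le_trans ha); rewrite ler_piMr//.
  have [_ + _ _ _] := expo => a0; rewrite -[leRHS](powRr0 p).
  by apply: ger_powR => //; rewrite p0.
apply: (le_trans hb); rewrite ler_piMr//.
have [_ _ + _ _] := expo => b0; rewrite -[leRHS](powRr0 p).
by apply: ler_powR => //; exact: ltW.
Qed.

(** The pointwise bounds pass to the limit; the factor 2 comes from bounding
    each of the two suprema by the full norm. *)
Lemma Y_sup (f : nat -> R -> R) (C : R) : (forall n, measurable_fun D (f n)) ->
    (forall n p, 0 <= f n p) -> (forall p, nondecreasing_seq (f^~ p)) ->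
    (forall n, Ynorm a b (f n) <= C%:E)%E ->
    {ae Leb, forall p : R, 0 < p -> cvgn (f^~ p)} /\
    (forall g, measurable_fun D g -> (forall p, 0 <= g p) ->
      {ae Leb, forall p : R, 0 < p -> (f^~ p) @ \oo --> g p} -> (Ynorm a b g <= (2 * C)%:E)%E).
Proof.
move=> mf f0 fnd fC.
have C0 : 0 <= C by rewrite -lee_fin; apply: le_trans (fC 0%N); exact: Ynorm_ge0.
have h : {ae Leb, forall p : R, forall n, 0 < p -> `|f n p| <= C * p `^ (2 * a) /\ `|f n p| <= C * p `^ (2 * b)}.
  by apply: ae_foralln => n; exact: Ynorm_bounds.
split.
  apply: filterS h => p hp p0; apply: nondecreasing_is_cvgn; first exact: fnd.
  exists (C * p `^ (2 * a)) => _ [n _ <-].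
  by have [+ _] := hp n p0; rewrite ger0_norm.
move=> g mg g0 fg; rewrite (_ : 2 * C = C + C); last by ring.
apply: Ynorm_le => //; apply: filterS2 h fg => p hp fp p0.
have {}fp := fp p0; rewrite (ger0_norm (g0 p)) -(cvg_lim (@Rhausdorff R) fp).
have cf : cvgn (f^~ p) by apply/cvg_ex; exists (g p).
split; apply: limr_le => //; apply: nearW => n; have [] := hp n p0; by rewrite ger0_norm.
Qed.

Lemma le_haar_ae (g h : R -> \bar R) : measurable_fun D g -> measurable_fun D h ->
  (forall p, 0 < p -> (0 <= g p)%E) -> (forall p, 0 < p -> (0 <= h p)%E) ->
  {ae Leb, forall p : R, 0 < p -> (g p <= h p)%E} ->
  (haar g <= haar h)%E.
Proof.
move=> mg mh g0 h0 gh; apply: ae_ge0_le_integral => //.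
- by move=> p; rewrite /= in_itv/= andbT => p0; rewrite mule_ge0 ?g0// lee_fin invr_ge0 ltW.
- exact: measurable_haar_integrand.
- by move=> p; rewrite /= in_itv/= andbT => p0; rewrite mule_ge0 ?h0// lee_fin invr_ge0 ltW.
- exact: measurable_haar_integrand.
- apply: filterS gh => p gh; rewrite /= in_itv/= andbT => p0.
  by rewrite lee_wpmul2r ?gh// lee_fin invr_ge0 ltW.
Qed.

(** Powers are eigenfunctions of the convolution:
    int V(p/q) q^c dq/q = K(-c) p^c. *)
Lemma mconv_le_powR (f : R -> R) (c M : R) : measurable_fun [set: R] f -> (forall p, 0 <= f p) ->
  0 <= M -> -2 < - c < 5 -> {ae Leb, forall p : R, 0 < p -> f p <= M * p `^ c} ->
  forall p, 0 < p -> (mconv kerV0 f p <= (fine (mellinV (- c)) * M * p `^ c)%:E)%E.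
Proof.
move=> mf f0 M0 c5 fM p p0.
have pc : 0 < p `^ (- c) by exact: powR_gt0.
rewrite -(@lee_pmul2l _ (p `^ (- c))%:E)//.
rewrite (mconv_powR _ measurable_kerV0 mf kerV0_ge0 f0 p0).
rewrite -EFinM mulrCA -powRD ?(gt_eqF p0) ?implybT// addNr powRr0 mulr1.
rewrite mulrC EFinM fineK ?mellinV_fin//.
rewrite /mellinV -(haar_refl (@measurable_kerV0X R (- c)) (kerV0X_ge0 (- c)) p0).
have mr : measurable_fun [set: R] (fun q => kerV0 (p / q) * (p / q) `^ (- c)).
  apply: (measurableT_comp (@measurable_kerV0X R (- c))); apply: measurable_funM => //.
  exact: measurable_fun_invr.
rewrite -haarZ; last 3 first.
- exact: M0.
- by apply/measurable_EFinP; exact: measurable_funTS.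
- by move=> q q0; rewrite lee_fin kerV0X_ge0.
apply: le_haar_ae.
- apply/measurable_EFinP; apply: measurable_funTS; apply: measurable_funM => //.
  by apply: measurable_funM => //; exact: measurable_powR.
- by apply: measurable_funeM; apply/measurable_EFinP; exact: measurable_funTS.
- by move=> q q0; rewrite lee_fin mulr_ge0 ?kerV0X_ge0// mulr_ge0 ?powR_ge0.
- by move=> q q0; rewrite mule_ge0 ?lee_fin ?kerV0X_ge0.
- apply: filterS fM => q hq q0; rewrite -EFinM lee_fin mulrC ler_wpM2r ?kerV0X_ge0//.
  by rewrite powRN ler_pdivrMr ?powR_gt0// hq.
Qed.

Let Ka := fine (mellinV (- (2 * a))).
Let Kb := fine (mellinV (- (2 * b))).
Let Ka0 : 0 <= Ka. Proof. by rewrite fine_ge0// ltW// mellinV_gt0. Qed.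
Let Kb0 : 0 <= Kb. Proof. by rewrite fine_ge0// ltW// mellinV_gt0. Qed.

Lemma Y_op f : measurable_fun [set: R] f -> (forall p, 0 <= f p) ->
    (Ynorm a b f < +oo)%E ->
    {ae Leb, forall p : R, 0 < p -> (mconv kerV0 f p < +oo)%E} /\
    (Ynorm a b (fun p => fine (mconv kerV0 f p)) <= (Ka + Kb)%:E * Ynorm a b f)%E.
Proof.
move=> mf f0 ffin; set M := fine (Ynorm a b f).
have E := fine_Ynorm ffin.
have M0 : 0 <= M by rewrite fine_ge0// Ynorm_ge0.
have bd := @Ynorm_bounds f M; rewrite -E lexx in bd; have {}bd := bd isT.
have [_ _ _ ca cb] := expo.
have ha : forall p, 0 < p -> (mconv kerV0 f p <= (Ka * M * p `^ (2 * a))%:E)%E.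
  apply: mconv_le_powR => //; apply: filterS bd => p h /h[+ _].
  by rewrite ger0_norm.
have hb : forall p, 0 < p -> (mconv kerV0 f p <= (Kb * M * p `^ (2 * b))%:E)%E.
  apply: mconv_le_powR => //; apply: filterS bd => p h /h[_ +].
  by rewrite ger0_norm.
have H0 p : (0 <= mconv kerV0 f p)%E by apply: mconv_ge0 => //; exact: kerV0_ge0.
have fin p : 0 < p -> (mconv kerV0 f p < +oo)%E.
  by move=> p0; apply: le_lt_trans (ha p p0) _; rewrite ltry.
split; first by apply: nearW => p; exact: fin.
rewrite E -EFinM mulrDl; apply: Ynorm_le; [exact: mulr_ge0 Ka0 M0|exact: mulr_ge0 Kb0 M0|].
apply: nearW => p p0; rewrite ger0_norm ?fine_ge0//.
by rewrite -!lee_fin fineK ?ge0_fin_numE ?fin// ha// hb.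
Qed.

Lemma good_Y : good_space (Yspace a b) (Ka + Kb) 2.
Proof.
split.
- exact: addr_ge0 Ka0 Kb0.
- by [].
- exact: Ynorm_ge0.
- exact: Y_mem.
- by move=> f g _ _ fg; apply: leeD; exact: weighted_sup_mono.
- move=> f g _ _; rewrite /= /Ynorm.
  apply: le_trans (leeD (weighted_supD _ _ _ _) (weighted_supD _ _ _ _)) _.
  by rewrite addeACA.
- move=> c f _ c0; rewrite /= /Ynorm !weighted_supZ// ge0_muleDr ?weighted_sup_ge0//.
- move=> f _ h.
  have /Ynorm_bounds : (Ynorm a b f <= 0%:E)%E by rewrite [Ynorm a b f]h.
  by apply: filterS => p hp /hp[+ _]; rewrite mul0r normr_le0 => /eqP.
- exact: Y_sup.
- exact: Y_op.
Qed.

End Y.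
End spaces.

(** * Gronwall and Taylor estimates for real functions of time *)

Section scalar.
Context {R : realType}.

(** Gronwall's inequality for a continuous function with a bound on its upper
    right increments.  For each eps > 0 the barrier eps exp ((K + 1) t) cannot be
    crossed: just after the last time at which f lies below it, f would have to
    grow at a rate larger than K + 1. *)
Lemma gronwall_le0 (f : R -> R) (K : R) : 0 <= K ->
  (forall t, 0 <= t -> forall e, 0 < e -> exists2 d, 0 < d & forall s, 0 <= s -> `|s - t| < d -> `|f s - f t| < e) ->
  f 0 <= 0 ->
  (forall t, 0 < t -> forall e, 0 < e -> exists2 d, 0 < d & forall h, 0 < h < d -> f (t + h) <= (1 + h * K) * f t + h * e) ->
  forall t, 0 <= t -> f t <= 0.
Proof.
move=> K0 cf f0 df T T0.
suff bound eps : 0 < eps -> f T <= eps * expR ((K + 1) * T).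
  apply/ler_addgt0Pr => e e0; rewrite add0r.
  have x0 : 0 < expR ((K + 1) * T) by exact: expR_gt0.
  by have := bound (e / expR ((K + 1) * T)); rewrite divfK ?gt_eqF//; apply; rewrite divr_gt0.
move=> e0; rewrite leNgt; apply/negP => gT.
pose E s := eps * expR ((K + 1) * s).
have E0 s : 0 < E s by rewrite mulr_gt0// expR_gt0.
have K1 : 0 <= K + 1 by rewrite addr_ge0.
have Emono s t : s <= t -> E s <= E t.
  by move=> st; rewrite ler_wpM2l ?(ltW e0)// ler_expR ler_wpM2l.
(* its supremum t0 is the last time before T at which f is below the barrier *)
pose S := [set s | 0 <= s <= T /\ f s <= E s].
have S0 : S 0 by split; [rewrite lexx T0|exact: le_trans (ltW (E0 0))].
have Sub : has_ubound S by exists T => s [/andP[]].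
have hS : has_sup S by split => //; exists 0.
set t0 := sup S.
have t00 : 0 <= t0 by exact: ub_le_sup.
have t0T : t0 <= T by apply: ge_sup; [exists 0|move=> s [/andP[]]].
have above s : t0 < s -> s <= T -> E s < f s.
  move=> ts sT; rewrite ltNge; apply/negP => fs.
  have : S s by split => //; rewrite sT (le_trans t00)// ltW.
  by move=> /(ub_le_sup Sub); rewrite leNgt ts.
have ft0 : f t0 <= E t0.
  rewrite leNgt; apply/negP => ft.
  have [d d0 hd] := cf t0 t00 (f t0 - E t0) ltac:(by rewrite subr_gt0).
  have [s Ss] := sup_adherent d0 hS; rewrite -/t0 => ds.
  have [/andP[s0 sT] fs] := Ss.
  have st : s <= t0 by exact: ub_le_sup.
  have := hd s s0; rewrite distrC ger0_norm ?subr_ge0// => /(_ _).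
  move=> /(_ ltac:(by rewrite ltrBlDl -ltrBlDr)); rewrite distrC.
  have := Emono _ _ st; have := ler_norm (f t0 - f s); lra.
have t0lt : t0 < T.
  by rewrite lt_neqAle t0T andbT; apply/eqP => t0E; move: gT; rewrite -t0E ltNge ft0.
(* at t0 = 0 the increments are not controlled, but f 0 <= 0 lies strictly
   below the barrier and continuity suffices *)
have [t0z|t0p] := eqVneq t0 0.
  have [d d0 hd] := cf 0 (lexx 0) eps e0.
  pose s := Num.min (d / 2) T.
  have s0 : 0 < s by rewrite lt_min divr_gt0//= -t0z.
  have sd : s < d by rewrite (@le_lt_trans _ _ (d / 2)) ?ge_min ?lexx//; lra.
  have sT : s <= T by rewrite ge_min lexx orbT.
  have := hd s (ltW s0); rewrite subr0 gtr0_norm// => /(_ sd).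
  have := above s; rewrite t0z => /(_ s0 sT).
  have : E 0 <= E s by exact/Emono/ltW.
  rewrite {1}/E mulr0 expR0 mulr1.
  have := ler_norm (f s - f 0); lra.
have {}t0p : 0 < t0 by rewrite lt_neqAle eq_sym t0p.
have [d d0 hd] := df t0 t0p (E t0) (E0 t0).
pose h := Num.min (d / 2) (T - t0).
have h0 : 0 < h by rewrite lt_min divr_gt0//= subr_gt0.
have hd' : h < d by rewrite (@le_lt_trans _ _ (d / 2)) ?ge_min ?lexx//; lra.
have hT : t0 + h <= T by rewrite -lerBrDl ge_min lexx orbT.
have := hd h; rewrite h0 hd' => /(_ isT).
have := above (t0 + h); rewrite ltrDl => /(_ h0 hT).
have -> : E (t0 + h) = E t0 * expR ((K + 1) * h) by rewrite /E mulrDr expRD mulrA.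
have : E t0 * (1 + (K + 1) * h) <= E t0 * expR ((K + 1) * h).
  by rewrite ler_wpM2l ?(ltW (E0 _))// expR_ge1Dx.
have : (1 + h * K) * f t0 <= (1 + h * K) * E t0.
  by rewrite ler_wpM2l// addr_ge0// mulr_ge0// ltW.
lra.
Qed.

Lemma mvt_between (f df : R -> R) (s t : R) :
  (forall x, is_derive x (1 : R) f (df x)) ->
  exists2 c, Num.min s t <= c <= Num.max s t & f s - f t = df c * (s - t).
Proof.
move=> dfx; have [st|ts] := leP s t.
- have [|c + E] := @MVT_segment R f df s t st.
  + by apply: derivable_within_continuous => x _; apply: ex_derive; exact: dfx.
  rewrite in_itv/= => cst; exists c => //.
  by rewrite -opprB E -mulrN opprB.
- have [|c + E] := @MVT_segment R f df t s (ltW ts).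
  + by apply: derivable_within_continuous => x _; apply: ex_derive; exact: dfx.
  by rewrite in_itv/= => cst; exists c.
Qed.

(** Applied for each fixed p to the solution as a function of time. *)
Lemma taylor1 (f df ddf : R -> R) (r M1 M2 : R) :
  (forall x, is_derive x (1 : R) f (df x)) ->
  (forall x, is_derive x (1 : R) df (ddf x)) ->
  (forall x, 0 <= x <= r -> `|df x| <= M1) ->
  (forall x, 0 <= x <= r -> `|ddf x| <= M2) ->
  forall s t, 0 <= s <= r -> 0 <= t <= r ->
  [/\ `|f s - f t| <= M1 * `|s - t|, `|df s - df t| <= M2 * `|s - t| &
      `|f s - f t - (s - t) * df t| <= M2 * `|s - t| ^+ 2].
Proof.
move=> d1 d2 b1 b2 s t /andP[s0 sr] /andP[t0 tr].
have btw c x y : 0 <= x <= r -> 0 <= y <= r -> Num.min x y <= c <= Num.max x y -> 0 <= c <= r.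
  move=> /andP[x0 xr] /andP[y0 yr] /andP[c1 c2]; apply/andP; split.
    by apply: le_trans c1; rewrite le_min x0.
  by apply: (le_trans c2); rewrite ge_max xr.
have sr' : 0 <= s <= r by rewrite s0. have tr' : 0 <= t <= r by rewrite t0.
have lip x y : 0 <= x <= r -> 0 <= y <= r -> `|df x - df y| <= M2 * `|x - y|.
  move=> hx hy; have [c hc ->] := @mvt_between df ddf x y d2.
  by rewrite normrM ler_wpM2r// b2//; exact: btw hc.
have [c hc E] := @mvt_between f df s t d1.
have c0r : 0 <= c <= r by exact: btw hc.
split.
- by rewrite E normrM ler_wpM2r// b1.
- exact: lip.
- rewrite E [X in _ - X]mulrC -mulrBl normrM expr2 mulrA ler_wpM2r//.
  apply: (le_trans (lip _ _ c0r tr')).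
  have M20 : 0 <= M2 by apply: le_trans (b2 _ sr').
  rewrite ler_wpM2l//; move: hc; clear.
  by case: (leP s t) => st /andP[? ?]; rewrite ler_norml; [rewrite ler0_norm ?subr_le0//|rewrite ger0_norm ?subr_ge0 ?(ltW st)//]; apply/andP; split; lra.
Qed.

Definition ecoef (b : nat -> R) (n : nat) : R := b n / n`!%:R.
(** When b is the sequence of the n-th iterates T^n A0 at a point, this is
    exp(t T) A0 at that point. *)
Definition egf (b : nat -> R) (t : R) : R := limn (pseries (ecoef b) t).

Lemma ecoef_diffs b : pseries_diffs (ecoef b) = ecoef (fun n => b n.+1).
Proof.
apply/funext => n; rewrite /pseries_diffs /ecoef factS natrM invfM mulrCA mulrA.
by rewrite mulrA mulfK ?pnatr_eq0.
Qed.

(** Differentiation shifts the sequence; convergence everywhere of the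
    sequence and its shifts is what term-by-term differentiation requires. *)
Lemma egf_derive (b : nat -> R) : (forall i (r : R), cvgn (pseries (ecoef (fun n => b (n + i)%N)) r)) ->
  forall t, is_derive t (1 : R) (egf b) (egf (fun n => b n.+1) t).
Proof.
move=> cb t.
have := @pseries_snd_diffs R (ecoef b) (`|t| + 1) t.
rewrite !ecoef_diffs; apply.
- by have := cb 0%N (`|t| + 1); under [fun n => b (n + 0)%N]eq_fun do rewrite addn0.
- by have := cb 1%N (`|t| + 1); under [fun n => b (n + 1)%N]eq_fun do rewrite addn1.
- by have := cb 2%N (`|t| + 1); under [fun n => b (n + 2)%N]eq_fun do rewrite addn2.
- by rewrite [ltRHS]ger0_norm// ltrDl.
Qed.

Section egf_bounds.
Variable b : nat -> R.
Hypothesis b0 : forall n, 0 <= b n.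
Hypothesis cb : forall (r : R), cvgn (pseries (ecoef b) r).

Lemma ecoef_ge0 n : 0 <= ecoef b n.
Proof. by rewrite /ecoef divr_ge0. Qed.

Lemma egf_ge0 (s : R) : 0 <= s -> 0 <= egf b s.
Proof.
move=> s0; apply: limr_ge; first exact: cb.
apply: nearW => n; apply: sumr_ge0 => i _.
by rewrite mulr_ge0 ?ecoef_ge0// exprn_ge0.
Qed.

Lemma egf_mono (s t : R) : 0 <= s <= t -> egf b s <= egf b t.
Proof.
move=> /andP[s0 st]; apply: ler_lim; [exact: cb|exact: cb|].
apply: nearW => n; apply: ler_sum => i _.
by rewrite ler_wpM2l ?ecoef_ge0// lerXn2r// nnegrE// (le_trans s0).
Qed.

End egf_bounds.

(** Bounds for the first and second derivatives of exp(g t) x(t), where x' = y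
    and y' = z, in terms of bounds for x, y, z. *)
Lemma damped_bounds (x y z G a0 a1 a2 g e : R) : 0 <= x <= a0 -> 0 <= y <= a1 -> 0 <= z <= a2 ->
  0 <= e <= G ->
  let M := G * (1 + `|g|) ^+ 2 * (a0 + a1 + a2) in
  `|g * (e * x) + e * y| <= M /\
  `|g * (g * (e * x) + e * y) + (g * (e * y) + e * z)| <= M.
Proof.
move=> /andP[x0 xa] /andP[y0 ya] /andP[z0 za] /andP[e0 eG] M.
have h0 := normr_ge0 g; set h := `|g| in h0 M *.
have G0 : 0 <= G by exact: le_trans eG.
have c0 : 0 <= G * a0 by rewrite mulr_ge0// (le_trans x0).
have c1 : 0 <= G * a1 by rewrite mulr_ge0// (le_trans y0).
have c2 : 0 <= G * a2 by rewrite mulr_ge0// (le_trans z0).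
have ME : M = (1 + h * 2 + h * h) * (G * a0 + G * a1 + G * a2) by rewrite /M; ring.
have b0 : e * x <= G * a0 by exact: ler_pM.
have b1 : e * y <= G * a1 by exact: ler_pM.
have b2 : e * z <= G * a2 by exact: ler_pM.
have ex0 : 0 <= e * x by exact: mulr_ge0. have ey0 : 0 <= e * y by exact: mulr_ge0.
have ez0 : 0 <= e * z by exact: mulr_ge0.
have hh0 : 0 <= h * h by exact: mulr_ge0.
split.
- apply: (le_trans (ler_normD _ _)); rewrite normrM -/h (ger0_norm ex0) (ger0_norm ey0) ME.
  have : h * (e * x) <= h * (G * a0) by exact: ler_wpM2l.
  have := mulr_ge0 h0 c0; have := mulr_ge0 h0 c1; have := mulr_ge0 h0 c2.
  have := mulr_ge0 hh0 c0; have := mulr_ge0 hh0 c1; have := mulr_ge0 hh0 c2.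
  by nra.
- have -> : g * (g * (e * x) + e * y) + (g * (e * y) + e * z) = (g * g) * (e * x) + (g * (2 * (e * y)) + e * z) by ring.
  apply: (le_trans (ler_normD _ _)); rewrite normrM (ger0_norm ex0).
  apply: (@le_trans _ _ (`|g * g| * (e * x) + (h * (2 * (e * y)) + e * z))).
    rewrite lerD2l; apply: (le_trans (ler_normD _ _)); rewrite normrM -/h (ger0_norm ez0).
    by rewrite [`|2 * _|]ger0_norm// mulr_ge0.
  rewrite normrM -/h ME.
  have : h * h * (e * x) <= h * h * (G * a0) by exact: ler_wpM2l.
  have : h * (e * y) <= h * (G * a1) by exact: ler_wpM2l.
  have := mulr_ge0 h0 c0; have := mulr_ge0 h0 c1; have := mulr_ge0 h0 c2.
  have := mulr_ge0 hh0 c0; have := mulr_ge0 hh0 c1; have := mulr_ge0 hh0 c2.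
  by nra.
Qed.

(** With nonnegative coefficients the generating functions increase in t, so
    their values at the right end r bound the derivatives on all of [0, r]. *)
Lemma damped_egf_taylor (b : nat -> R) (g r : R) : (forall n, 0 <= b n) ->
  (forall i (r : R), cvgn (pseries (ecoef (fun n => b (n + i)%N)) r)) ->
  let E i := egf (fun n => b (n + i)%N) in
  let F t := expR (g * t) * E 0 t in
  let dF t := g * F t + expR (g * t) * E 1 t in
  let M := expR (`|g| * r) * (1 + `|g|) ^+ 2 * (E 0 r + E 1 r + E 2 r) in
  forall s t, 0 <= s <= r -> 0 <= t <= r ->
  [/\ `|F s - F t| <= M * `|s - t|, `|dF s - dF t| <= M * `|s - t| &
      `|F s - F t - (s - t) * dF t| <= M * `|s - t| ^+ 2].
Proof.
move=> b0 cb E F dF M.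
have dE i (t : R) : is_derive t (1 : R) (E i) (E i.+1 t).
  have := @egf_derive (fun n => b (n + i)%N); rewrite /E.
  under [X in egf X t]eq_fun do rewrite addnS.
  by apply => j r'; under eq_fun do rewrite -addnA; exact: cb.
have dex (t : R) : is_derive t (1 : R) (fun t => expR (g * t)) (g * expR (g * t)).
  have h1 : is_derive t (1 : R) (fun t : R => g * t) g.
    by have := @is_deriveZ _ _ _ (@id R) g t 1 1 _; rewrite /GRing.scale/= mulr1; apply.
  have := @is_derive1_comp R expR _ t _ _ (is_derive_expR (g * t)) h1.
  by rewrite mulrC; apply.
have dG i (t : R) : is_derive t (1 : R) (fun t => expR (g * t) * E i t)
    (g * (expR (g * t) * E i t) + expR (g * t) * E i.+1 t).
  have := @is_deriveM _ _ _ _ _ _ _ _ (dex t) (dE i t).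
  move=> h; have -> : g * (expR (g * t) * E i t) + expR (g * t) * E i.+1 t
    = expR (g * t) *: E i.+1 t + E i t *: (g * expR (g * t)); last exact: h.
  by rewrite /GRing.scale/=; ring.
have bnd t : 0 <= t <= r -> [/\ 0 <= E 0 t <= E 0 r, 0 <= E 1 t <= E 1 r, 0 <= E 2 t <= E 2 r
   & 0 <= expR (g * t) <= expR (`|g| * r)].
  move=> /andP[t0 tr]; have h i : 0 <= E i t <= E i r.
    by apply/andP; split; [exact: egf_ge0|apply: egf_mono => //; rewrite t0].
  split; [exact: h|exact: h|exact: h|].
  rewrite expR_ge0 ler_expR.
  apply: (@le_trans _ _ (`|g| * t)); first by rewrite ler_wpM2r// ler_norm.
  by rewrite ler_wpM2l.
apply: (@taylor1 F dF (fun t => g * dF t + (g * (expR (g * t) * E 1 t) + expR (g * t) * E 2 t))).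
- by move=> x /bnd[x0 x1 x2 xe]; exact: (damped_bounds g x0 x1 x2 xe).1.
- by move=> x /bnd[x0 x1 x2 xe]; exact: (damped_bounds g x0 x1 x2 xe).2.
Qed.

End scalar.

(** * The explicit solution, and uniqueness *)

Section flow.
Context {R : realType}.
Local Notation D := (`]0, +oo[%classic : set R).

(** T^n g0, made real-valued by [fine]; no information is lost where the
    convolutions are finite, that is almost everywhere ([kiter_ae_lty]). *)
Definition kiter (g0 : R -> R) (n : nat) : R -> R :=
  iter n (fun f p => fine (mconv kerV0 f p)) g0.

(** exp(t T) T^i g0, as an extended real: the terms are nonnegative, so the
    series makes sense at every point and is measurable, whether or not it
    converges there. *)
Definition expser (g0 : R -> R) (i : nat) (t p : R) : \bar R :=
  (\sum_(0 <= n <oo) (ecoef (fun n => kiter g0 (n + i) p) n * t ^+ n)%:E)%E.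

(** The points at which all manipulations of the series are legitimate. *)
Definition regular (g0 : R -> R) (p : R) :=
  (forall i (r : R), cvgn (pseries (ecoef (fun n => kiter g0 (n + i) p)) r)) /\
  (forall n, (mconv kerV0 (kiter g0 n) p < +oo)%E).

Definition flow (g0 : R -> R) (t p : R) : R :=
  expR (gammaN R * t) * fine (expser g0 0 t p).

Definition dflow (g0 : R -> R) (t p : R) : R :=
  gammaN R * flow g0 t p + expR (gammaN R * t) * fine (expser g0 1 t p).

Section basic.
Variables (g0 : R -> R).
Hypotheses (mg0 : measurable_fun [set: R] g0) (g00 : forall p, 0 <= g0 p).

Lemma kiter_prop n : measurable_fun [set: R] (kiter g0 n) /\ (forall p, 0 <= kiter g0 n p).
Proof.
elim: n => [//|n [mi i0]]; split=> [|p] /=.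
- have mH : measurable_fun [set: R] (mconv kerV0 (kiter g0 n)).
    by apply: measurable_mconv => //; [exact: measurable_kerV0|exact: kerV0_ge0].
  exact: (measurableT_comp _ mH).
- by rewrite fine_ge0// mconv_ge0//; exact: kerV0_ge0.
Qed.

Lemma measurable_kiter n : measurable_fun [set: R] (kiter g0 n).
Proof. by have [] := kiter_prop n. Qed.

Lemma kiter_ge0 n p : 0 <= kiter g0 n p.
Proof. by have [_] := kiter_prop n. Qed.

Lemma expser_term_ge0 i t p n : 0 <= t ->
  0 <= ecoef (fun n => kiter g0 (n + i) p) n * t ^+ n.
Proof. by move=> t0; rewrite /ecoef mulr_ge0 ?exprn_ge0 ?divr_ge0 ?kiter_ge0. Qed.

Lemma measurable_expser_term i t n :
  measurable_fun [set: R] (fun p => ecoef (fun n => kiter g0 (n + i) p) n * t ^+ n).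
Proof.
rewrite /ecoef; apply: measurable_funM => //; apply: measurable_funM => //.
exact: measurable_kiter.
Qed.

Lemma measurable_expser i t : 0 <= t -> measurable_fun [set: R] (expser g0 i t).
Proof.
move=> t0; apply: (@ge0_emeasurable_sum _ _ _ _
  (fun n p => (ecoef (fun n => kiter g0 (n + i) p) n * t ^+ n)%:E) xpredT).
- by move=> n p _ _; rewrite lee_fin expser_term_ge0.
- by move=> n _; apply/measurable_EFinP; exact: measurable_expser_term.
Qed.

Lemma expser_ge0 i t p : 0 <= t -> (0 <= expser g0 i t p)%E.
Proof. by move=> t0; apply: nneseries_ge0 => n _ _; rewrite lee_fin expser_term_ge0. Qed.

Lemma expser_egf i t p : regular g0 p ->
  expser g0 i t p = (egf (fun n => kiter g0 (n + i) p) t)%:E.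
Proof.
move=> [cb _]; rewrite /egf -EFin_lim; last exact: cb.
by apply: congr_lim; apply/funext => N; rewrite /pseries /series/= sumEFin.
Qed.

Lemma fine_expser i t p : regular g0 p ->
  fine (expser g0 i t p) = egf (fun n => kiter g0 (n + i) p) t.
Proof. by move=> /expser_egf ->. Qed.

Lemma flow_ge0 t p : 0 <= t -> 0 <= flow g0 t p.
Proof. by move=> t0; rewrite /flow mulr_ge0 ?expR_ge0// fine_ge0// expser_ge0. Qed.

Lemma measurable_flow t : 0 <= t -> measurable_fun [set: R] (flow g0 t).
Proof.
move=> t0; apply: measurable_funM => //.
exact: (measurableT_comp _ (measurable_expser 0 t0)).
Qed.

Lemma measurable_dflow t : 0 <= t -> measurable_fun [set: R] (dflow g0 t).
Proof.
move=> t0; apply: measurable_funD; apply: measurable_funM => //; first exact: measurable_flow.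
exact: (measurableT_comp _ (measurable_expser 1 t0)).
Qed.

Lemma flow0 p : flow g0 0 p = g0 p.
Proof.
(* only the term n = 0 survives, since 0 ^+ 0 = 1 *)
rewrite /flow mulr0 expR0 mul1r /expser (@nneseries_split _ _ 0 1).
rewrite ?big_mkord big_ord1 expr0 mulr1.
  rewrite eseries0 ?adde0; first by rewrite /ecoef fact0 divr1.
  by move=> n n1 _; rewrite expr0n gtn_eqF// mulr0.
by move=> n _; rewrite lee_fin expser_term_ge0.
Qed.

Lemma flow_taylor (r p : R) : regular g0 p ->
  let M := expR (`|gammaN R| * r) * (1 + `|gammaN R|) ^+ 2 *
     (fine (expser g0 0 r p) + fine (expser g0 1 r p) + fine (expser g0 2 r p)) in
  forall s t, 0 <= s <= r -> 0 <= t <= r ->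
  [/\ `|flow g0 s p - flow g0 t p| <= M * `|s - t|,
      `|dflow g0 s p - dflow g0 t p| <= M * `|s - t| &
      `|flow g0 s p - flow g0 t p - (s - t) * dflow g0 t p| <= M * `|s - t| ^+ 2].
Proof.
move=> rp M s t hs ht; rewrite /M /dflow /flow !fine_expser//.
have [cb _] := rp.
exact: (@damped_egf_taylor R (fun n => kiter g0 n p) (gammaN R) r (fun n => kiter_ge0 n p) cb).
Qed.

End basic.

Section in_space.
Variables (X : fspace R) (K B : R).
Hypothesis gX : good_space X K B.
Variables (g0 : R -> R).
Hypotheses (mg0 : measurable_fun [set: R] g0) (g00 : forall p, 0 <= g0 p).
Hypothesis n0 : (fnorm X g0 < +oo)%E.

Let N0 := fine (fnorm X g0).
Let N0E : fnorm X g0 = N0%:E.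
Proof. by rewrite fineK// ge0_fin_numE// (gs_ge0 gX). Qed.
Let N00 : 0 <= N0. Proof. by rewrite fine_ge0// (gs_ge0 gX). Qed.

Lemma kiter_norm n : (fnorm X (kiter g0 n) <= (K ^+ n * N0)%:E)%E.
Proof.
have K0 := gs_K gX.
elim: n => [|n ih]; first by rewrite expr0 mul1r /= N0E.
have lt : (fnorm X (kiter g0 n) < +oo)%E by apply: le_lt_trans ih _; rewrite ltry.
have [_ h] := gs_op gX (measurable_kiter mg0 g00 n) (kiter_ge0 mg0 g00 n) lt.
apply: le_trans h _; rewrite exprS -mulrA EFinM lee_wpmul2l ?lee_fin//.
Qed.

Lemma kiter_ae_lty n : {ae Leb, forall p : R, 0 < p -> (mconv kerV0 (kiter g0 n) p < +oo)%E}.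
Proof.
apply: (gs_op gX (measurable_kiter mg0 g00 n) (kiter_ge0 mg0 g00 n) _).1.
by apply: le_lt_trans (kiter_norm n) _; rewrite ltry.
Qed.

(** The partial sums are dominated in norm by those of exp(r K), uniformly in
    their length; this is the bound under which [gs_sup] applies. *)
Lemma pseries_kiter_norm i (r : R) N : 0 <= r ->
  (fnorm X (fun p => pseries (ecoef (fun n => kiter g0 (n + i) p)) r N)
    <= (expR (r * K) * K ^+ i * N0)%:E)%E.
Proof.
move=> r0; have K0 := gs_K gX.
have rK0 : 0 <= r * K by rewrite mulr_ge0.
have mps M : measurable_fun [set: R] (fun p => pseries (ecoef (fun n => kiter g0 (n + i) p)) r M).
  by apply: measurable_sum => n; exact: measurable_expser_term.
apply: (@le_trans _ _ (series (exp_coeff (r * K)) N * (K ^+ i * N0))%:E); last first.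
  rewrite lee_fin -mulrA ler_wpM2r ?mulr_ge0 ?exprn_ge0//.
  apply: nondecreasing_cvgn_le; last exact: is_cvg_series_exp_coeff.
  apply/nondecreasing_seqP => n; rewrite /series/= big_nat_recr//= lerDl.
  exact: exp_coeff_ge0.
elim: N => [|N ih].
  (* the empty sum is 0 * g0, whose norm is 0 by homogeneity *)
  have := @gs_scale _ _ _ _ gX 0 g0 (measurable_funTS mg0) (lexx 0).
  move=> h; rewrite [X in (_ <= X)%E](_ : _ = fnorm X (fun p => 0 * g0 p)%R); last first.
    by rewrite h mul0e /series/= big_geq// mul0r.
  apply: (gs_le gX); [exact: measurable_funTS (mps 0%N)|by apply: measurable_funM => //; exact: measurable_funTS|].
  by apply: aeW => p _; rewrite /pseries /series/= big_geq// mul0r.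
have mt : measurable_fun [set: R] (fun p => r ^+ N / N`!%:R * kiter g0 (N + i) p).
  by apply: measurable_funM => //; exact: measurable_kiter.
apply: (@le_trans _ _ (fnorm X (fun p => pseries (ecoef (fun n => kiter g0 (n + i) p)) r N +
    r ^+ N / N`!%:R * kiter g0 (N + i) p))).
  apply: (gs_le gX); [exact: measurable_funTS (mps N.+1)| |].
    by apply: measurable_funTS; apply: measurable_funD; [exact: mps|exact: mt].
  apply: aeW => p _; rewrite /pseries /series/= big_nat_recr//= /ecoef.
  rewrite (_ : kiter g0 (N + i) p / N`!%:R * r ^+ N = r ^+ N / N`!%:R * kiter g0 (N + i) p)//.
  by rewrite mulrC mulrA mulrAC.
apply: le_trans (gs_add gX (measurable_funTS (mps N)) (measurable_funTS mt)) _.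
rewrite (gs_scale gX); [|exact: measurable_funTS (measurable_kiter mg0 g00 _)|by rewrite divr_ge0 ?exprn_ge0].
rewrite /series/= big_nat_recr//= mulrDl EFinD leeD//.
apply: (@le_trans _ _ ((r ^+ N / N`!%:R)%:E * (K ^+ (N + i) * N0)%:E)%E).
  by rewrite lee_wpmul2l ?kiter_norm// lee_fin divr_ge0 ?exprn_ge0.
by rewrite -EFinM lee_fin /exp_coeff/= exprMn exprD le_eqVlt; apply/orP; left; apply/eqP; ring.
Qed.

(** [gs_sup] gives convergence at integer times for all shifts, off a countable
    union of null sets; a power series converging at all integers converges
    everywhere. *)
Lemma regular_ae : {ae Leb, forall p : R, 0 < p -> regular g0 p}.
Proof.
have h1 i k : {ae Leb, forall p : R, 0 < p ->
    cvgn (pseries (ecoef (fun n => kiter g0 (n + i) p)) k%:R)}.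
  have [] := @gs_sup _ _ _ _ gX (fun N p => pseries (ecoef (fun n => kiter g0 (n + i) p)) k%:R N)
    (expR (k%:R * K) * K ^+ i * N0).
  - by move=> N; apply: measurable_funTS; apply: measurable_sum => n; exact: measurable_expser_term.
  - by move=> N p; apply: sumr_ge0 => n _; exact: expser_term_ge0.
  - move=> p; apply/nondecreasing_seqP => n; rewrite /pseries /series/= big_nat_recr//= lerDl.
    exact: expser_term_ge0.
  - by move=> N; exact: pseries_kiter_norm.
  by move=> h _; exact: h.
have h2 : {ae Leb, forall p : R, forall i k, 0 < p ->
    cvgn (pseries (ecoef (fun n => kiter g0 (n + i) p)) k%:R)}.
  by apply: ae_foralln => i; apply: ae_foralln => k; exact: h1.
have h3 : {ae Leb, forall p : R, forall n, 0 < p -> (mconv kerV0 (kiter g0 n) p < +oo)%E}.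
  by apply: ae_foralln => n; exact: kiter_ae_lty.
apply: filterS2 h2 h3 => p c2 c3 p0; split => [i r|n]; last exact: c3.
apply: (@is_cvg_pseries_inside _ _ (Num.truncn `|r|).+1%:R); first exact: c2.
by rewrite [ltRHS]ger0_norm// truncnS_gt.
Qed.

Lemma expser_norm i (r : R) : 0 <= r ->
  (fnorm X (fun p => fine (expser g0 i r p)) <= (B * (expR (r * K) * K ^+ i * N0))%:E)%E.
Proof.
move=> r0; have [_] := @gs_sup _ _ _ _ gX (fun N p => pseries (ecoef (fun n => kiter g0 (n + i) p)) r N)
    (expR (r * K) * K ^+ i * N0)
  (fun N => measurable_funTS (measurable_sum _ (fun n => measurable_expser_term mg0 g00 i r n)))
  ltac:(by move=> N p; apply: sumr_ge0 => n _; exact: expser_term_ge0)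
  ltac:(by move=> p; apply/nondecreasing_seqP => n; rewrite /pseries /series/= big_nat_recr//= lerDl; exact: expser_term_ge0)
  (fun N => pseries_kiter_norm i N r0).
apply.
- apply: measurable_funTS; exact: (measurableT_comp _ (measurable_expser mg0 g00 i r0)).
- by move=> p; rewrite fine_ge0// expser_ge0.
- by apply: filterS regular_ae => p /[apply] rp; rewrite fine_expser//; exact: rp.1.
Qed.

Lemma flow_norm t : 0 <= t ->
  (fnorm X (flow g0 t) <= (expR (gammaN R * t) * (B * expR (t * K)))%:E * fnorm X g0)%E.
Proof.
move=> t0; rewrite (gs_scale gX) ?expR_ge0//; last first.
  by apply: measurable_funTS; exact: (measurableT_comp _ (measurable_expser mg0 g00 0 t0)).
rewrite N0E -EFinM -mulrA EFinM lee_wpmul2l ?lee_fin ?expR_ge0//.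
by have := expser_norm 0 t0; rewrite expr0 mulr1 mulrA.
Qed.

(** The pointwise Taylor bound has, as a function of p, the constant M below,
    which lies in the space; taking norms turns it into Lipschitz continuity and
    a uniform first-order expansion. *)
Lemma flow_taylor_norm (r : R) : 0 <= r -> exists2 C : R, 0 <= C & forall s t : R, 0 <= s <= r -> 0 <= t <= r ->
  [/\ (fnorm X (flow g0 s \- flow g0 t)%R <= (C * `|s - t|)%:E)%E,
      (fnorm X (dflow g0 s \- dflow g0 t)%R <= (C * `|s - t|)%:E)%E &
      s != t -> (fnorm X (fun p => (flow g0 s p - flow g0 t p) / (s - t) - dflow g0 t p)%R <= (C * `|s - t|)%:E)%E].
Proof.
move=> r0.
pose G := expR (`|gammaN R| * r) * (1 + `|gammaN R|) ^+ 2.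
have G0 : 0 <= G by rewrite mulr_ge0 ?expR_ge0// exprn_ge0// addr_ge0.
pose e i p := fine (expser g0 i r p).
have me i : measurable_fun [set: R] (e i) by exact: (measurableT_comp _ (measurable_expser mg0 g00 i r0)).
have e0 i p : 0 <= e i p by rewrite fine_ge0// expser_ge0.
pose M p := G * (e 0%N p + e 1%N p + e 2%N p).
have mM : measurable_fun [set: R] M.
  by apply: measurable_funM => //; apply: measurable_funD => //; exact: measurable_funD.
have M0 p : 0 <= M p by rewrite mulr_ge0// !addr_ge0.
have Mfin : (fnorm X M < +oo)%E.
  have fi i : (fnorm X (e i) < +oo)%E by apply: le_lt_trans (expser_norm i r0) _; rewrite ltry.
  rewrite (gs_scale gX)//; last first.
    by apply: measurable_funTS; apply: measurable_funD => //; exact: measurable_funD.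
  apply: lte_mul_pinfty => //.
  apply: le_lt_trans (gs_add gX _ _) _; [|exact: measurable_funTS|].
    by apply: measurable_funTS; exact: measurable_funD.
  apply: lte_add_pinfty => //; apply: le_lt_trans (gs_add gX _ _) _; [exact: measurable_funTS|exact: measurable_funTS|].
  exact: lte_add_pinfty.
have ME : fnorm X M = (fine (fnorm X M))%:E by rewrite fineK// ge0_fin_numE// (gs_ge0 gX).
exists (fine (fnorm X M)); first by rewrite fine_ge0// (gs_ge0 gX).
move=> s t hs ht.
have bnd (f : R -> R) (c : R) : measurable_fun [set: R] f -> 0 <= c ->
    (forall p, 0 < p -> regular g0 p -> `|f p| <= c * M p) -> (fnorm X f <= (fine (fnorm X M) * c)%:E)%E.
  move=> mf c0 fM; rewrite mulrC EFinM -ME -(gs_scale gX)//; last exact: measurable_funTS.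
  apply: (gs_le gX); [exact: measurable_funTS|by apply: measurable_funTS; exact: measurable_funM|].
  apply: filterS regular_ae => p rp p0; rewrite (ger0_norm (mulr_ge0 c0 (M0 p))).
  exact: (fM p p0 (rp p0)).
have ms : measurable_fun [set: R] (flow g0 s) by apply: measurable_flow => //; case/andP: hs.
have mt : measurable_fun [set: R] (flow g0 t) by apply: measurable_flow => //; case/andP: ht.
have mds : measurable_fun [set: R] (dflow g0 s) by apply: measurable_dflow => //; case/andP: hs.
have mdt : measurable_fun [set: R] (dflow g0 t) by apply: measurable_dflow => //; case/andP: ht.
split.
- apply: bnd => //; first exact: measurable_funB.
  by move=> p p0 rp; have [h _ _] := flow_taylor mg0 g00 rp hs ht; rewrite mulrC.
- apply: bnd => //; first exact: measurable_funB.
  by move=> p p0 rp; have [_ h _] := flow_taylor mg0 g00 rp hs ht; rewrite mulrC.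
- move=> st; apply: bnd => //.
    by apply: measurable_funB => //; apply: measurable_funM => //; exact: measurable_funB.
  move=> p p0 rp; have [_ _ h] := flow_taylor mg0 g00 rp hs ht.
  have st0 : s - t != 0 by rewrite subr_eq0.
  have nst : 0 < `|s - t| by rewrite normr_gt0.
  rewrite -(ler_pM2l nst) -normrM mulrBr mulrCA divff// mulr1.
  suff -> : `|s - t| * (`|s - t| * M p) = M p * `|s - t| ^+ 2 by exact: h.
  by ring.
Qed.

Lemma ge0_cvg0_linear (F : set_system R) {FF : Filter F} (f : R -> \bar R) (t C : R) :
  F --> t -> (forall s, (0 <= f s)%E) ->
  (\forall s \near F, (f s <= (C * `|s - t|)%:E)%E) -> f @ F --> 0%E.
Proof.
move=> Ft f0 fC; apply: (@squeeze_cvge _ _ _ _ (cst 0%E) _ (fun s => (C * `|s - t|)%:E)).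
- by apply: filterS fC => s h; rewrite /= f0.
- exact: cvg_cst.
- apply: cvg_EFin; first exact: nearW.
  rewrite [X in _ --> X](_ : _ = C * `|t - t|); last by rewrite subrr normr0 mulr0.
  by apply: cvgMr; apply: cvg_norm; apply: cvgB => //; exact: cvg_cst.
Qed.

Lemma near_norm_lt (t e : R) : 0 < e -> \forall s \near t, `|s - t| < e.
Proof.
move=> e0; have := nbhsx_ballx t e e0; apply: filterS => s.
by rewrite /ball/= distrC.
Qed.

Lemma flow_mem t : 0 <= t -> fmem X (flow g0 t).
Proof.
move=> t0; apply/(gs_mem gX); split; first exact: measurable_funTS (measurable_flow mg0 g00 t0).
apply: le_lt_trans (flow_norm t0) _; rewrite N0E -EFinM ltry//.
Qed.

Lemma dflow_mem t : 0 <= t -> fmem X (dflow g0 t).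
Proof.
move=> t0; apply/(gs_mem gX); split; first exact: measurable_funTS (measurable_dflow mg0 g00 t0).
have me : measurable_fun [set: R] (fun p => fine (expser g0 1 t p)).
  exact: (measurableT_comp _ (measurable_expser mg0 g00 1 t0)).
have mf := measurable_flow mg0 g00 t0.
apply: le_lt_trans (gs_add gX _ _) _.
- by apply: measurable_funTS; exact: measurable_funM.
- by apply: measurable_funTS; exact: measurable_funM.
apply: lte_add_pinfty.
- apply: (@le_lt_trans _ _ (`|gammaN R|%:E * fnorm X (flow g0 t))%E).
    rewrite -(gs_scale gX)//; last exact: measurable_funTS.
    apply: (gs_le gX); [by apply: measurable_funTS; exact: measurable_funM|by apply: measurable_funTS; exact: measurable_funM|].
    by apply: aeW => p _; rewrite !normrM normr_id.
  by apply: lte_mul_pinfty => //; have /(gs_mem gX)[] := flow_mem t0.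
- rewrite (gs_scale gX) ?expR_ge0//; last exact: measurable_funTS.
  apply: lte_mul_pinfty => //.
  by apply: le_lt_trans (expser_norm 1 t0) _; rewrite ltry.
Qed.

Lemma flow_continuous : continuous_into X `[0, +oo[ (flow g0).
Proof.
split=> t; rewrite /= in_itv/= andbT => t0; first exact: flow_mem.
have t10 : 0 <= t + 1 by rewrite addr_ge0.
have [C C0 h] := flow_taylor_norm t10.
apply: (@ge0_cvg0_linear _ _ _ t C); first exact: cvg_within.
  by move=> s; exact: (gs_ge0 gX).
rewrite near_withinE; near=> s => s0.
have st : `|s - t| < 1 by near: s; exact: near_norm_lt.
have [||//] := h s t.
- by move: s0; rewrite /= in_itv/= andbT => s0; rewrite s0/= -lerBlDl (le_trans (ler_norm _))// ltW.
- by rewrite t0 lerDl ler01.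
Unshelve. all: by end_near. Qed.

Lemma dflow_continuous : continuous_into X `]0, +oo[ (dflow g0).
Proof.
split=> t; rewrite /= in_itv/= andbT => t0; first exact: dflow_mem (ltW t0).
have t10 : 0 <= t + 1 by rewrite addr_ge0// ltW.
have [C C0 h] := flow_taylor_norm t10.
apply: (@ge0_cvg0_linear _ _ _ t C); first exact: cvg_within.
  by move=> s; exact: (gs_ge0 gX).
rewrite near_withinE; near=> s => s0.
have st : `|s - t| < 1 by near: s; exact: near_norm_lt.
have [||//] := h s t.
- by move: s0; rewrite /= in_itv/= andbT => s0; rewrite (ltW s0)/= -lerBlDl (le_trans (ler_norm _))// ltW.
- by rewrite (ltW t0) lerDl ler01.
Unshelve. all: by end_near. Qed.

Lemma flow_derivative : derivative_into X (flow g0) (dflow g0).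
Proof.
move=> t t0; have t10 : 0 <= t + 1 by rewrite addr_ge0// ltW.
have [C C0 h] := flow_taylor_norm t10.
apply: (@ge0_cvg0_linear _ _ _ 0 C); first exact: cvg_within.
  by move=> s; exact: (gs_ge0 gX).
rewrite near_withinE; near=> s => s0.
have st : `|s| < Num.min t 1.
  by rewrite -[s]subr0; near: s; apply: near_norm_lt; rewrite lt_min t0/=.
have [/= st1 st2] : `|s| < t /\ `|s| < 1 by apply/andP; rewrite -lt_min.
have [||_ _] := h (t + s) t.
- rewrite lerD2l (le_trans (ler_norm _) (ltW st2)) andbT -lerBlDl sub0r.
  by move: st1; rewrite ltr_norml => /andP[/ltW].
- by rewrite (ltW t0) lerDl ler01.
have -> : t + s - t = s by ring.
rewrite subr0; apply.
by rewrite -subr_eq0 (_ : t + s - t = s)//; ring.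
Unshelve. all: by end_near. Qed.

End in_space.

Lemma eq_haar_ae (g h : R -> \bar R) : measurable_fun D g -> measurable_fun D h ->
  (forall p, 0 < p -> (0 <= g p)%E) -> (forall p, 0 < p -> (0 <= h p)%E) ->
  {ae Leb, forall p : R, 0 < p -> g p = h p} -> haar g = haar h.
Proof.
move=> mg mh g0 h0 gh; apply/eqP; rewrite eq_le; apply/andP; split.
- by apply: le_haar_ae => //; apply: filterS gh => p /[apply] ->.
- by apply: le_haar_ae => //; apply: filterS gh => p /[apply] ->.
Qed.

Lemma haar_nneseries (h : nat -> R -> \bar R) : (forall n, measurable_fun D (h n)) ->
  (forall n p, 0 < p -> (0 <= h n p)%E) ->
  haar (fun p => \sum_(0 <= n <oo) h n p)%E = (\sum_(0 <= n <oo) haar (h n))%E.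
Proof.
move=> mh h0; rewrite /haar -integral_nneseries//; last 2 first.
- by move=> n; exact: measurable_haar_integrand.
- move=> n p; rewrite /= in_itv/= andbT => p0.
  by rewrite mule_ge0 ?h0// lee_fin invr_ge0 ltW.
apply: eq_integral => p; rewrite inE/= in_itv/= andbT => p0.
rewrite muleC -nneseriesZl; last by move=> n _; exact: h0.
by apply: eq_eseriesr => n _; rewrite muleC.
Qed.

Lemma measurable_mconv_fiber (f : R -> R) (p : R) : measurable_fun [set: R] f ->
  measurable_fun [set: R] (fun q => kerV0 (p / q) * f q).
Proof.
move=> mf; apply: measurable_funM => //.
apply: (measurableT_comp measurable_kerV0).
by apply: measurable_funM => //; exact: measurable_fun_invr.
Qed.

(** [kerV] and [kerV0] agree at p / p' > 0, and f agrees with its absolute value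
    almost everywhere. *)
Lemma kernel_integral (f : R -> R) (p : R) : measurable_fun D f -> ae_ge0 f -> 0 < p ->
  (\int[Leb]_(p' in `]0%R, +oo[) (kerV (p / p') * f p' / p')%:E)%E = mconv kerV0 (posD f) p.
Proof.
move=> mf f0 p0.
transitivity (\int[Leb]_(p' in `]0%R, +oo[) (kerV0 (p / p') * f p' / p')%:E)%E.
  apply: eq_integral => q; rewrite inE/= in_itv/= andbT => q0.
  by rewrite /kerV0 divr_gt0.
apply: ae_eq_integral => //.
- apply/measurable_EFinP; apply: measurable_funM; last by apply: measurable_funTS; exact: measurable_fun_invr.
  apply: measurable_funM => //; apply: measurable_funTS; apply: (measurableT_comp measurable_kerV0).
  by apply: measurable_funM => //; exact: measurable_fun_invr.
- apply: measurable_haar_integrand; apply/measurable_EFinP; apply: measurable_funTS.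
  by apply: measurable_mconv_fiber; exact: measurable_posD.
- apply: filterS f0 => q fq; rewrite /= in_itv/= andbT => q0.
  by rewrite -EFinM /posD q0 ger0_norm// fq.
Qed.

Lemma eq_mconv (k f g : R -> R) p : (forall q, 0 < q -> f q = g q) -> mconv k f p = mconv k g p.
Proof. by move=> fg; apply: eq_haar => q q0; rewrite fg. Qed.

Section equation.
Variables (g0 : R -> R).
Hypotheses (mg0 : measurable_fun [set: R] g0) (g00 : forall p, 0 <= g0 p).
Hypothesis reg : {ae Leb, forall p : R, 0 < p -> regular g0 p}.

(** T commutes with the nonnegative series by monotone convergence:
    T exp(t T) g0 = exp(t T) T g0. *)
Lemma mconv_expser (t p : R) : 0 <= t -> 0 < p -> regular g0 p ->
  mconv kerV0 (fun q => fine (expser g0 0 t q)) p = expser g0 1 t p.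
Proof.
move=> t0 p0 rp.
pose c n := t ^+ n / n`!%:R.
have c0 n : 0 <= c n by rewrite divr_ge0 ?exprn_ge0.
have mE : measurable_fun [set: R] (fun q => fine (expser g0 0 t q)).
  exact: (measurableT_comp _ (measurable_expser mg0 g00 0 t0)).
have E0 q : 0 <= fine (expser g0 0 t q) by rewrite fine_ge0// expser_ge0.
have mh n : measurable_fun [set: R] (fun q => (c n * (kerV0 (p / q) * kiter g0 n q))).
  apply: measurable_funM => //; apply: measurable_mconv_fiber; exact: measurable_kiter.
have h0 n q : 0 <= c n * (kerV0 (p / q) * kiter g0 n q).
  by apply: mulr_ge0 => //; apply: mulr_ge0; [exact: kerV0_ge0|exact: kiter_ge0].
have mS : measurable_fun [set: R] (fun q => \sum_(0 <= n <oo) (c n * (kerV0 (p / q) * kiter g0 n q))%:E)%E.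
  have h1 n q : [set: R] q -> xpredT n -> (0 <= (c n * (kerV0 (p / q) * kiter g0 n q))%:E)%E.
    by move=> _ _; rewrite lee_fin.
  have mh1 n : xpredT n -> measurable_fun [set: R] (fun q => (c n * (kerV0 (p / q) * kiter g0 n q))%:E).
    by move=> _; apply/measurable_EFinP; exact: mh.
  exact: (ge0_emeasurable_sum h1 mh1).
transitivity (haar (fun q => \sum_(0 <= n <oo) (c n * (kerV0 (p / q) * kiter g0 n q))%:E)%E).
  apply: eq_haar_ae.
  - by apply/measurable_EFinP; apply: measurable_funTS; exact: measurable_mconv_fiber.
  - exact: measurable_funTS mS.
  - by move=> q q0; rewrite lee_fin mulr_ge0 ?kerV0_ge0.
  - by move=> q q0; apply: nneseries_ge0 => n _ _; rewrite lee_fin.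
  apply: filterS reg => q /[apply] rq.
  rewrite EFinM fineK; last by rewrite (expser_egf _ _ rq).
  rewrite /expser -nneseriesZl; last by move=> n _; rewrite lee_fin expser_term_ge0.
  apply: eq_eseriesr => n _; rewrite -EFinM /ecoef addn0 /c; congr EFin.
  by ring.
rewrite haar_nneseries; last 2 first.
- by move=> n; apply/measurable_EFinP; exact: measurable_funTS (mh n).
- by move=> n q q0; rewrite lee_fin.
apply: eq_eseriesr => n _.
rewrite (_ : haar _ = ((c n)%:E * mconv kerV0 (kiter g0 n) p)%E); last first.
  rewrite -haarZ//.
  - apply/measurable_EFinP; apply: measurable_funTS; apply: measurable_mconv_fiber; exact: measurable_kiter.
  - by move=> q q0; rewrite lee_fin mulr_ge0 ?kerV0_ge0 ?kiter_ge0.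
rewrite /ecoef addn1 /= -(@fineK _ (mconv kerV0 (kiter g0 n) p)); last first.
  rewrite ge0_fin_numE; first exact: rp.2.
  by apply: mconv_ge0; [exact: kerV0_ge0|exact: kiter_ge0].
by rewrite -EFinM /c; congr EFin; ring.
Qed.

Lemma flow_equation : satisfies_eqn (flow g0) (dflow g0).
Proof.
move=> t t0; apply: filterS reg => p /[swap] p0 /(_ p0) rp.
have mf := measurable_flow mg0 g00 (ltW t0).
rewrite kernel_integral//; last 2 first.
- exact: measurable_funTS.
- by apply: aeW => q _; exact: flow_ge0 (ltW t0).
rewrite (@eq_mconv _ _ (flow g0 t)); last first.
  by move=> q q0; rewrite /posD q0 ger0_norm// flow_ge0// ltW.
have mE : measurable_fun [set: R] (fun q => fine (expser g0 0 t q)).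
  exact: (measurableT_comp _ (measurable_expser mg0 g00 0 (ltW t0))).
have -> : mconv kerV0 (flow g0 t) p = ((expR (gammaN R * t))%:E * expser g0 1 t p)%E.
  rewrite -(mconv_expser (ltW t0) p0 rp) -haarZ ?expR_ge0//.
  - by apply: eq_haar => q q0; rewrite /flow -EFinM mulrCA.
  - by apply/measurable_EFinP; apply: measurable_funTS; exact: measurable_mconv_fiber.
  - by move=> q q0; rewrite lee_fin mulr_ge0 ?kerV0_ge0// fine_ge0// expser_ge0// ltW.
by rewrite (expser_egf _ _ rp) -EFinM -EFinD /dflow (expser_egf 1 t rp).
Qed.

End equation.

Lemma posD_addN_le (f g : R -> R) q : posD f q <= posD g q + posD (f \- g) q.
Proof.
rewrite /posD; case: ifP => _; last by rewrite addr0.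
by have := ler_normD (g q) (f q - g q); rewrite addrC subrK.
Qed.

Lemma mconv_posD_le (f g : R -> R) p : measurable_fun D f -> measurable_fun D g ->
  (mconv kerV0 (posD f) p <= mconv kerV0 (posD g) p + mconv kerV0 (posD (f \- g)%R) p)%E.
Proof.
move=> mf mg.
have mh h : measurable_fun D h -> measurable_fun D (fun q => (kerV0 (p / q) * posD h q)%:E).
  move=> m; apply/measurable_EFinP; apply: measurable_funTS; apply: measurable_mconv_fiber.
  exact: measurable_posD.
have h0 h q : 0 < q -> (0 <= (kerV0 (p / q) * posD h q)%:E)%E.
  by move=> _; rewrite lee_fin mulr_ge0 ?kerV0_ge0 ?posD_ge0.
have mfg : measurable_fun D (f \- g) by exact: measurable_funB.
rewrite /mconv -haarD//; [|exact: mh|exact: mh|exact: h0|exact: h0].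
apply: le_haar => //; [exact: mh|by apply: emeasurable_funD; exact: mh|exact: h0|].
move=> q q0; rewrite -EFinD lee_fin -mulrDr ler_wpM2l ?kerV0_ge0//.
exact: posD_addN_le.
Qed.

(** |T f - T g| <= T |f - g|, at the points where the three integrals
    converge. *)
Lemma mconv_posD_dist (f g : R -> R) p : measurable_fun D f -> measurable_fun D g ->
  (mconv kerV0 (posD f) p < +oo)%E -> (mconv kerV0 (posD g) p < +oo)%E ->
  (mconv kerV0 (posD (f \- g)%R) p < +oo)%E ->
  `|fine (mconv kerV0 (posD f) p) - fine (mconv kerV0 (posD g) p)| <= fine (mconv kerV0 (posD (f \- g)%R) p).
Proof.
move=> mf mg.
have p0 h : (0 <= mconv kerV0 (posD h) p)%E by apply: mconv_ge0; [exact: kerV0_ge0|exact: posD_ge0].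
have fK h : (mconv kerV0 (posD h) p < +oo)%E -> mconv kerV0 (posD h) p = (fine (mconv kerV0 (posD h) p))%:E.
  by move=> ?; rewrite fineK// ge0_fin_numE.
move=> /fK f1 /fK g1 /fK fg1.
have := mconv_posD_le p mf mg; have := mconv_posD_le p mg mf.
have -> : posD (g \- f) = posD (f \- g).
  by apply/funext => q; rewrite /posD/= distrC.
rewrite f1 g1 fg1 -!EFinD !lee_fin/= => h1 h2; rewrite ler_norml; apply/andP; split.
- by rewrite lerBrDl lerBlDr.
- by rewrite lerBlDl.
Qed.

Section well_posed.
Variables (X : fspace R) (K B : R).
Hypothesis gX : good_space X K B.

Lemma eq_lee (x y : \bar R) : x = y -> (x <= y)%E.
Proof. by move=> ->. Qed.

Lemma norm_add_le (f g : R -> R) (a b : R) : measurable_fun D f -> measurable_fun D g ->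
  (fnorm X f <= a%:E)%E -> (fnorm X g <= b%:E)%E -> (fnorm X (fun p => f p + g p)%R <= (a + b)%:E)%E.
Proof. by move=> mf mg fa gb; apply: le_trans (gs_add gX mf mg) _; rewrite EFinD leeD. Qed.

Lemma norm_scale_le (c : R) (f : R -> R) (a : R) : measurable_fun D f ->
  (fnorm X f <= a%:E)%E -> (fnorm X (fun p => c * f p)%R <= (`|c| * a)%:E)%E.
Proof.
move=> mf fa; apply: (@le_trans _ _ (fnorm X (fun p => `|c| * f p)%R)).
  apply: (gs_le gX); [exact: measurable_funM|exact: measurable_funM|].
  by apply: aeW => p _; rewrite !normrM normr_id.
by rewrite (gs_scale gX)// EFinM lee_wpmul2l ?lee_fin.
Qed.

Lemma norm_sub_le (f g : R -> R) (a b : R) : measurable_fun D f -> measurable_fun D g ->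
  (fnorm X f <= a%:E)%E -> (fnorm X g <= b%:E)%E -> (fnorm X (fun p => f p - g p)%R <= (a + b)%:E)%E.
Proof.
move=> mf mg fa gb; have := norm_scale_le (-1) mg gb; rewrite normrN1 mul1r => h.
have mg' : measurable_fun D (fun p => -1 * g p) by exact: measurable_funM.
apply: le_trans (norm_add_le mf mg' fa h).
apply: (gs_le gX); [exact: measurable_funB|exact: measurable_funD|].
by apply: aeW => p _; rewrite mulN1r.
Qed.

Lemma norm_ae_le (f g : R -> R) (a : R) : measurable_fun D f -> measurable_fun D g ->
  {ae Leb, forall p : R, 0 < p -> `|f p| <= `|g p|} ->
  (fnorm X g <= a%:E)%E -> (fnorm X f <= a%:E)%E.
Proof. by move=> mf mg fg; apply: le_trans; exact: (gs_le gX). Qed.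

Lemma norm_posD (f : R -> R) : measurable_fun D f -> fnorm X (posD f) = fnorm X f.
Proof.
move=> mf; have mp : measurable_fun D (posD f) by apply: measurable_funTS; exact: measurable_posD.
by apply/eqP; rewrite eq_le; apply/andP; split; apply: (gs_le gX) => //; apply: aeW => p p0;
  rewrite /posD p0 normr_id.
Qed.

Lemma cvg0_norm_near (F : set_system R) {FF : Filter F} (f : R -> \bar R) (e : R) :
  f @ F --> 0%E -> 0 < e -> \forall s \near F, (f s <= e%:E)%E.
Proof.
move=> f0 e0; have /fine_cvgP[fin cf] := f0.
have /cvgrPdist_lt/(_ _ e0) := cf.
apply: filterS2 fin => s /fineK <-; rewrite sub0r normrN/= lee_fin => h.
by rewrite ltW// (le_lt_trans (ler_norm _)).
Qed.

Lemma solution_measurable (A : R -> R -> R) (I : set R) t : continuous_into X I A -> I t ->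
  measurable_fun D (A t) /\ (fnorm X (A t) < +oo)%E.
Proof. by move=> [h _] It; apply/(gs_mem gX); exact: h. Qed.

Lemma continuous_into_eps (A : R -> R -> R) t (e : R) : continuous_into X `[0, +oo[ A -> 0 <= t -> 0 < e ->
  exists2 d, 0 < d & forall s, 0 <= s -> `|s - t| < d -> (fnorm X (A s \- A t)%R <= e%:E)%E.
Proof.
move=> [_ cA] t0 e0; have It : `[0, +oo[%classic t by rewrite /= in_itv/= t0.
have FF : Filter (within `[0, +oo[ (nbhs t)) by exact: within_filter.
have := @cvg0_norm_near _ FF _ _ (cA t It) e0; rewrite near_withinE => h0.
have /nbhs_ballP[d /= d0 h] := h0.
exists d => // s s0 sd; apply: h; last by rewrite /= in_itv/= s0.
by rewrite /ball/= distrC.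
Qed.

Lemma derivative_into_eps (A DA : R -> R -> R) t (e : R) : derivative_into X A DA -> 0 < t -> 0 < e ->
  exists2 d, 0 < d & forall h, 0 < h < d ->
    (fnorm X (fun p => (A (t + h) p - A t p) / h - DA t p)%R <= e%:E)%E.
Proof.
move=> dA t0 e0.
have FF : Filter (0 : R)^' by exact: within_filter.
have := @cvg0_norm_near _ FF _ _ (dA t t0) e0; rewrite near_withinE => h0.
have /nbhs_ballP[d /= d0 h] := h0.
exists d => // s /andP[s0 sd]; apply: h; last by rewrite gt_eqF.
by rewrite /ball/= sub0r normrN gtr0_norm.
Qed.

(** For the difference w of two solutions, w(t + h) = (1 + h gamma) w + h T w
    + o(h) in norm, where T w is controlled pointwise by T |w|; the norm of w
    then satisfies the hypothesis of [gronwall_le0] with constant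
    |gamma| + K. *)
Lemma nonneg_solution_unique A0 A A' : nonneg_solution X A0 A -> nonneg_solution X A0 A' ->
  forall t, 0 <= t -> ae_eq0oo (A' t) (A t).
Proof.
move=> [cA A0E [DA [cD dA eA]] pA] [cA' A0E' [DA' [cD' dA' eA']] pA'].
have K0 := gs_K gX.
have mA t : 0 <= t -> measurable_fun D (A t) /\ (fnorm X (A t) < +oo)%E.
  by move=> t0; apply: (solution_measurable cA); rewrite /= in_itv/= t0.
have mA' t : 0 <= t -> measurable_fun D (A' t) /\ (fnorm X (A' t) < +oo)%E.
  by move=> t0; apply: (solution_measurable cA'); rewrite /= in_itv/= t0.
have mDA t : 0 < t -> measurable_fun D (DA t).
  by move=> t0; apply: (solution_measurable cD _).1; rewrite /= in_itv/= t0.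
have mDA' t : 0 < t -> measurable_fun D (DA' t).
  by move=> t0; apply: (solution_measurable cD' _).1; rewrite /= in_itv/= t0.
pose w t := (A' t \- A t)%R.
have mw t : 0 <= t -> measurable_fun D (w t).
  by move=> t0; apply: measurable_funB; [exact: (mA' t t0).1|exact: (mA t t0).1].
pose f t := fine (fnorm X (w t)).
have finE (g : R -> R) : (fnorm X g < +oo)%E -> fnorm X g = (fine (fnorm X g))%:E.
  by move=> ?; rewrite fineK// ge0_fin_numE// (gs_ge0 gX).
have wE t : 0 <= t -> fnorm X (w t) = (f t)%:E.
  move=> t0; apply: (finE); have [m1 /finE n1] := mA' t t0; have [m2 /finE n2] := mA t t0.
  by apply: le_lt_trans (norm_sub_le m1 m2 (eq_lee n1) (eq_lee n2)) _; rewrite ltry.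
have f_ge0 t : 0 <= f t by rewrite fine_ge0// (gs_ge0 gX).
have triang s t e : 0 <= s -> 0 <= t -> (fnorm X (A s \- A t)%R <= (e / 2)%:E)%E ->
    (fnorm X (A' s \- A' t)%R <= (e / 2)%:E)%E -> `|f s - f t| <= e.
  move=> s0 t0 hA hA'.
  have m1 : measurable_fun D (A' s \- A' t) by apply: measurable_funB; [exact: (mA' _ s0).1|exact: (mA' _ t0).1].
  have m2 : measurable_fun D (A s \- A t) by apply: measurable_funB; [exact: (mA _ s0).1|exact: (mA _ t0).1].
  have m3 : measurable_fun D (fun p => (A' s \- A' t) p - (A s \- A t) p) by exact: measurable_funB.
  have h := norm_sub_le m1 m2 hA' hA; rewrite -splitr in h.
  rewrite ler_norml; apply/andP; split.
  - rewrite lerBrDl lerBlDr -lee_fin -(wE t t0).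
    have := norm_sub_le (mw s s0) m3 (eq_lee (wE s s0)) h.
    apply: norm_ae_le; [exact: mw|by apply: measurable_funB => //; exact: mw|].
    by apply: aeW => p _; rewrite le_eqVlt; apply/orP; left; apply/eqP; congr `|_|; rewrite /w/=; ring.
  - rewrite lerBlDl -lee_fin -(wE s s0).
    have := norm_add_le (mw t t0) m3 (eq_lee (wE t t0)) h.
    apply: norm_ae_le; [exact: mw|by apply: measurable_funD => //; exact: mw|].
    by apply: aeW => p _; rewrite le_eqVlt; apply/orP; left; apply/eqP; congr `|_|; rewrite /w/=; ring.
have fle0 : forall t, 0 <= t -> f t <= 0.
  apply: (@gronwall_le0 _ _ (`|gammaN R| + K)); first by rewrite addr_ge0.
  - move=> t t0 e e0; have e4 : 0 < e / 2 / 2 by rewrite !divr_gt0.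
    have [d1 d10 h1] := continuous_into_eps cA t0 e4.
    have [d2 d20 h2] := continuous_into_eps cA' t0 e4.
    exists (Num.min d1 d2); first by rewrite lt_min d10.
    move=> s s0; rewrite lt_min => /andP[sd1 sd2].
    apply: (@le_lt_trans _ _ (e / 2)); last by rewrite ltr_pdivrMr// ltr_pMr// ltr1n.
    by apply: triang => //; [exact: h1|exact: h2].
  - rewrite -lee_fin -wE//; have := gs_scale gX (mw 0 (lexx 0)) (lexx 0).
    rewrite mul0e => /eq_lee; apply: norm_ae_le; [exact: mw|by apply: measurable_funM => //; exact: mw|].
    apply: filterS2 A0E A0E' => p h1 h2 p0.
    by rewrite /w/= h1// h2// subrr normr0.
  - move=> t t0 e e0; have e2 : 0 < e / 2 by rewrite divr_gt0.
    have [d1 d10 h1] := derivative_into_eps dA t0 e2.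
    have [d2 d20 h2] := derivative_into_eps dA' t0 e2.
    exists (Num.min d1 d2); first by rewrite lt_min d10.
    move=> h /andP[h0]; rewrite lt_min => /andP[hd1 hd2].
    have t00 := ltW t0.
    have th0 : 0 <= t + h by rewrite addr_ge0// ltW.
    (* z is T A' - T A at time t *)
    pose z p := DA' t p - DA t p - gammaN R * w t p.
    have mz : measurable_fun D z.
      apply: measurable_funB; first by apply: measurable_funB; [exact: mDA'|exact: mDA].
      by apply: measurable_funM => //; exact: mw.
    have nz : (fnorm X z <= (K * f t)%:E)%E.
      have mpw := measurable_posD (mw t t00).
      have pw0 := posD_ge0 (w t).
      have npw : (fnorm X (posD (w t)) < +oo)%E by rewrite norm_posD ?wE ?ltry//; exact: mw.
      have [wae wn] := gs_op gX mpw pw0 npw.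
      rewrite norm_posD in wn; last exact: mw.
      rewrite (wE _ t00) -EFinM in wn.
      apply: norm_ae_le wn => //.
        have mm : measurable_fun [set: R] (mconv kerV0 (posD (w t))).
          by apply: measurable_mconv => //; [exact: measurable_kerV0|exact: kerV0_ge0].
        by apply: measurable_funTS; exact: (measurableT_comp _ mm).
      apply: filterS3 wae (eA t t0) (eA' t t0) => p wp + + p0.
      have {}wp := wp p0.
      move=> /(_ p0); rewrite kernel_integral//; [|exact: (mA t t00).1|exact: pA].
      move=> eqA /(_ p0); rewrite kernel_integral//; [|exact: (mA' t t00).1|exact: pA'].
      move=> eqA'.
      have fin_of (x y : R) (m : \bar R) : x%:E = (y%:E + m)%E -> m = (x - y)%:E.
        case: m => [r| |]//; rewrite -EFinD => -[->]; congr EFin; ring.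
      have EA := fin_of _ _ _ eqA; have EA' := fin_of _ _ _ eqA'.
      have := @mconv_posD_dist (A' t) (A t) p (mA' t t00).1 (mA t t00).1.
      rewrite EA EA' !ltry => /(_ isT isT wp)/= hd.
      apply: (@le_trans _ _ (fine (mconv kerV0 (posD (w t)) p))); last exact: ler_norm.
      by apply: le_trans hd; rewrite le_eqVlt; apply/orP; left; apply/eqP; congr `|_|; rewrite /z /w/=; ring.
    pose rem p := (A (t + h) p - A t p) / h - DA t p.
    pose rem' p := (A' (t + h) p - A' t p) / h - DA' t p.
    have mrem : measurable_fun D rem.
      apply: measurable_funB; last exact: mDA.
      by apply: measurable_funM => //; apply: measurable_funB; [exact: (mA _ th0).1|exact: (mA _ t00).1].
    have mrem' : measurable_fun D rem'.
      apply: measurable_funB; last exact: mDA'.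
      by apply: measurable_funM => //; apply: measurable_funB; [exact: (mA' _ th0).1|exact: (mA' _ t00).1].
    have nr : (fnorm X rem <= (e / 2)%:E)%E by apply: h1; rewrite h0.
    have nr' : (fnorm X rem' <= (e / 2)%:E)%E by apply: h2; rewrite h0.
    have n1 := norm_sub_le mrem' mrem nr' nr; rewrite -splitr in n1.
    have m1 : measurable_fun D (fun p => rem' p - rem p) by exact: measurable_funB.
    have n2 := norm_scale_le h (measurable_funD mz m1) (norm_add_le mz m1 nz n1).
    have m2 : measurable_fun D (fun p => h * (z p + (rem' p - rem p))).
      by apply: measurable_funM => //; exact: measurable_funD.
    have n3 := norm_scale_le (1 + h * gammaN R) (mw t t00) (eq_lee (wE t t00)).
    have m3 : measurable_fun D (fun p => (1 + h * gammaN R) * w t p).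
      by apply: measurable_funM => //; exact: mw.
    have n4 := norm_add_le m3 m2 n3 n2.
    have h_neq0 : h != 0 by rewrite gt_eqF.
    have : f (t + h) <= `|1 + h * gammaN R| * f t + `|h| * (K * f t + e).
      rewrite -lee_fin -(wE _ th0); apply: norm_ae_le n4; [exact: mw|exact: measurable_funD|].
      apply: aeW => p _; rewrite le_eqVlt; apply/orP; left; apply/eqP; congr `|_|.
      by rewrite /w /z /rem /rem' /w/=; field.
    move=> /le_trans; apply; rewrite (gtr0_norm h0).
    have : `|1 + h * gammaN R| * f t <= (1 + h * `|gammaN R|) * f t.
      by rewrite ler_wpM2r// (le_trans (ler_normD _ _))// normr1 normrM (gtr0_norm h0).
    move=> uv; apply: (@le_trans _ _ ((1 + h * `|gammaN R|) * f t + h * (K * f t + e))).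
      by rewrite lerD2r.
    by rewrite le_eqVlt; apply/orP; left; apply/eqP; ring.
move=> t t0.
have : {ae Leb, forall p : R, 0 < p -> w t p = 0}.
  apply: (gs_eq0 gX); first exact: mw.
  by rewrite (wE _ t0); congr EFin; apply/eqP; rewrite eq_le fle0// f_ge0.
by apply: filterS => p h p0; apply/eqP; rewrite -subr_eq0; apply/eqP; exact: h.
Qed.

Lemma posD_norm_lty A0 : fmem X A0 -> (fnorm X (posD A0) < +oo)%E.
Proof. by move=> /(gs_mem gX)[mA nA]; rewrite norm_posD. Qed.

Lemma measurable_posD_mem A0 : fmem X A0 -> measurable_fun [set: R] (posD A0).
Proof. by move=> /(gs_mem gX)[mA _]; exact: measurable_posD. Qed.

Lemma flow_nonneg_solution A0 : fmem X A0 -> ae_ge0 A0 -> nonneg_solution X A0 (flow (posD A0)).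
Proof.
move=> XA0 A00; have m := measurable_posD_mem XA0; have p0 := posD_ge0 A0.
have n := posD_norm_lty XA0.
split.
- exact: (flow_continuous gX).
- apply: filterS A00 => p h p1; rewrite flow0// /posD p1 ger0_norm//; exact: h.
- exists (dflow (posD A0)); split; [exact: (dflow_continuous gX)|exact: (flow_derivative gX)|].
  by apply: flow_equation => //; exact: (regular_ae gX).
- by move=> t t0; apply: aeW => p _; apply: flow_ge0 => //; exact: ltW.
Qed.

Lemma good_well_posed : well_posed_in X.
Proof.
move=> A0 XA0 A00; exists (flow (posD A0)); split; first exact: flow_nonneg_solution.
by move=> A' sA' t t0; exact: nonneg_solution_unique (flow_nonneg_solution XA0 A00) sA' t t0.
Qed.

Lemma solution_eq_flow A0 A t : fmem X A0 -> ae_ge0 A0 -> nonneg_solution X A0 A -> 0 <= t ->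
  ae_eq0oo (A t) (flow (posD A0) t).
Proof. by move=> XA0 A00 sA t0; apply: nonneg_solution_unique sA t t0; exact: flow_nonneg_solution. Qed.

Lemma solution_norm_le A0 A t : fmem X A0 -> ae_ge0 A0 -> nonneg_solution X A0 A -> 0 <= t ->
  (fnorm X (A t) <= (expR (gammaN R * t) * (B * expR (t * K)))%:E * fnorm X A0)%E.
Proof.
move=> XA0 A00 sA t0; have m := measurable_posD_mem XA0.
rewrite -(norm_posD ((gs_mem gX _).1 XA0).1).
apply: le_trans (flow_norm gX m (posD_ge0 A0) (posD_norm_lty XA0) t0).
apply: (gs_le gX).
- by case: sA => cA _ _ _; apply: (solution_measurable cA _).1; rewrite /= in_itv/= t0.
- by apply: measurable_funTS; apply: measurable_flow => //; exact: posD_ge0.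
- by apply: filterS (solution_eq_flow XA0 A00 sA t0) => p /[apply] ->.
Qed.

Lemma good_bounded : bounded_on_finite_times X.
Proof.
move=> T T0; have K0 := gs_K gX; have B0 := gs_B gX.
pose C := expR (`|gammaN R| * T) * (B * expR (T * K)) + 1.
have C1 : 0 <= expR (`|gammaN R| * T) * (B * expR (T * K)) by rewrite !mulr_ge0 ?expR_ge0.
exists C; split; first by rewrite ltr_wpDl.
move=> A0 A XA0 A00 sA t /andP[t0 tT].
apply: le_trans (solution_norm_le XA0 A00 sA t0) _.
rewrite lee_wpmul2r ?(gs_ge0 gX)// lee_fin ler_wpDr//.
rewrite ler_pM ?mulr_ge0 ?expR_ge0// ?ler_expR.
- apply: (@le_trans _ _ (`|gammaN R| * t)); first by rewrite ler_wpM2r// ler_norm.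
  by rewrite ler_wpM2l.
- by rewrite ler_wpM2l// ler_expR ler_wpM2r.
Qed.

End well_posed.

End flow.

(** * Moments of the solutions, and the theorem *)

Lemma tail_exponents (R : realFieldType) (a b s : R) : b < - (3 / 4) -> 1 / 2 < a -> 0 <= s <= 3 / 2 ->
  -1 < 2 * a + s - 1 /\ 0 < - (2 * b + s).
Proof. by move=> ? ? /andP[? ?]; split; lra. Qed.

Section moments.
Context {R : realType}.
Local Notation D := (`]0, +oo[%classic : set R).

Lemma nneseries_exp (x : R) : (\sum_(0 <= n <oo) (exp_coeff x n)%:E = (expR x)%:E)%E.
Proof.
rewrite /expR -EFin_lim; last exact: is_cvg_series_exp_coeff.
by apply: congr_lim; apply/funext => N; rewrite /series/= sumEFin.
Qed.

Section flow_moments.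
Variables (g0 : R -> R).
Hypotheses (mg0 : measurable_fun [set: R] g0) (g00 : forall p, 0 <= g0 p).
Hypothesis reg : {ae Leb, forall p : R, 0 < p -> regular g0 p}.
Variables (s h : R).
Hypotheses (s_range : -2 < s < 5) (gh : haar (fun p => (g0 p * p `^ s)%:E) = h%:E).

Let measurable_weight (f : R -> R) : measurable_fun [set: R] f -> measurable_fun [set: R] (fun p => f p * p `^ s).
Proof. by move=> mf; apply: measurable_funM => //; exact: measurable_powR. Qed.

(** Each convolution multiplies the moment of order s by the total mass of
    V(u) u^s, by [mconv_powR] and [haar_mconv]. *)
Lemma kiter_moment n : haar (fun p => (kiter g0 n p * p `^ s)%:E) = (fine (mellinV s) ^+ n * h)%:E.
Proof.
elim: n => [|n ih]; first by rewrite expr0 mul1r.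
have mk := measurable_kiter mg0 g00. have k0 := kiter_ge0 mg0 g00.
pose k u : R := kerV0 u * u `^ s; pose G p := kiter g0 n p * p `^ s.
have mm : measurable_fun [set: R] (mconv kerV0 (kiter g0 n)).
  by apply: measurable_mconv => //; [exact: measurable_kerV0|exact: kerV0_ge0].
have m0 p : (0 <= mconv kerV0 (kiter g0 n) p)%E by apply: mconv_ge0; [exact: kerV0_ge0|exact: k0].
transitivity (haar (fun p => (p `^ s)%:E * mconv kerV0 (kiter g0 n) p)%E).
  apply: eq_haar_ae.
  - by apply/measurable_EFinP; apply: measurable_funTS; exact: measurable_weight.
  - apply: emeasurable_funM; last exact: measurable_funTS.
    by apply/measurable_EFinP; exact: measurable_powRl.
  - by move=> p p0; rewrite lee_fin mulr_ge0 ?powR_ge0.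
  - by move=> p p0; rewrite mule_ge0// lee_fin powR_ge0.
  apply: filterS reg => p /[apply] rp.
  by rewrite mulrC EFinM /= fineK// ge0_fin_numE// rp.2.
transitivity (haar (mconv k G)).
  by apply: eq_haar => p p0; rewrite (mconv_powR s measurable_kerV0 (mk n) kerV0_ge0 (k0 n) p0).
rewrite haar_mconv.
- rewrite [haar (EFin \o G)]ih -[haar (EFin \o k)]/(mellinV s) -(fineK (mellinV_fin s_range)).
  by rewrite -EFinM exprS mulrA.
- exact: measurable_kerV0X.
- exact: measurable_weight.
- by move=> u; exact: kerV0X_ge0.
- by move=> u; rewrite mulr_ge0 ?powR_ge0.
Qed.

(** Summing the moments of the iterates gives an exponential series in
    t * mellinV s. *)
Lemma flow_moment t : 0 <= t ->
  haar (fun p => (flow g0 t p * p `^ s)%:E) = (expR ((gammaN R + fine (mellinV s)) * t) * h)%:E.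
Proof.
move=> t0.
have k0 := kiter_ge0 mg0 g00.
pose c n := t ^+ n / n`!%:R.
have c0 n : 0 <= c n by rewrite divr_ge0 ?exprn_ge0.
pose H n q : R := c n * (kiter g0 n q * q `^ s).
have mH n : measurable_fun [set: R] (H n).
  by apply: measurable_funM => //; apply: measurable_weight; exact: measurable_kiter.
have H0 n q : 0 <= H n q by apply: mulr_ge0 => //; rewrite mulr_ge0 ?powR_ge0.
have mE : measurable_fun [set: R] (fun q => fine (expser g0 0 t q)).
  exact: (measurableT_comp _ (measurable_expser mg0 g00 0 t0)).
have E0 q : 0 <= fine (expser g0 0 t q) by rewrite fine_ge0// expser_ge0.
have mS : measurable_fun [set: R] (fun q => \sum_(0 <= n <oo) (H n q)%:E)%E.
  have h1 n q : [set: R] q -> xpredT n -> (0 <= (H n q)%:E)%E by move=> _ _; rewrite lee_fin.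
  have mh1 n : xpredT n -> measurable_fun [set: R] (fun q => (H n q)%:E).
    by move=> _; exact/measurable_EFinP.
  exact: (ge0_emeasurable_sum h1 mh1).
transitivity ((expR (gammaN R * t))%:E * haar (fun p => (fine (expser g0 0 t p) * p `^ s)%:E))%E.
  rewrite -haarZ ?expR_ge0//.
  - by apply: eq_haar => p p0; rewrite -EFinM mulrA.
  - by apply/measurable_EFinP; apply: measurable_funTS; exact: measurable_weight.
  - by move=> p p0; rewrite lee_fin mulr_ge0 ?powR_ge0.
rewrite (_ : haar _ = haar (fun q => \sum_(0 <= n <oo) (H n q)%:E)%E); last first.
  apply: eq_haar_ae.
  - by apply/measurable_EFinP; apply: measurable_funTS; exact: measurable_weight.
  - exact: measurable_funTS.
  - by move=> p p0; rewrite lee_fin mulr_ge0 ?powR_ge0.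
  - by move=> p p0; apply: nneseries_ge0 => n _ _; rewrite lee_fin.
  apply: filterS reg => q /[apply] rq.
  rewrite mulrC EFinM fineK; last by rewrite (expser_egf _ _ rq).
  rewrite /expser -nneseriesZl; last by move=> n _; rewrite lee_fin expser_term_ge0.
  apply: eq_eseriesr => n _; rewrite -EFinM /ecoef addn0 /H /c; congr EFin.
  by ring.
rewrite haar_nneseries; last 2 first.
- by move=> n; apply/measurable_EFinP; exact: measurable_funTS.
- by move=> n q q0; rewrite lee_fin.
rewrite (_ : (\sum_(0 <= n <oo) _)%E = (expR (t * fine (mellinV s)) * h)%:E).
  by rewrite -EFinM mulrA -expRD mulrDl [t * _]mulrC.
have h0 : 0 <= h.
  by rewrite -lee_fin -gh; apply: haar_ge0 => p p0; rewrite lee_fin mulr_ge0 ?powR_ge0.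
rewrite [RHS](_ : _ = (h%:E * \sum_(0 <= n <oo) (exp_coeff (t * fine (mellinV s)) n)%:E)%E); last first.
  by rewrite nneseries_exp -EFinM mulrC.
have m0 : 0 <= fine (mellinV s) by rewrite fine_ge0// ltW// mellinV_gt0.
rewrite -nneseriesZl; last by move=> n _; rewrite lee_fin exp_coeff_ge0// mulr_ge0.
apply: eq_eseriesr => n _; rewrite /H.
transitivity ((c n)%:E * haar (fun p => (kiter g0 n p * p `^ s)%:E))%E.
  rewrite -haarZ//.
  - by apply/measurable_EFinP; apply: measurable_funTS; apply: measurable_weight; exact: measurable_kiter.
  - by move=> p p0; rewrite lee_fin mulr_ge0 ?powR_ge0.
rewrite kiter_moment -!EFinM /exp_coeff/= exprMn /c; congr EFin; ring.
Qed.

End flow_moments.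

Lemma integral_eq_haar (f g w : R -> R) (s : R) : measurable_fun D f -> measurable_fun [set: R] g ->
  measurable_fun D w -> ae_eq0oo f g -> (forall p, 0 < p -> w p = p `^ s / p) ->
  (\int[Leb]_(p in `]0%R, +oo[) (f p * w p)%:E = haar (fun p => (g p * p `^ s)%:E))%E.
Proof.
move=> mf mg mw fg wE; apply: ae_eq_integral => //.
- by apply/measurable_EFinP; exact: measurable_funM.
- apply: measurable_haar_integrand; apply/measurable_EFinP; apply: measurable_funM.
    exact: measurable_funTS.
  exact: measurable_powRl.
- apply: filterS fg => p hp; rewrite /= in_itv/= andbT => p0.
  by rewrite hp// wE// -EFinM mulrA.
Qed.

Lemma posD_eq (f : R -> R) : ae_ge0 f -> ae_eq0oo f (posD f).
Proof. by apply: filterS => p h p0; rewrite /posD p0 ger0_norm ?h. Qed.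

Lemma Lq1_moment_lty (theta : R) (f : R -> R) : (Lqnorm 1 theta f < +oo)%E ->
  (haar (fun p => (posD f p * p `^ (2 * theta))%:E) < +oo)%E.
Proof.
rewrite /Lqnorm invr1 poweRe1; last first.
  by apply: integral_ge0 => p _; rewrite lee_fin mulr_ge0 ?powR_ge0.
apply: le_lt_trans; rewrite le_eqVlt; apply/orP; left; apply/eqP.
apply: eq_integral => p; rewrite inE/= in_itv/= andbT => p0.
rewrite -EFinM /posD p0 powRr1// powRB ?(gt_eqF p0) ?implybT// powRr1 ?(ltW p0)//.
by rewrite mulrA.
Qed.

Lemma haar_fin (f : R -> R) : (forall p, 0 < p -> 0 <= f p) -> (haar (EFin \o f) < +oo)%E ->
  haar (EFin \o f) = (fine (haar (EFin \o f)))%:E.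
Proof.
move=> f0 h; rewrite fineK// ge0_fin_numE//.
by apply: haar_ge0 => p p0; rewrite lee_fin f0.
Qed.

Lemma half_line_split (f : R -> \bar R) : measurable_fun D f -> (forall p, 0 < p -> (0 <= f p)%E) ->
  (\int[Leb]_(p in `]0%R, +oo[) f p =
   \int[Leb]_(p in `]0%R, 1%R[) f p + \int[Leb]_(p in `[1%R, +oo[) f p)%E.
Proof.
move=> mf f0; have E : D = `]0, 1[%classic `|` `[1, +oo[%classic.
  apply/seteqP; split => p; rewrite /= !in_itv/= !andbT.
    by move=> p0; have [_|_] := ltP p 1; [left; rewrite p0|right].
  by move=> [/andP[]//|]; exact: lt_le_trans.
rewrite E ge0_integral_setU//=.
- by rewrite -E.
- move=> p [|]; rewrite in_itv/= ?andbT; first by move=> /andP[/f0].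
  by move=> /(lt_le_trans ltr01)/f0.
- rewrite disj_set2E; apply/eqP/seteqP; split => // p [].
  by rewrite /= !in_itv/= andbT => /andP[_ p1]; rewrite leNgt p1.
Qed.

(** The bound p^(2a) is used on (0, 1), p^(2b) beyond; b < - 3/4 is what makes
    the moment of order 3/2 finite. *)
Lemma Y_moment_lty (a b s : R) (f : R -> R) :
  - (5 / 2) < b -> b < - (3 / 4) -> 1 / 2 < a -> a < 1 -> 0 <= s <= 3 / 2 ->
  measurable_fun D f -> (Ynorm a b f < +oo)%E ->
  (haar (fun p => (posD f p * p `^ s)%:E) < +oo)%E.
Proof.
move=> b1 b2 a1 a2 hs mf nf.
have [ea eb] := tail_exponents b2 a1 hs.
set M := fine (Ynorm a b f).
have NE : Ynorm a b f = M%:E by rewrite fineK// ge0_fin_numE// Ynorm_ge0.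
have M0 : 0 <= M by rewrite fine_ge0// Ynorm_ge0.
have bd := @Ynorm_bounds R a b b1 b2 a1 a2 f M; rewrite -NE lexx in bd; have {}bd := bd isT.
have mg : measurable_fun D (fun p => (posD f p * p `^ s)%:E * (p^-1)%:E)%E.
  apply: measurable_haar_integrand; apply/measurable_EFinP; apply: measurable_funM.
    by apply: measurable_funTS; exact: measurable_posD.
  exact: measurable_powRl.
have g0 (p : R) : 0 < p -> (0 <= (posD f p * p `^ s)%:E * (p^-1)%:E)%E.
  by move=> p0; rewrite -EFinM lee_fin !mulr_ge0 ?posD_ge0 ?powR_ge0// invr_ge0 ltW.
have bnd (I : set R) (c e : R) : measurable I -> I `<=` D ->
    {ae Leb, forall p : R, 0 < p -> `|f p| <= M * p `^ c} -> c + s - 1 = e ->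
    (\int[Leb]_(p in I) (p `^ e)%:E < +oo)%E ->
    (\int[Leb]_(p in I) ((posD f p * p `^ s)%:E * (p^-1)%:E) < +oo)%E.
  move=> mI ID fc ce fin.
  have mp : measurable_fun I (fun p => (p `^ e)%:E).
    apply/measurable_EFinP; apply: measurable_funTS; exact: measurable_powR.
  apply: (@le_lt_trans _ _ (M%:E * \int[Leb]_(p in I) (p `^ e)%:E)%E); last exact: lte_mul_pinfty.
  rewrite -ge0_integralZl//; last by move=> p _; rewrite lee_fin powR_ge0.
  apply: ae_ge0_le_integral => //.
  - by move=> p /ID; rewrite /= in_itv/= andbT; exact: g0.
  - exact: measurable_funS mg.
  - by move=> p _; rewrite mule_ge0// lee_fin powR_ge0.
  - exact: measurable_funeM.
  - apply: filterS fc => p hp /ID; rewrite /= in_itv/= andbT => p0.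
    rewrite -!EFinM lee_fin -ce powRB ?(gt_eqF p0) ?implybT// powRr1 ?(ltW p0)//.
    rewrite powRD ?(gt_eqF p0) ?implybT// !mulrA ler_wpM2r ?invr_ge0 ?(ltW p0)//.
    by rewrite ler_wpM2r ?powR_ge0// /posD p0 hp.
rewrite /haar half_line_split//; apply: lte_add_pinfty.
- apply: (@bnd _ (2 * a) (2 * a + s - 1)) => //.
  + by move=> p; rewrite /= !in_itv/= andbT => /andP[].
  + by apply: filterS bd => p h /h[].
  + exact: integral_powR_01.
- apply: (@bnd _ (2 * b) (- - (2 * b + s) - 1)) => //.
  + by move=> p; rewrite /= !in_itv/= !andbT; exact: lt_le_trans.
  + by apply: filterS bd => p h /h[].
  + by rewrite opprK.
  + exact: integral_powR_1y.
Qed.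

Lemma expR_decay (c k e : R) : 0 < c -> 0 <= k -> 0 < e ->
  exists2 T, 0 < T & forall t, T < t -> k * expR (- (c * t)) <= e.
Proof.
move=> c0 k0 e0; exists (k / e / c + 1).
  by rewrite ltr_wpDl// !divr_ge0// ltW.
move=> t Tt; rewrite expRN ler_pdivrMr ?expR_gt0//.
have h : 1 + c * t <= expR (c * t) by exact: expR_ge1Dx.
have : k / e / c <= t by apply: ltW; apply: lt_trans Tt; rewrite ltrDl.
rewrite ler_pdivrMr// ler_pdivrMr// => hk.
apply: (le_trans hk); rewrite mulrC ler_wpM2l ?(ltW e0)//.
by rewrite mulrC; apply: le_trans h; rewrite lerDr.
Qed.

Lemma cvg_ereal_eps (f : R -> \bar R) (l : R) :
  (forall e, 0 < e -> exists2 T, 0 < T & forall t, T < t -> (`|f t - l%:E| <= e%:E)%E) ->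
  f @ +oo%R --> l%:E.
Proof.
move=> h.
have fin t e : (`|f t - l%:E| <= e%:E)%E -> f t \is a fin_num.
  by case: (f t).
apply/fine_cvgP; split.
  have [T _ hT] := h 1 ltr01; exists T; split; first exact: num_real.
  by move=> t /hT; exact: fin.
apply/cvgrPdist_le => e e0; have [T _ hT] := h e e0.
exists T; split; first exact: num_real.
move=> t /hT hf /=; have := hf; rewrite -{1}(fineK (fin _ _ hf)) -EFinB/= lee_fin.
by rewrite distrC.
Qed.

(** If phi is close to c up to a multiple of p^(1/2), then the integral of
    U phi is close to c times the mass of U as soon as the moment of order 3/2
    of U (its integral against p^(1/2) dp) is small. *)
Lemma integral_near_const (U phi : R -> R) (c e C m k : R) :
  measurable_fun [set: R] U -> (forall p, 0 <= U p) -> measurable_fun D phi ->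
  0 <= e -> 0 <= C ->
  haar (fun p => (U p * p `^ 1)%:E) = m%:E ->
  haar (fun p => (U p * p `^ (3 / 2))%:E) = k%:E ->
  {ae Leb, forall p : R, 0 < p -> `|phi p - c| <= e + C * p `^ (1 / 2)} ->
  (`| \int[Leb]_(p in `]0%R, +oo[) (U p * phi p)%:E - (c * m)%:E | <= (e * m + C * k)%:E)%E.
Proof.
move=> mU U0 mphi e0 C0 Um Uk hphi.
have mUD : measurable_fun D U by exact: measurable_funTS.
have mp : measurable_fun D (fun p : R => p `^ (1 / 2)) by exact: measurable_powRl.
have UmE : (\int[Leb]_(p in D) (U p)%:E = m%:E)%E.
  rewrite -Um; apply: eq_integral => p; rewrite inE/= in_itv/= andbT => p0.
  by rewrite -EFinM powRr1 ?(ltW p0)// mulfK// gt_eqF.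
have UkE : (\int[Leb]_(p in D) (U p * p `^ (1 / 2))%:E = k%:E)%E.
  rewrite -Uk; apply: eq_integral => p; rewrite inE/= in_itv/= andbT => p0.
  rewrite -EFinM (_ : 3 / 2 = 1 / 2 + 1 :> R); last by field.
  by rewrite powRD ?(gt_eqF p0) ?implybT// powRr1 ?(ltW p0)// mulrA mulfK// gt_eqF.
pose G p := U p * (e + C * p `^ (1 / 2)).
have mG : measurable_fun D G.
  by apply: measurable_funM => //; apply: measurable_funD => //; exact: measurable_funM.
have G0 p : 0 <= G p by rewrite mulr_ge0// addr_ge0// mulr_ge0// powR_ge0.
have GE : (\int[Leb]_(p in D) (G p)%:E = (e * m + C * k)%:E)%E.
  transitivity (\int[Leb]_(p in D) (e%:E * (U p)%:E + C%:E * (U p * p `^ (1 / 2))%:E))%E.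
    by apply: eq_integral => p _; rewrite -!EFinM -EFinD /G; congr EFin; ring.
  have m1 : measurable_fun D (fun p => (U p)%:E) by exact/measurable_EFinP.
  have m2 : measurable_fun D (fun p => (U p * p `^ (1 / 2))%:E).
    by apply/measurable_EFinP; exact: measurable_funM.
  rewrite ge0_integralD//.
  - rewrite !ge0_integralZl//.
    + by rewrite UmE UkE.
    + by move=> p _; rewrite lee_fin mulr_ge0 ?powR_ge0.
    + by move=> p _; rewrite lee_fin.
  - by move=> p _; rewrite mule_ge0// lee_fin.
  - exact: measurable_funeM.
  - by move=> p _; rewrite mule_ge0// lee_fin mulr_ge0 ?powR_ge0.
  - exact: measurable_funeM.
pose F p := U p * (phi p - c).
have mF : measurable_fun D F.
  by apply: measurable_funM => //; exact: measurable_funB.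
have FG : {ae Leb, forall p : R, D p -> (`|(F p)%:E| <= (G p)%:E)%E}.
  apply: filterS hphi => p hp; rewrite /= in_itv/= andbT => p0.
  by rewrite lee_fin normrM (ger0_norm (U0 p)) ler_wpM2l// hp.
have intF : (\int[Leb]_(p in D) `|(F p)%:E| <= (e * m + C * k)%:E)%E.
  rewrite -GE; apply: ae_ge0_le_integral => //.
  - by apply: measurableT_comp => //; exact/measurable_EFinP.
  - by move=> p _; rewrite lee_fin.
  - exact/measurable_EFinP.
have iF : Leb.-integrable D (EFin \o F).
  apply/integrableP; split; first exact/measurable_EFinP.
  by apply: le_lt_trans intF _; rewrite ltry.
have iU : Leb.-integrable D (EFin \o U).
  apply/integrableP; split; first exact/measurable_EFinP.
  rewrite (_ : (\int[_]_(_ in _) _)%E = m%:E) ?ltry// -UmE.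
  by apply: eq_integral => p _; rewrite /= ger0_norm.
have -> : (\int[Leb]_(p in D) (U p * phi p)%:E = \int[Leb]_(p in D) (F p)%:E + (c * m)%:E)%E.
  transitivity (\int[Leb]_(p in D) ((EFin \o F) p + c%:E * (EFin \o U) p))%E.
    by apply: eq_integral => p _; rewrite /= -!EFinM -EFinD /F; congr EFin; ring.
  rewrite integralD//; last exact: integrableZl.
  by rewrite integralZl// [(\int[_]_(_ in _) (EFin \o U) _)%E]UmE EFinM.
rewrite addeK//; apply: le_trans intF; apply: le_abse_integral => //.
exact/measurable_EFinP.
Qed.

(** Near 0 continuity gives e; away from 0, phi is bounded and p^(1/2) is
    bounded below. *)
Lemma continuous_near_zero_bound (phi : R -> R) (e : R) : {within `[0, +oo[, continuous phi} ->
  (exists M : R, {ae Leb, forall p : R, 0 < p -> `|phi p| <= M}) -> 0 < e ->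
  measurable_fun D phi /\ exists2 C : R, 0 <= C &
    {ae Leb, forall p : R, 0 < p -> `|phi p - phi 0| <= e + C * p `^ (1 / 2)}.
Proof.
move=> /continuous_within_itvcyP[cphi phi0] [M phiM] e0; split.
  apply: open_continuous_measurable_fun; first exact: interval_open.
  by move=> x; rewrite inE; exact: cphi.
have /cvgrPdist_le/(_ _ e0) := phi0; rewrite near_withinE => hh.
have /nbhs_ballP[d /= d0 hd] := hh.
have d2 : 0 < d `^ (1 / 2) by exact: powR_gt0.
exists ((`|M| + `|phi 0|) / d `^ (1 / 2)); first by rewrite divr_ge0 ?addr_ge0// ltW.
apply: filterS phiM => p hM p0; have [pd|dp] := ltP p d.
  apply: (@le_trans _ _ e).
    rewrite distrC; apply: hd => //.
    by rewrite /ball/= sub0r normrN gtr0_norm.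
  by rewrite lerDl mulr_ge0 ?powR_ge0// divr_ge0 ?addr_ge0// ltW.
apply: (@le_trans _ _ (`|M| + `|phi 0|)).
  apply: (le_trans (ler_normB _ _)); rewrite lerD2r.
  by apply: (le_trans (hM p0)); exact: ler_norm.
rewrite ler_wpDl ?(ltW e0)// mulrAC ler_pdivlMr// ler_wpM2l ?addr_ge0//.
by rewrite ge0_ler_powR ?nnegrE// ltW.
Qed.

(** Every solution is the explicit one, whose moments are known. *)
Lemma solution_moment (X : fspace R) (K B s : R) (A0 : R -> R) (A : R -> R -> R) (t : R) :
  good_space X K B -> fmem X A0 -> ae_ge0 A0 -> nonneg_solution X A0 A ->
  -2 < s < 5 -> (haar (fun p => (posD A0 p * p `^ s)%:E) < +oo)%E -> 0 <= t ->
  [/\ measurable_fun D (A t), ae_eq0oo (A t) (flow (posD A0) t) &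
   haar (fun p => (flow (posD A0) t p * p `^ s)%:E) =
    ((expR ((gammaN R + fine (mellinV s)) * t))%:E * haar (fun p => (posD A0 p * p `^ s)%:E))%E].
Proof.
move=> gX XA0 A00 sA hs fin t0.
have m := measurable_posD_mem gX XA0; have p0 := posD_ge0 A0.
split.
- by case: sA => cA _ _ _; apply: (solution_measurable gX cA _).1; rewrite /= in_itv/= t0.
- exact: (solution_eq_flow gX).
have E := @haar_fin (fun p => posD A0 p * p `^ s) _ fin.
rewrite [X in (_ * X)%E]E; last by move=> p _; rewrite mulr_ge0 ?powR_ge0.
rewrite -EFinM; apply: flow_moment => //.
- exact: (regular_ae gX m p0 (posD_norm_lty gX XA0)).
- by apply: E => p _; rewrite mulr_ge0 ?powR_ge0.
Qed.

(** dp = p dp/p, and the moment of order 1 has rate gammaN + mellinV 1 = 0. *)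
Lemma wave_action_conserved (A0 : R -> R) (A : R -> R -> R) :
  fmem (Lq 1 (1 / 2)) A0 -> ae_ge0 A0 -> nonneg_solution (Lq 1 (1 / 2)) A0 A ->
  forall t : R, 0 < t ->
    (\int[Leb]_(p in `]0%R, +oo[) (A t p)%:E = \int[Leb]_(p in `]0%R, +oo[) (A0 p)%:E)%E.
Proof.
move=> XA0 A00 sA t t0.
have th : -1 < (1 / 2 : R) < 5 / 2 by apply/andP; split; lra.
have gX := good_Lq (lexx 1) th.
have [mA0 nA0] := (gs_mem gX _).1 XA0.
have fin := Lq1_moment_lty nA0.
have e1 : 2 * (1 / 2) = 1 :> R by field.
rewrite e1 in fin.
have s1 : -2 < (1 : R) < 5 by apply/andP; split; lra.
have [mA AE H] := solution_moment gX XA0 A00 sA s1 fin (ltW t0).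
have g0 : gammaN R + fine (mellinV 1) = 0 by rewrite gammaN_mellinV addNr.
rewrite g0 mul0r expR0 mul1e in H.
have toH (f g : R -> R) : measurable_fun D f -> measurable_fun [set: R] g -> ae_eq0oo f g ->
    (\int[Leb]_(p in `]0%R, +oo[) (f p)%:E = haar (fun p => (g p * p `^ 1)%:E))%E.
  move=> mf mg fg; rewrite -(@integral_eq_haar f g (cst 1))//.
  - by apply: eq_integral => p _; rewrite mulr1.
  - by move=> p p0; rewrite powRr1 ?(ltW p0)// divff// gt_eqF.
rewrite (toH _ _ mA _ AE) ?(toH _ _ mA0 _ (posD_eq A00)) ?H//.
- exact: measurable_posD.
- by apply: measurable_flow => //; [exact: measurable_posD|exact: posD_ge0|exact: ltW].
Qed.

(** gammaN = - mellinV 1, so this is [mellinV_1_lt_3]. *)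
Lemma energy_growth_rate_gt0 : 0 < gammaN R + fine (mellinV 3).
Proof.
have f1 : @mellinV R 1 \is a fin_num by apply: mellinV_fin; lra.
have f3 : @mellinV R 3 \is a fin_num by apply: mellinV_fin; lra.
by rewrite gammaN_mellinV addrC subr_gt0 -lte_fin (fineK f1) (fineK f3) mellinV_1_lt_3.
Qed.

(** p^2 dp = p^3 dp/p, a moment of order 3. *)
Lemma energy_exponential (A0 : R -> R) (A : R -> R -> R) :
  fmem (Lq 1 (3 / 2)) A0 -> ae_ge0 A0 -> nonneg_solution (Lq 1 (3 / 2)) A0 A ->
  forall t : R, 0 < t ->
    (\int[Leb]_(p in `]0%R, +oo[) (A t p * p ^+ 2)%:E =
     (expR ((gammaN R + fine (mellinV 3)) * t))%:E * \int[Leb]_(p in `]0%R, +oo[) (A0 p * p ^+ 2)%:E)%E.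
Proof.
move=> XA0 A00 sA t t0.
have th : -1 < (3 / 2 : R) < 5 / 2 by apply/andP; split; lra.
have gX := good_Lq (lexx 1) th.
have [mA0 nA0] := (gs_mem gX _).1 XA0.
have fin := Lq1_moment_lty nA0.
have e1 : 2 * (3 / 2) = 3 :> R by field.
rewrite e1 in fin.
have s1 : -2 < (3 : R) < 5 by apply/andP; split; lra.
have [mA AE H] := solution_moment gX XA0 A00 sA s1 fin (ltW t0).
have toH (f g : R -> R) : measurable_fun D f -> measurable_fun [set: R] g -> ae_eq0oo f g ->
    (\int[Leb]_(p in `]0%R, +oo[) (f p * p ^+ 2)%:E = haar (fun p => (g p * p `^ 3)%:E))%E.
  move=> mf mg fg; apply: integral_eq_haar => // p p0.
  rewrite (_ : p `^ 3 = p ^+ 2 * p); first by rewrite mulfK// gt_eqF.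
  by rewrite powR_mulrn ?(ltW p0)// exprSr.
rewrite (toH _ _ mA _ AE) ?(toH _ _ mA0 _ (posD_eq A00)) ?H//.
- exact: measurable_posD.
- by apply: measurable_flow => //; [exact: measurable_posD|exact: posD_ge0|exact: ltW].
Qed.

Lemma half_moment_decay_rate : 0 < - (gammaN R + fine (mellinV (3 / 2))).
Proof.
have f1 : @mellinV R 1 \is a fin_num by apply: mellinV_fin; lra.
have f32 : @mellinV R (3 / 2) \is a fin_num by apply: mellinV_fin; lra.
by rewrite gammaN_mellinV opprD opprK subr_gt0 -lte_fin (fineK f1) (fineK f32) mellinV_32_lt_1.
Qed.

(** The mass is constant (order 1) and the moment of order 3/2 decays
    exponentially; [integral_near_const] then applies with c = phi 0. *)
Lemma solution_concentrates_at_zero (a b : R) : - (5 / 2) < b -> b < - (3 / 4) -> 1 / 2 < a -> a < 1 ->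
  forall (A0 : R -> R) (A : R -> R -> R),
    fmem (Yspace a b) A0 -> ae_ge0 A0 -> nonneg_solution (Yspace a b) A0 A ->
  forall phi : R -> R, {within `[0, +oo[, continuous phi} ->
    (exists M : R, {ae Leb, forall p : R, 0 < p -> `|phi p| <= M}) ->
    (fun t : R => \int[Leb]_(p in `]0%R, +oo[) (A t p * phi p)%:E)%E @ +oo%R
      --> ((phi 0)%:E * \int[Leb]_(p in `]0%R, +oo[) (A0 p)%:E)%E.
Proof.
move=> b1 b2 a1 a2 A0 A XA0 A00 sA phi cphi bphi.
have gX := good_Y b1 b2 a1 a2.
have [mA0 nA0] := (gs_mem gX _).1 XA0.
have s1 : -2 < (1 : R) < 5 by apply/andP; split; lra.
have s32 : -2 < (3 / 2 : R) < 5 by apply/andP; split; lra.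
have r1 : 0 <= (1 : R) <= 3 / 2 by apply/andP; split; lra.
have r32 : 0 <= (3 / 2 : R) <= 3 / 2 by apply/andP; split; lra.
have fin1 := Y_moment_lty b1 b2 a1 a2 r1 mA0 nA0.
have fin32 := Y_moment_lty b1 b2 a1 a2 r32 mA0 nA0.
have m := measurable_posD mA0; have p0 := posD_ge0 A0.
have w0 (s p : R) : 0 < p -> 0 <= posD A0 p * p `^ s by move=> _; rewrite mulr_ge0 ?powR_ge0.
have E1 := haar_fin (w0 1) fin1; have E32 := haar_fin (w0 (3 / 2)) fin32.
set m1 := fine _ in E1; set m32 := fine _ in E32.
have m10 : 0 <= m1 by rewrite fine_ge0// haar_ge0// => p pp; rewrite lee_fin w0.
have m320 : 0 <= m32 by rewrite fine_ge0// haar_ge0// => p pp; rewrite lee_fin w0.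
have A0E : (\int[Leb]_(p in `]0%R, +oo[) (A0 p)%:E = m1%:E)%E.
  rewrite -E1 -(@integral_eq_haar A0 (posD A0) (cst 1))//.
  - by apply: eq_integral => p _; rewrite mulr1.
  - exact: posD_eq.
  - by move=> p pp; rewrite powRr1 ?(ltW pp)// divff// gt_eqF.
rewrite A0E -EFinM; apply: cvg_ereal_eps => e e0.
have e1 : 0 < e / 2 / (m1 + 1) by rewrite !divr_gt0// ltr_wpDl.
have [mphi [C C0 hC]] := continuous_near_zero_bound cphi bphi e1.
have e2 : 0 < e / 2 by rewrite divr_gt0.
have [T T0 hT] := expR_decay half_moment_decay_rate (mulr_ge0 C0 m320) e2.
exists T => // t Tt; have t0 : 0 <= t by rewrite ltW// (lt_trans T0).
have [mA AE H1] := solution_moment gX XA0 A00 sA s1 fin1 t0.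
have [_ _ H32] := solution_moment gX XA0 A00 sA s32 fin32 t0.
have mU := measurable_flow m p0 t0.
have -> : (\int[Leb]_(p in `]0%R, +oo[) (A t p * phi p)%:E =
           \int[Leb]_(p in `]0%R, +oo[) (flow (posD A0) t p * phi p)%:E)%E.
  apply: ae_eq_integral => //.
  - by apply/measurable_EFinP; exact: measurable_funM.
  - by apply/measurable_EFinP; apply: measurable_funM => //; exact: measurable_funTS.
  - by apply: filterS AE => p hp; rewrite /= in_itv/= andbT => pp; rewrite hp.
have g0 : gammaN R + fine (mellinV 1) = 0 by rewrite gammaN_mellinV addNr.
rewrite g0 mul0r expR0 mul1e [RHS]E1 in H1.
rewrite [X in (_ * X)%E]E32 -EFinM in H32.
have h := integral_near_const mU (fun p => flow_ge0 m p0 p t0) mphi (ltW e1) C0 H1 H32 hC.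
apply: le_trans h _; rewrite lee_fin.
have := hT t Tt; rewrite mulNr opprK => hT'.
rewrite [leRHS]splitr lerD//; last first.
  by apply: le_trans hT'; rewrite mulrCA mulrC.
by rewrite mulrAC ler_pdivrMr ?ltr_wpDl// ler_wpM2l ?(ltW e2)// lerDl.
Qed.

Lemma expR_le_affine (n t : R) : 1 <= n -> 0 <= t ->
  expR (n * t) <= 1 + n * (expR (n * t) - 1).
Proof.
move=> n1 t0; have : 1 <= expR (n * t) by rewrite -[leLHS]expR0 ler_expR mulr_ge0// (le_trans _ n1).
set x := expR _ => x1; have h : 0 <= (n - 1) * (x - 1) by rewrite mulr_ge0 ?subr_ge0.
by rewrite -subr_ge0 (_ : 1 + n * (x - 1) - x = (n - 1) * (x - 1))//; ring.
Qed.

(** For theta = 0 the operator norm K is the L^1_0 norm of the kernel, and the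
    exponential series gives a bound that is at least as good. *)
Lemma Lq0_norm_bound (q : R) (A0 : R -> R) (A : R -> R -> R) : 1 <= q ->
  fmem (Lq q 0) A0 -> ae_ge0 A0 -> nonneg_solution (Lq q 0) A0 A ->
  let nV := fine (Lqnorm 1 0 (@kerV R)) in
  forall t : R, 0 <= t ->
    (Lqnorm q 0 (A t) <=
       (expR (gammaN R * t) * (1 + nV * (expR (nV * t) - 1)))%:E * Lqnorm q 0 A0)%E.
Proof.
move=> q1 XA0 A00 sA nV t t0.
have th : -1 < (0 : R) < 5 / 2 by apply/andP; split; lra.
have gX := good_Lq q1 th.
have nVE : nV = fine (mellinV 0) by rewrite /nV Lqnorm_mellinV.
have e0 : 2 * 0 / q = 0 :> R by rewrite mulr0 mul0r.
rewrite e0 -nVE in gX.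
have nV1 : 1 <= nV.
  by rewrite -lee_fin nVE fineK ?mellinV_0_ge1//; apply: mellinV_fin; lra.
apply: le_trans (solution_norm_le gX XA0 A00 sA t0) _.
rewrite lee_wpmul2r ?(gs_ge0 gX)// lee_fin ler_wpM2l ?expR_ge0// mul1r [t * _]mulrC.
exact: expR_le_affine.
Qed.

End moments.

Unset Implicit Arguments.

Theorem theorem1p4 (R : realType) :
  (* well-posedness (i) *)
  (forall q theta : R, 1 <= q -> -1 < theta < 5 / 2 ->
     well_posed_in (Lq q theta) /\ bounded_on_finite_times (Lq q theta)) /\
  (forall (q : R) (A0 : R -> R) (A : R -> R -> R), 1 <= q ->
     fmem (Lq q 0) A0 -> ae_ge0 A0 -> nonneg_solution (Lq q 0) A0 A ->
     let nV := fine (Lqnorm 1 0 (@kerV R)) in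
     forall t : R, 0 <= t ->
       (Lqnorm q 0 (A t) <=
          (expR (gammaN R * t) * (1 + nV * (expR (nV * t) - 1)))%:E
          * Lqnorm q 0 A0)%E) /\
  (* well-posedness (ii) *)
  (forall a b : R, - (5 / 2) < b -> b < - (3 / 4) -> 1 / 2 < a -> a < 1 ->
     well_posed_in (Yspace a b) /\ bounded_on_finite_times (Yspace a b)) /\
  (* conservation of wave action *)
  (forall (A0 : R -> R) (A : R -> R -> R),
     fmem (Lq 1 (1 / 2)) A0 -> ae_ge0 A0 ->
     nonneg_solution (Lq 1 (1 / 2)) A0 A ->
     forall t : R, 0 < t ->
       (\int[Leb]_(p in `]0%R, +oo[) (A t p)%:E
        = \int[Leb]_(p in `]0%R, +oo[) (A0 p)%:E)%E) /\
  (* non-conservation of energy *)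
  (exists kappa : R, 0 < kappa /\
     forall (A0 : R -> R) (A : R -> R -> R),
       fmem (Lq 1 (3 / 2)) A0 -> ae_ge0 A0 ->
       nonneg_solution (Lq 1 (3 / 2)) A0 A ->
       forall t : R, 0 < t ->
         (\int[Leb]_(p in `]0%R, +oo[) (A t p * p ^+ 2)%:E
          = (expR (kappa * t))%:E
            * \int[Leb]_(p in `]0%R, +oo[) (A0 p * p ^+ 2)%:E)%E) /\
  (* long time behaviour *)
  (forall a b : R, - (5 / 2) < b -> b < - (3 / 4) -> 1 / 2 < a -> a < 1 ->
     forall (A0 : R -> R) (A : R -> R -> R),
       fmem (Yspace a b) A0 -> ae_ge0 A0 ->
       nonneg_solution (Yspace a b) A0 A ->
     forall phi : R -> R,
       {within `[0, +oo[, continuous phi} ->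
       (exists M : R, {ae Leb, forall p : R, 0 < p -> `|phi p| <= M}) ->
       (fun t : R => \int[Leb]_(p in `]0%R, +oo[) (A t p * phi p)%:E)%E
         @ +oo%R
       --> ((phi 0)%:E * \int[Leb]_(p in `]0%R, +oo[) (A0 p)%:E)%E).
Proof.
split; last split; last split; last split; last split.
- move=> q theta q1 th; have gX := good_Lq q1 th.
  by split; [exact: good_well_posed gX|exact: good_bounded gX].
- exact: Lq0_norm_bound.
- move=> a b b1 b2 a1 a2; have gX := good_Y b1 b2 a1 a2.
  by split; [exact: good_well_posed gX|exact: good_bounded gX].
- exact: wave_action_conserved.
- exists (gammaN R + fine (mellinV 3)); split; first exact: energy_growth_rate_gt0.
  exact: energy_exponential.
- exact: solution_concentrates_at_zero.
Qed.
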